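(* Let $\alpha\ge 2$, $0<\beta<1$, and let $\mu$ be a positive Borel measure on $[0,1)$. The following conditions are equivalent: (i) $\mathcal{H}_{\mu,\alpha}$ is a bounded operator from $\mathscr{B}_{\beta}$ into $\mathscr{B}_{\alpha-1}$. (ii) $\mathcal{H}_{\mu,\alpha}$ is a compact operator from $\mathscr{B}_{\beta}$ into $\mathscr{B}_{\alpha-1}$. (iii) $\mu$ is a $2$-Carleson measure.
   Context: $\mathbb{D}$ is the open unit disc, $H(\mathbb{D})$ the analytic functions on $\mathbb{D}$. For $\alpha>0$, the Bloch type space $\mathscr{B}_{\alpha}$ is the set of $f\in H(\mathbb{D})$ with $\|f\|_{\mathscr{B}_\alpha}=\sup_{z\in\mathbb{D}}(1-|z|^2)^{\alpha}|f'(z)|<\infty$; it is a Banach space with norm $|f(0)|+\|f\|_{\mathscr{B}_\alpha}$. For a positive Borel measure $\mu$ on $[0,1)$ and $\alpha>0$ put $\mu_{n,k,\alpha}=\int_{[0,1)}\frac{\Gamma(n+\alpha)}{n!\,\Gamma(\alpha)}t^{n+k}\,d\mu(t)$ for $n,k\ge 0$, and for $f(z)=\sum_{k\ge0}a_kz^k\in H(\mathbb{D})$ define $\mathcal{H}_{\mu,\alpha}(f)(z)=\sum_{n=0}^\infty\big(\sum_{k=0}^\infty\mu_{n,k,\alpha}a_k\big)z^n$ whenever the right-hand side makes sense (the numbers $\mu_{n,k,\alpha}$ are finite and the inner series converge) and defines an analytic function in $\mathbb{D}$. Saying that $\mathcal{H}_{\mu,\alpha}$ is a bounded (or compact) operator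 from $X$ into $Y$ includes that it is well defined in this sense on every $f\in X$. For $s>0$, a positive Borel measure $\mu$ on $[0,1)$ is an $s$-Carleson measure if there is $C>0$ with $\mu([t,1))\le C(1-t)^s$ for all $0\le t<1$. *)

(* Defs.v *)
From HB Require Import structures.
From mathcomp Require Import all_boot all_order all_algebra.
From mathcomp Require Import complex.
From mathcomp Require Import all_classical all_reals all_analysis.

Set Implicit Arguments.
Unset Strict Implicit.
Unset Printing Implicit Defensive.

Import Order.TTheory GRing.Theory Num.Theory.
Import numFieldNormedType.Exports.
Import Normc.

Local Open Scope classical_set_scope.
Local Open Scope complex_scope.
Local Open Scope ring_scope.

(* The field R[i], named as a numFieldType: it then gets, like any
   numFieldType, the topology of its norm and the structure of normed module
   over itself, so that [derivable f z 1] below is complex differentiability. *)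
Definition cplx (R : realType) : numFieldType := R[i].

Section Bloch.
Variable R : realType.
Local Notation C := (cplx R).

Definition unit_disc : set C := [set z | normc z < 1].

Definition analytic_on_disc (f : C -> C) : Prop :=
  forall z, unit_disc z -> derivable f z 1.

Section BlochSpace.
Variable alpha : R.

Definition bloch_values (f : C -> C) : set R :=
  [set (1 - normc z ^+ 2) `^ alpha * normc (derive1 f z) | z in unit_disc].

Definition bloch_seminorm (f : C -> C) : R := sup (bloch_values f).

(* A function on the disc is represented by its extension by 0 to C, so that
   equality of representatives is equality on the disc. *)
Definition is_bloch (f : C -> C) : Prop :=
  [/\ analytic_on_disc f, has_ubound (bloch_values f)
    & forall z, ~ unit_disc z -> f z = 0].

Definition bloch_pred : {pred C -> C} := mem [set f | is_bloch f].

Record bloch : Type := Bloch {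
  bloch_fun :> C -> C;
  bloch_funP : bloch_fun \in bloch_pred }.

HB.instance Definition _ := [isSub for bloch_fun].
HB.instance Definition _ := [Choice of bloch by <:].

Lemma blochP (f : bloch) : is_bloch f.
Proof. by apply: set_mem; exact: bloch_funP. Qed.

End BlochSpace.
End Bloch.

Section Facts.
Variable R : realType.
Local Notation C := (cplx R).
Implicit Types (f g : C -> C) (z : C).

Lemma normc_ge0 z : 0 <= normc z.
Proof. by case: z => a b; exact: sqrtr_ge0. Qed.

Lemma normcC0 : normc (0 : C) = 0.
Proof. exact: normc0. Qed.

Lemma norm_normc z : `|z| = (normc z)%:C.
Proof. by []. Qed.

Lemma disc0 : unit_disc (0 : C).
Proof. by rewrite /unit_disc /mkset normcC0. Qed.

Lemma derive1D_disc f g z : derivable f z 1 -> derivable g z 1 ->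
  derive1 (f + g) z = derive1 f z + derive1 g z.
Proof. by move=> df dg; rewrite !derive1E deriveD. Qed.

Lemma derive1Z_disc (a : C) f z : derivable f z 1 ->
  derive1 (a *: f) z = a * derive1 f z.
Proof. by move=> df; rewrite !derive1E deriveZ. Qed.

Lemma normcR (x : R) : normc x%:C = `|x|.
Proof. by rewrite /normc /= expr0n /= addr0 sqrtr_sqr. Qed.

Lemma Re_le_normc z : `|complex.Re z| <= normc z.
Proof. by have := normc_ge_Re z; rewrite norm_normc lecR. Qed.

Lemma Im_le_normc z : `|complex.Im z| <= normc z.
Proof.
case: z => a b /=; rewrite -sqrtr_sqr ler_sqrt ?lerDr ?sqr_ge0 //.
by rewrite addr_ge0 ?sqr_ge0.
Qed.

Lemma lecC_gt0 (d : C) : 0 < d -> d = (complex.Re d)%:C /\ 0 < complex.Re d.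
Proof. by case: d => a b; rewrite ltcE /= => /andP[/eqP-> a0]. Qed.

Lemma derive10_small f z : derivable f z 1 -> derive1 f z = 0 ->
  forall e : R, 0 < e -> exists2 d : R, 0 < d &
    forall k : C, normc k < d -> normc (f (k + z) - f z) <= e * normc k.
Proof.
move=> df f0 e e0.
have := df; rewrite /derivable => /cvg_ex[l hl].
have l0 : l = 0.
  rewrite -f0 derive1E /derive; apply/esym/cvg_lim => //.
have e0C : (0 : C) < e%:C by rewrite ltcR.
move/cvgrPdist_le : hl => /(_ _ e0C); rewrite l0 => /nbhs_ballP[d /= d0 hd].
have [dE d0'] := lecC_gt0 d0.
exists (complex.Re d) => // k kd.
have [->|k0] := eqVneq k 0; first by rewrite add0r subrr normcC0 mulr0.
have := hd k; rewrite /ball /= sub0r normrN => /(_ _ k0).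
rewrite sub0r normrN norm_normc {1}dE ltcR => /(_ kd).
rewrite norm_normc lecR /= /GRing.scale /= mulr1 normcM normcV.
by rewrite ler_pdivrMl 1?mulrC // lt_def normc_ge0 andbT; apply: contra k0 => /eqP/eq0_normc->.
Qed.

Lemma derive10_const f z : analytic_on_disc f ->
  (forall w, unit_disc w -> derive1 f w = 0) -> unit_disc z -> f z = f 0.
Proof.
move=> af f0 z1.
have tz1 (t : R) : t \in `[0, 1] -> unit_disc (t%:C * z).
  rewrite in_itv /= => /andP[t0 t1]; rewrite /unit_disc /mkset normcM normcR.
  by rewrite ger0_norm // (le_lt_trans _ z1) // ler_piMl // normc_ge0.
have main (phi : C -> R) : (forall u v, phi (u - v) = phi u - phi v) ->
    (forall u, `|phi u| <= normc u) -> phi (f z) = phi (f 0).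
  move=> phiB phi1; pose g (t : R) := phi (f (t%:C * z)).
  have dg (t : R) : t \in `[0, 1] -> is_derive t 1 g 0.
    move=> t01; have tz := tz1 _ t01.
    suff hg : h^-1 *: ((g \o shift t) (h *: 1) - g t) @[h --> 0^'] --> (0 : R).
      by apply: DeriveDef; [apply/cvg_ex; exists 0|exact: cvg_lim].
    apply/cvgrPdist_le => e e0.
    have [d d0 hd] := derive10_small (af _ tz) (f0 _ tz) e0.
    apply/nbhs_ballP; exists d => //= h; rewrite /ball /= sub0r normrN => hd' h0.
    rewrite sub0r normrN normrM normfV ler_pdivrMl ?normr_gt0 // /GRing.scale /= mulr1.
    have nk : normc (h%:C * z) <= `|h|.
      by rewrite normcM normcR ler_piMr // ltW.
    rewrite /g -phiB rmorphD /= mulrDl.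
    apply: (le_trans (phi1 _)); apply: (le_trans (hd _ (le_lt_trans nk hd'))).
    by rewrite mulrC ler_wpM2r // ltW.
  have cg : {within `[0, 1], continuous g}.
    apply: continuous_in_subspaceT => t /set_mem/= /dg[dt _].
    exact/differentiable_continuous/derivable1_diffP.
  have [c _] := @MVT_segment _ g (cst 0) 0 1 ler01 (fun t t01 =>
    dg t (subset_itv_oo_cc t01)) cg.
  rewrite mul0r => /eqP; rewrite subr_eq0 => /eqP.
  by rewrite /g mul1r mul0r.
apply/eqP; rewrite eq_complex; apply/andP; split; apply/eqP; apply: main.
- by case=> ? ? [].
- exact: Re_le_normc.
- by case=> ? ? [].
- exact: Im_le_normc.
Qed.

Section Norm.
Variable alpha : R.

Lemma weight_ge0 z : 0 <= (1 - normc z ^+ 2) `^ alpha.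
Proof. exact: powR_ge0. Qed.

Lemma weight_gt0 z : unit_disc z -> 0 < (1 - normc z ^+ 2) `^ alpha.
Proof.
move=> z1; apply: powR_gt0; rewrite subr_gt0 expr_lt1 //.
exact: normc_ge0.
Qed.

Lemma bloch_values_ge0 f x : bloch_values alpha f x -> 0 <= x.
Proof.
by move=> [z _ <-]; rewrite mulr_ge0 ?weight_ge0 ?normc_ge0.
Qed.

Lemma bloch_values0 f : bloch_values alpha f !=set0.
Proof. by eexists; exists 0; [exact: disc0|reflexivity]. Qed.

Lemma bloch_seminorm_ub f z : has_ubound (bloch_values alpha f) ->
  unit_disc z ->
  (1 - normc z ^+ 2) `^ alpha * normc (derive1 f z) <= bloch_seminorm alpha f.
Proof. by move=> ub z1; apply: ub_le_sup => //; exists z. Qed.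

Lemma bloch_seminorm_le f M :
  (forall z, unit_disc z ->
     (1 - normc z ^+ 2) `^ alpha * normc (derive1 f z) <= M) ->
  bloch_seminorm alpha f <= M.
Proof.
move=> h; apply: ge_sup; first exact: bloch_values0.
by move=> _ [z z1 <-]; exact: h.
Qed.

Lemma bloch_seminorm_ge0 f : has_ubound (bloch_values alpha f) ->
  0 <= bloch_seminorm alpha f.
Proof.
move=> ub; apply: le_trans (bloch_seminorm_ub ub disc0).
by rewrite mulr_ge0 ?weight_ge0 ?normc_ge0.
Qed.

Lemma bloch_submod_closed : submod_closed (@bloch_pred R alpha).
Proof.
have c0 z : derivable (0 : C -> C) z 1 /\ derive1 (0 : C -> C) z = 0.
  by split; [exact: derivable_cst|rewrite -[LHS]/(derive1 (cst 0) z) derive1_cst].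
split.
  apply/mem_set; split=> [z _||z _ //]; first by case: (c0 z).
  exists 0 => _ [z _ <-]; case: (c0 z) => _ ->.
  by rewrite normcC0 mulr0.
move=> a f g /set_mem[af [Mf hf] zf] /set_mem[ag [Mg hg] zg].
have daf z : unit_disc z -> derivable (a *: f) z 1.
  by move=> z1; apply: derivableZ; exact: af.
apply/mem_set; split.
- by move=> z z1; apply: derivableD; [exact: daf|exact: ag].
- exists (normc a * Mf + Mg) => _ [z z1 <-].
  rewrite derive1D_disc; [|exact: daf|exact: ag].
  rewrite derive1Z_disc; last exact: af.
  apply: (@le_trans _ _ ((1 - normc z ^+ 2) `^ alpha *
     (normc a * normc (derive1 f z) + normc (derive1 g z)))).
    by rewrite ler_wpM2l ?weight_ge0 // -normcM le_normcD.
  rewrite mulrDr mulrCA lerD //; last by apply: hg; exists z.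
  by rewrite ler_wpM2l ?normc_ge0 //; apply: hf; exists z.
- by move=> z z1; rewrite /GRing.add /= /GRing.scale /= zf // zg // scaler0 addr0.
Qed.

End Norm.
End Facts.

HB.instance Definition _ (R : realType) (alpha : R) :=
  GRing.isSubmodClosed.Build _ _ (bloch_pred alpha) (bloch_submod_closed alpha).
HB.instance Definition _ (R : realType) (alpha : R) :=
  [SubChoice_isSubLmodule of bloch alpha by <:].

Section BlochNorm.
Variables (R : realType) (alpha : R).
Local Notation C := (cplx R).
Implicit Types f g : bloch alpha.

Definition bloch_norm f : C := (normc (f 0) + bloch_seminorm alpha f)%:C.

Lemma bloch_ub f : has_ubound (bloch_values alpha f).
Proof. by case: (blochP f). Qed.

Lemma bloch_derivable f z : unit_disc z -> derivable f z 1.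
Proof. by case: (blochP f) => + _ _; exact. Qed.

Lemma bloch_normD f g : bloch_norm (f + g) <= bloch_norm f + bloch_norm g.
Proof.
rewrite /bloch_norm -rmorphD lecR addrACA lerD ?le_normcD //.
apply: bloch_seminorm_le => z z1.
rewrite derive1D_disc; [|exact: bloch_derivable..].
apply: (@le_trans _ _ ((1 - normc z ^+ 2) `^ alpha *
   (normc (derive1 f z) + normc (derive1 g z)))).
  by rewrite ler_wpM2l ?weight_ge0 // le_normcD.
by rewrite mulrDr lerD // bloch_seminorm_ub //; exact: bloch_ub.
Qed.

Lemma bloch_seminormZ_le (a : C) f :
  bloch_seminorm alpha (a *: f) <= normc a * bloch_seminorm alpha f.
Proof.
apply: bloch_seminorm_le => z z1.
rewrite derive1Z_disc; last exact: bloch_derivable.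
rewrite normcM mulrCA ler_wpM2l ?normc_ge0 //.
by apply: bloch_seminorm_ub => //; exact: bloch_ub.
Qed.

Lemma bloch_normZ (a : C) f : bloch_norm (a *: f) = `|a| * bloch_norm f.
Proof.
rewrite /bloch_norm norm_normc -rmorphM mulrDr; congr (_ %:C).
rewrite [(a *: f) 0]/(a * f 0) normcM; congr (_ + _).
have [->|a0] := eqVneq a 0.
  rewrite normcC0 mul0r; apply/eqP; rewrite eq_le bloch_seminorm_ge0 ?andbT.
    by rewrite (le_trans (bloch_seminormZ_le _ _)) // normcC0 mul0r.
  exact: bloch_ub.
have na0 : 0 < normc a.
  by rewrite lt_def normc_ge0 andbT; apply: contra a0 => /eqP/eq0_normc->.
apply/eqP; rewrite eq_le bloch_seminormZ_le /= -ler_pdivlMl // -normcV.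
by rewrite -[in leLHS](scalerK a0 f) bloch_seminormZ_le.
Qed.

Lemma bloch_norm0_eq0 f : bloch_norm f = 0 -> f = 0.
Proof.
move=> /complexI/eqP; rewrite paddr_eq0 ?normc_ge0 //; last first.
  by apply: bloch_seminorm_ge0; exact: bloch_ub.
move=> /andP[/eqP/eq0_normc f00 /eqP s0].
have [af ubf zf] := blochP f.
have f'0 w : unit_disc w -> derive1 f w = 0.
  move=> w1; apply: eq0_normc; apply/eqP; rewrite eq_le normc_ge0 andbT.
  by have := bloch_seminorm_ub ubf w1; rewrite s0 pmulr_rle0 // weight_gt0.
apply/val_inj/funext => z /=.
have [z1|z1] := pselect (unit_disc z); last exact: zf.
by rewrite (derive10_const af f'0 z1).
Qed.

HB.instance Definition _ := Lmodule_isNormed.Build C (bloch alpha)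
  bloch_normD bloch_normZ bloch_norm0_eq0.

End BlochNorm.

Section BoundedCompact.
Variables (K : numFieldType) (V W : normedModType K).

Definition bounded_operator (T : V -> W) : Prop :=
  exists M : K, forall x, `|T x| <= M * `|x|.

Definition compact_operator (T : V -> W) : Prop :=
  forall A : set V, bounded_set A -> compact (closure (T @` A)).

End BoundedCompact.

Section Hilbert.
Variable R : realType.
Local Notation C := (cplx R).

Definition Gamma (x : R) : R :=
  (\int[lebesgue_measure]_(t in `]0, +oo[) (t `^ (x - 1) * expR (- t)))%R.

Definition power_series_on_disc (a : nat -> C) (f : C -> C) : Prop :=
  forall z, unit_disc z -> series (fun k => a k * z ^+ k) @ \oo --> f z.

(* A Borel measure on [0,1) is given by a Borel measure on the line, of which
   only the restriction to [0,1) is ever used. *)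
Variable mu : {measure set (measurableTypeR R) -> \bar R}.

Definition carleson (s : R) : Prop :=
  exists2 c : R, 0 < c &
    forall t : R, 0 <= t < 1 -> (mu `[t, 1%R[%classic <= (c * (1 - t) `^ s)%:E)%E.

Variable alpha : R.

Definition hilbert_moment (n k : nat) : \bar R :=
  (\int[mu]_(t in `[0%R, 1%R[)
     (Gamma (n%:R + alpha) / (n`!%:R * Gamma alpha) * t ^+ (n + k))%:E)%E.

Definition hilbert_series (a : nat -> C) (n : nat) : nat -> C :=
  series (fun k => (fine (hilbert_moment n k))%:C * a k).

(* The operator is well defined at f, with value g on the disc. *)
Definition hilbert_image (f g : C -> C) : Prop :=
  exists a : nat -> C,
  [/\ power_series_on_disc a f,
      forall n k, hilbert_moment n k \is a fin_num,
      forall n, cvgn (hilbert_series a n),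
      power_series_on_disc (fun n => limn (hilbert_series a n)) g
    & analytic_on_disc g].

Definition is_hilbert_operator (beta gamma : R)
    (T : bloch beta -> bloch gamma) : Prop :=
  forall f : bloch beta, hilbert_image f (T f).

Definition hilbert_bounded (beta gamma : R) : Prop :=
  exists T : {linear bloch beta -> bloch gamma},
    is_hilbert_operator T /\ bounded_operator T.

Definition hilbert_compact (beta gamma : R) : Prop :=
  exists T : {linear bloch beta -> bloch gamma},
    is_hilbert_operator T /\ compact_operator T.

End Hilbert.

(* Main.v *)
From HB Require Import structures.
Require Import Defs.
From mathcomp Require Import all_boot all_order all_algebra.
From mathcomp Require Import complex ring lra.
From mathcomp Require Import all_classical all_reals all_analysis.
From mathcomp Require Import measurable_realfun.

(* Necessity: the image of the constant [1] is
   [g z = \sum_n gbin alpha n * m_n * z ^ n], where [m_n] are the moments of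
   [mu] and [gbin alpha n = Gamma (n + alpha) / (n! * Gamma alpha)].  All the
   coefficients are nonnegative and [m_n >= t ^ n * mu [t, 1)], so
   [g^' t >= alpha * t * mu [t, 1) * (1 - t ^ 2) ^ (- (alpha + 1))]; comparing
   with [g^' t = O ((1 - t ^ 2) ^ (1 - alpha))] gives
   [mu [t, 1) = O ((1 - t) ^ 2)].

   Sufficiency: for [beta < 1] the functions of the Bloch space are bounded,
   with Hoelder-continuous radial restrictions.  Since
   [\sum_k m_(n + k) a_k] is the integral of [t ^ n * f t], it is at most
   [m_n] times the supremum of [f] on [0, 1), and [m_n = O (n ^ -2)]; hence the
   coefficients of the derivative of the image are dominated by those of
   [(1 - z) ^ (1 - alpha)].  Only this supremum matters, and the coefficient
   sequences of the unit ball lie in a class which is compact for pointwise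
   convergence and on which pointwise convergence implies uniform convergence
   on [0, 1): this gives compactness. *)

Set Implicit Arguments.
Unset Strict Implicit.
Unset Printing Implicit Defensive.

Import Order.TTheory GRing.Theory Num.Theory.
Import numFieldNormedType.Exports.
Import Normc.
Local Open Scope classical_set_scope.
Local Open Scope complex_scope.
Local Open Scope ring_scope.

(** Analyticity is given as complex differentiability at every point of the disc, while the operator
    acts on Taylor coefficients; so Cauchy's formula has to be established for Bloch functions. At
    that stage the derivative is not known to be continuous. The Bloch condition bounds it on every
    smaller disc, so [f] is Lipschitz there, and a Lipschitz bound is enough to apply dominated
    convergence to difference quotients. Uniqueness of the coefficients then makes their choice
    harmless and gives linearity. The exponent 2 is the gap between the weight exponent [alpha - 1]
    of the target and the order [alpha + 1] of the singularity at 1 of the derivative of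
    [(1 - z) ^ (- alpha)]. The measure may be infinite a priori. Its finiteness is the Carleson
    bound at [t = 0] in one direction, and the finiteness of the moment with [n = k = 0] in the
    other. Conditions (i) and (ii) lead to (iii) by the same evaluation at the constant 1, and (iii)
    yields a single operator that witnesses both. *)

(** * Moduli, limits and absolutely convergent series of complex numbers *)

Section ComplexLimits.
Variable R : realType.
Local Notation C := (cplx R).
Implicit Types (z w : C).

Lemma normcD z w : normc (z + w) <= normc z + normc w.
Proof. exact: le_normcD. Qed.

Lemma normcNn z : normc (- z) = normc z.
Proof. exact: normcN. Qed.

Lemma normc1n : normc (1 : C) = 1.
Proof. exact: normc1. Qed.

Lemma normc_eq0 z : (normc z == 0) = (z == 0).
Proof.
by apply/eqP/eqP => [/eq0_normc //|->]; exact: normcC0.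
Qed.

Lemma normc_gt0 z : (0 < normc z) = (z != 0).
Proof. by rewrite lt_def normc_ge0 andbT normc_eq0. Qed.

Lemma normcX z n : normc (z ^+ n) = normc z ^+ n.
Proof.
elim: n => [|n ih]; first by rewrite !expr0 normc1n.
by rewrite !exprS normcM ih.
Qed.

Lemma normc_nat n : normc (n%:R : C) = n%:R.
Proof. by rewrite -(rmorph_nat (real_complex R)) normcR ger0_norm. Qed.

Lemma normcB z w : normc (z - w) = normc (w - z).
Proof. by rewrite -[in LHS]normcNn opprB. Qed.

Lemma normc_distD u z w : normc (z - w) <= normc (z - u) + normc (u - w).
Proof. by apply: le_trans (normcD _ _); rewrite addrA subrK. Qed.

Lemma normc_le_dist (z w : C) : normc z <= normc w + normc (w - z).
Proof. by rewrite normcB; apply: le_trans (normcD _ _); rewrite addrC subrK. Qed.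

Lemma normc_quad (x y z w : C) :
  normc (x - y) <= normc (z - w) + (normc (x - z) + normc (y - w)).
Proof.
apply: le_trans (normc_distD z _ _) _; rewrite addrCA lerD2l.
by apply: le_trans (normc_distD w _ _) _; rewrite (normcB w).
Qed.

Lemma normc_le_sum (F : nat -> C) n :
  normc (\sum_(0 <= k < n) F k) <= \sum_(0 <= k < n) normc (F k).
Proof.
elim: n => [|n ih]; first by rewrite !big_nil normcC0.
by rewrite !big_nat_recr //=; apply: le_trans (normcD _ _) _; rewrite lerD2r.
Qed.

Lemma normc_le_ReIm z : normc z <= `|complex.Re z| + `|complex.Im z|.
Proof.
case: z => a b; rewrite /= -[leRHS]ger0_norm ?addr_ge0 // -sqrtr_sqr.
rewrite ler_sqrt ?sqr_ge0 // sqrrD !real_normK ?num_real //.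
by rewrite -addrA lerD2l lerDr mulrn_wge0 // mulr_ge0.
Qed.

(** Turns a bound on a modulus into a bound on the real part of a rotated number, so that real tools
    (mean value theorem, monotonicity of integrals) apply without losing a constant. *)
Lemma normc_dual z : exists2 u : C, normc u = 1 & normc z = complex.Re (u * z).
Proof.
have [->|z0] := eqVneq z 0.
  by exists 1; rewrite ?normc1n // mulr0 normcC0.
have nz0 : normc z != 0 by rewrite normc_eq0.
exists ((normc z)%:C / z); first by rewrite normcM normcR normcV ger0_norm ?normc_ge0 // divff.
by rewrite divfK.
Qed.

Lemma ReD z w : complex.Re (z + w) = complex.Re z + complex.Re w.
Proof. by case: z w => ? ? []. Qed.

Lemma ImD z w : complex.Im (z + w) = complex.Im z + complex.Im w.
Proof. by case: z w => ? ? []. Qed.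

Lemma ReB z w : complex.Re (z - w) = complex.Re z - complex.Re w.
Proof. by case: z w => ? ? []. Qed.

Lemma ImB z w : complex.Im (z - w) = complex.Im z - complex.Im w.
Proof. by case: z w => ? ? []. Qed.

Lemma ReZ (x : R) z : complex.Re ((real_complex R x : C) * z) = x * complex.Re z.
Proof. by case: z => a b /=; rewrite mul0r subr0. Qed.

Lemma Re_sum (I : Type) (r : seq I) (P : pred I) (F : I -> C) :
  complex.Re (\sum_(i <- r | P i) F i) = \sum_(i <- r | P i) complex.Re (F i).
Proof. by apply: (big_morph (@complex.Re R) ReD). Qed.

Lemma Im_sum (I : Type) (r : seq I) (P : pred I) (F : I -> C) :
  complex.Im (\sum_(i <- r | P i) F i) = \sum_(i <- r | P i) complex.Im (F i).
Proof. by apply: (big_morph (@complex.Im R) ImD). Qed.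

Lemma cvg_normcP (T : Type) (F : set_system T) {FF : Filter F} (f : T -> C) (l : C) :
  f @ F --> l <-> (forall e : R, 0 < e -> \forall x \near F, normc (l - f x) <= e).
Proof.
split=> [/cvgrPdist_le h e e0|h].
  have e0C : (0 : C) < e%:C by rewrite ltcR.
  have := h _ e0C; apply: filterS => x; by rewrite norm_normc lecR.
apply/cvgrPdist_le => e /lecC_gt0[-> e0].
by have := h _ e0; apply: filterS => x; rewrite norm_normc lecR.
Qed.

Lemma cvgC_ReIm (T : Type) (F : set_system T) {FF : Filter F} (f : T -> C) (l : C) :
  (fun x => complex.Re (f x)) @ F --> complex.Re l ->
  (fun x => complex.Im (f x)) @ F --> complex.Im l -> f @ F --> l.
Proof.
move=> /cvgrPdist_le hr /cvgrPdist_le hi; apply/cvg_normcP => e e0.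
have e20 : 0 < e / 2 by rewrite divr_gt0.
near=> x; apply: le_trans (normc_le_ReIm _) _; rewrite (splitr e) lerD //.
  by rewrite ReB; near: x; exact: hr.
by rewrite ImB; near: x; exact: hi.
Unshelve. all: by end_near. Qed.

Lemma cvg_Re (T : Type) (F : set_system T) {FF : Filter F} (f : T -> C) (l : C) :
  f @ F --> l -> (fun x => complex.Re (f x)) @ F --> complex.Re l.
Proof.
move=> /cvg_normcP h; apply/cvgrPdist_le => e e0.
have := h _ e0; apply: filterS => x; apply: le_trans.
by rewrite -ReB; exact: Re_le_normc.
Qed.

Lemma cvg_Im (T : Type) (F : set_system T) {FF : Filter F} (f : T -> C) (l : C) :
  f @ F --> l -> (fun x => complex.Im (f x)) @ F --> complex.Im l.
Proof.
move=> /cvg_normcP h; apply/cvgrPdist_le => e e0.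
have := h _ e0; apply: filterS => x; apply: le_trans.
by rewrite -ImB; exact: Im_le_normc.
Qed.

Lemma cvg_normc (T : Type) (F : set_system T) {FF : Filter F} (f : T -> C) (l : C) :
  f @ F --> l -> (fun x => normc (f x)) @ F --> normc l.
Proof.
move=> /cvg_normcP h; apply/cvgrPdist_le => e e0.
have := h _ e0; apply: filterS => x; apply: le_trans.
have h1 := normcD (l - f x) (f x); have h2 := normcD (f x - l) l.
rewrite !subrK in h1 h2; rewrite normcB in h2.
by rewrite ler_norml; apply/andP; split; lra.
Qed.

Lemma normc_lim_le (u : nat -> C) (l : C) (M : R) :
  u @ \oo --> l -> (forall n, normc (u n) <= M) -> normc l <= M.
Proof.
move=> ul uM; have hl : normc (u n) @[n --> \oo] --> normc l by exact: cvg_normc.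
rewrite -(cvg_lim (@Rhausdorff R) hl); apply: limr_le.
  by apply/cvg_ex; exists (normc l).
by apply: nearW => n; exact: uM.
Qed.

Lemma abs_cvgC (u : nat -> C) (S : R) :
  (forall n, \sum_(0 <= k < n) normc (u k) <= S) -> cvgn (series u).
Proof.
move=> uS.
have aux (phi : C -> R) : (forall z, `|phi z| <= normc z) -> cvgn (series (fun k => phi (u k))).
  move=> phi1; apply: normed_cvg.
  apply: (@series_le_cvg _ _ (fun k => normc (u k))) => //= [n|]; rewrite ?normc_ge0 //.
  apply: nondecreasing_is_cvgn; first by apply: nondecreasing_series => n _ _; exact: normc_ge0.
  by exists S => _ [n _ <-]; exact: uS.
have /cvg_ex[a ha] := aux _ (@Re_le_normc R).
have /cvg_ex[b hb] := aux _ (@Im_le_normc R).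
apply/cvg_ex; exists (a +i* b)%C; apply: cvgC_ReIm => /=.
  by under eq_fun do rewrite /series /= Re_sum.
by under eq_fun do rewrite /series /= Im_sum.
Qed.

End ComplexLimits.

(** * Power series on the disc *)

Section PowerSeries.
Variable R : realType.
Local Notation C := (cplx R).
Implicit Types (z w h : C) (a b : nat -> C) (f : C -> C).

(** Radius of convergence at least 1, in the form of Abel's lemma: bounded terms at every radius
    below 1. In this form the condition passes easily to the differentiated series. *)
Definition tame a :=
  forall r : R, 0 <= r < 1 -> exists B, forall k, normc (a k) * r ^+ k <= B.

Definition psum a z : C := limn (series (fun k => a k * z ^+ k)).

Definition dcoef a (k : nat) : C := k.+1%:R * a k.+1.

Lemma geo_sum_le (x : R) n : 0 <= x < 1 ->
  \sum_(0 <= k < n) x ^+ k <= (1 - x)^-1.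
Proof.
move=> /andP[x0 x1]; rewrite -[leRHS]mul1r ler_pdivlMr ?subr_gt0 // mulrC.
have -> : (1 - x) * \sum_(0 <= k < n) x ^+ k = 1 - x ^+ n.
  by rewrite big_mkord -(opprB x 1) mulNr -subrX1 opprB.
by rewrite gerBl exprn_ge0.
Qed.

Lemma geo_bound_sum (u : nat -> R) (B r s : R) n : 0 <= s < r ->
  (forall k, 0 <= u k) -> (forall k, u k * r ^+ k <= B) ->
  \sum_(0 <= k < n) u k * s ^+ k <= B / (1 - s / r).
Proof.
move=> /andP[s0 sr] u0 uB; have r0 : 0 < r by exact: le_lt_trans sr.
have B0 : 0 <= B by apply: le_trans (uB 0%N); rewrite expr0 mulr1.
apply: (@le_trans _ _ (B * \sum_(0 <= k < n) (s / r) ^+ k)).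
  rewrite mulr_sumr; apply: ler_sum => k _.
  have -> : u k * s ^+ k = u k * r ^+ k * (s / r) ^+ k.
    by rewrite -mulrA -exprMn mulrCA divff ?mulr1 ?gt_eqF.
  by rewrite ler_wpM2r // exprn_ge0 // divr_ge0 // ltW.
rewrite ler_wpM2l // geo_sum_le // divr_ge0 ?(ltW r0) //=.
by rewrite ltr_pdivrMr // mul1r.
Qed.

Lemma tame_sum a (s : R) : tame a -> 0 <= s < 1 ->
  exists S, forall n, \sum_(0 <= k < n) normc (a k) * s ^+ k <= S.
Proof.
move=> ta /andP[s0 s1]; have sr : s < (1 + s) / 2 by lra.
have [|B hB] := ta ((1 + s) / 2); first by lra.
exists (B / (1 - s / ((1 + s) / 2))) => n; apply: geo_bound_sum; rewrite ?s0 //.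
by move=> k; exact: normc_ge0.
Qed.

Lemma tame_psum a : tame a -> power_series_on_disc a (psum a).
Proof.
move=> ta z z1; have [|S hS] := tame_sum ta (s := normc z); first by rewrite normc_ge0.
suff : cvgn (series (fun k => a k * z ^+ k)) by exact.
apply: (@abs_cvgC _ _ S) => n; apply: le_trans (hS n).
by apply: ler_sum => k _; rewrite normcM normcX.
Qed.

Lemma power_seriesE a f z : power_series_on_disc a f -> unit_disc z -> f z = psum a z.
Proof. by move=> af z1; apply/esym/cvg_lim; [exact: norm_hausdorff|exact: af]. Qed.

Lemma power_series_tame a f : power_series_on_disc a f -> tame a.
Proof.
move=> af r /andP[r0 r1].
have rd : unit_disc (r%:C : C) by rewrite /unit_disc /mkset normcR ger0_norm.
have /cvgP/cvg_series_cvg_0 := af _ rd.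
move=> /cvg_normc; rewrite normcC0 => /cvgP/cvg_seq_bounded[M [_ hM]].
exists (M + 1) => k; have := hM (M + 1) _ k I.
rewrite ltrDl ltr01 => /(_ erefl) /=; rewrite ger0_norm ?normc_ge0 //.
by rewrite normcM normcX normcR (ger0_norm r0).
Qed.

Lemma natM_geo_le (x : R) k : 0 <= x < 1 -> k.+1%:R * x ^+ k <= (1 - x)^-1.
Proof.
move=> /andP[x0 x1]; apply: le_trans (geo_sum_le k.+1 _); last by rewrite x0.
rewrite mulr_natl -[X in _ *+ X]subn0 -sumr_const_nat; apply: ler_sum_nat => i /=.
by rewrite ltnS => ik; rewrite ler_wiXn2l // ltW.
Qed.

(** The factor [k.+1] is absorbed by the geometric decay of [(r / q) ^+ k] for a radius [q] strictly
    between [r] and 1. *)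
Lemma tame_dcoef a : tame a -> tame (dcoef a).
Proof.
move=> ta r /andP[r0 r1]; pose q := (1 + r) / 2.
have [rq q1 q0] : [/\ r < q, q < 1 & 0 < q] by rewrite /q; split; lra.
have [|B hB] := ta q; first by rewrite q1 ltW.
have B0 : 0 <= B by apply: le_trans (hB 0%N); rewrite expr0 mulr1 normc_ge0.
exists ((1 - r / q)^-1 * (B / q)) => k.
have rq1 : 0 <= r / q < 1 by rewrite divr_ge0 //= ?(ltW q0)// ltr_pdivrMr // mul1r.
have -> : normc (dcoef a k) * r ^+ k =
    k.+1%:R * (r / q) ^+ k * (normc (a k.+1) * q ^+ k.+1 / q).
  rewrite /dcoef normcM normc_nat expr_div_n exprS; field.
  by rewrite expf_neq0 ?gt_eqF.
apply: ler_pM; rewrite ?natM_geo_le //.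
- by rewrite mulr_ge0 // exprn_ge0 //; case/andP: rq1.
- by rewrite !mulr_ge0 ?normc_ge0 ?exprn_ge0 // ?invr_ge0 ltW.
by rewrite ler_wpM2r // invr_ge0 ltW.
Qed.

(** The first-order Taylor remainder of the [k]-th power at [z]. Its recursion in [k] yields a bound
    quadratic in [h] with no binomial expansion. *)
Definition power_remainder z h (k : nat) : C := (h + z) ^+ k - z ^+ k - k%:R * h * z ^+ k.-1.

Lemma power_remainder_rec z h k :
  power_remainder z h k.+2 = (h + z) * power_remainder z h k.+1 + k.+1%:R * h ^+ 2 * z ^+ k.
Proof. by rewrite /power_remainder /= !exprS -(natr1 k.+1) -(natr1 k); ring. Qed.

Lemma power_remainder_le z h (r : R) k : normc z <= r -> normc (h + z) <= r ->
  normc (power_remainder z h k.+2) <= normc h ^+ 2 * (k.+2%:R * k.+1%:R * r ^+ k).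
Proof.
move=> zr hzr; have r0 : 0 <= r by exact: le_trans (normc_ge0 _) zr.
have t1 : power_remainder z h 1 = 0 by rewrite /power_remainder /= !expr1 expr0; ring.
elim: k => [|k ih]; rewrite power_remainder_rec.
  rewrite t1 mulr0 add0r !expr0 !mulr1 normcM normc_nat normcX mul1r.
  by rewrite ler_peMr ?exprn_ge0 ?normc_ge0 ?ler1n.
apply: le_trans (normcD _ _) _; rewrite !normcM !normcX normc_nat.
have h1 : normc (h + z) * normc (power_remainder z h k.+2) <=
    r * (normc h ^+ 2 * (k.+2%:R * k.+1%:R * r ^+ k)).
  by apply: ler_pM; rewrite ?normc_ge0.
have h2 : k.+2%:R * normc h ^+ 2 * normc z ^+ k.+1 <= k.+2%:R * normc h ^+ 2 * r ^+ k.+1.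
  apply: ler_wpM2l; first by rewrite mulr_ge0 ?exprn_ge0 ?normc_ge0.
  by rewrite lerXn2r // qualifE /= ?normc_ge0.
apply: le_trans (lerD h1 h2) _.
rewrite -subr_ge0.
have -> : normc h ^+ 2 * (k.+3%:R * k.+2%:R * r ^+ k.+1) -
   (r * (normc h ^+ 2 * (k.+2%:R * k.+1%:R * r ^+ k)) +
    k.+2%:R * normc h ^+ 2 * r ^+ k.+1) = k.+2%:R * normc h ^+ 2 * r ^+ k.+1.
  by rewrite !(exprS r) -(natr1 k.+2) -(natr1 k.+1); ring.
by rewrite !mulr_ge0 ?exprn_ge0 ?normc_ge0.
Qed.

(** Termwise, the first-order remainder is at most [normc h ^+ 2] times a term of the twice
    differentiated series at the radius [r] halfway between [normc z] and 1; that series converges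
    absolutely there. *)
Lemma power_series_derive a f z : power_series_on_disc a f -> unit_disc z ->
  is_derive z 1 f (psum (dcoef a) z).
Proof.
move=> af z1; have ta := power_series_tame af; have tda := tame_dcoef ta.
pose r := (1 + normc z) / 2.
have z1' : normc z < 1 by exact: z1.
have nz0 := normc_ge0 z.
have [|S hS] := tame_sum (tame_dcoef tda) (s := r); first by rewrite /r; lra.
have S0 : 0 <= S by have := hS 0%N; rewrite big_nil.
set D := psum _ z.
have key h : normc h <= r - normc z ->
    normc (f (h + z) - f z - h * D) <= normc h ^+ 2 * S.
  move=> hr; have zr : normc z <= r by rewrite /r; lra.
  have hzr : normc (h + z) <= r by apply: le_trans (normcD _ _) _; lra.
  have hz1 : unit_disc (h + z) by rewrite /unit_disc /mkset (le_lt_trans hzr) // /r; lra.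
  (* The remainders of index 0 and 1 vanish, so the shifts by 2 and by 1 align the three partial
     sums into one sum of remainders starting at index 2. *)
  pose u n := series (fun k => a k * (h + z) ^+ k) n.+2 - series (fun k => a k * z ^+ k) n.+2
     - h * series (fun k => dcoef a k * z ^+ k) n.+1.
  apply: (@normc_lim_le _ u).
    apply: cvgB; first apply: cvgB.
    - by have := af _ hz1; rewrite -(cvg_shiftn 2); under eq_fun do rewrite addn2.
    - by have := af _ z1; rewrite -(cvg_shiftn 2); under eq_fun do rewrite addn2.
    apply: cvgM; first exact: cvg_cst.
    by have := tame_psum tda z1; rewrite -(cvg_shiftn 1); under eq_fun do rewrite addn1.
  move=> n.
  have -> : u n = \sum_(0 <= k < n) a k.+2 * power_remainder z h k.+2.
    rewrite /u /series /=; elim: n => [|n ih].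
      by rewrite !big_nat_recr ?big_nil //= /dcoef; ring.
    rewrite [in RHS]big_nat_recr //= -ih.
    have S1 (v : nat -> C) m : \sum_(0 <= k < m.+1) v k = \sum_(0 <= k < m) v k + v m.
      by rewrite big_nat_recr.
    rewrite (S1 (fun k => a k * (h + z) ^+ k) n.+2) (S1 (fun k => a k * z ^+ k) n.+2).
    rewrite (S1 (fun k => dcoef a k * z ^+ k) n.+1) /dcoef /power_remainder /=; ring.
  apply: le_trans (normc_le_sum _ _) _.
  apply: le_trans (ler_wpM2l _ (hS n)); last by rewrite exprn_ge0 ?normc_ge0.
  rewrite mulr_sumr; apply: ler_sum => k _.
  rewrite normcM; apply: le_trans (ler_wpM2l (normc_ge0 _) (power_remainder_le k zr hzr)) _.
  rewrite /dcoef !normcM !normc_nat le_eqVlt; apply/orP; left; apply/eqP; ring.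
suff hg : h^-1 *: ((f \o shift z) (h *: 1) - f z) @[h --> (0:C)^'] --> D.
  by apply: DeriveDef; [apply/cvg_ex; exists D|exact: cvg_lim].
apply/cvg_normcP => e e0; pose d := Num.min (r - normc z) (e / (S + 1)).
have d0 : 0 < d by rewrite lt_min subr_gt0 divr_gt0 ?ltr_wpDl // andbT /r; lra.
apply/nbhs_ballP; exists d%:C => /=; first by rewrite ltcR.
move=> h; rewrite /ball /= sub0r normrN norm_normc ltcR lt_min => /andP[h1 h2] h0.
rewrite /GRing.scale /= mulr1.
have -> : D - h^-1 * (f (h + z) - f z) = - (h^-1 * (f (h + z) - f z - h * D)).
  by field.
rewrite normcNn normcM normcV ler_pdivrMl ?normc_gt0 //.
apply: le_trans (key _ (ltW h1)) _; rewrite expr2 -mulrA ler_wpM2l ?normc_ge0 //.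
rewrite ltr_pdivlMr in h2; last by rewrite ltr_wpDl.
apply: le_trans (ltW h2); rewrite ler_wpM2l ?normc_ge0 // ; lra.
Qed.

Lemma power_series_analytic a f : power_series_on_disc a f -> analytic_on_disc f.
Proof. by move=> af z /(power_series_derive af)[]. Qed.

Lemma power_series_derive1 a f z : power_series_on_disc a f -> unit_disc z ->
  derive1 f z = psum (dcoef a) z.
Proof. by move=> af /(power_series_derive af)[_ <-]; rewrite derive1E. Qed.

Lemma power_seriesB a b f g : power_series_on_disc a f -> power_series_on_disc b g ->
  power_series_on_disc (fun k => a k - b k) (fun z => f z - g z).
Proof.
move=> af bg z z1; apply: (cvg_trans _ (cvgB (af z z1) (bg z z1))).
by apply: near_eq_cvg; near=> n; rewrite fctE /series /= -sumrB; apply: eq_bigr => k _; rewrite mulrBl.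
Unshelve. all: by end_near. Qed.

Lemma power_seriesZD (c : C) a b f g : power_series_on_disc a f -> power_series_on_disc b g ->
  power_series_on_disc (fun k => c * a k + b k) (fun z => c * f z + g z).
Proof.
move=> af bg z z1; apply: (cvg_trans _ (cvgD (cvgM (cvg_cst c) (af z z1)) (bg z z1))).
apply: near_eq_cvg; near=> n.
rewrite !fctE /series /= mulr_sumr -big_split /=; apply: eq_bigr => k _.
by rewrite mulrDl mulrA.
Unshelve. all: by end_near. Qed.

(** Induction over all sequences at once: the constant term is the value at 0, and the
    differentiated series again sums to zero, with coefficients shifted by one. *)
Lemma power_series0 a f : power_series_on_disc a f ->
  (forall z, unit_disc z -> f z = 0) -> forall n, a n = 0.
Proof.
move=> af f0 n; elim: n a f af f0 => [|n ih] a f af f0.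
  have <- : f 0 = a 0%N; last by apply: f0; exact: disc0.
  apply/esym; have := af 0 (disc0 _); apply: cvg_unique; first exact: norm_hausdorff.
  apply: (@cvg_trans _ (cst (a 0%N) @ \oo)); last exact: cvg_cst.
  apply: near_eq_cvg; near=> m; rewrite /series /=.
  have m0 : (0 < m)%N by near: m; exact: nbhs_infty_gt.
  rewrite -(prednK m0) big_nat_recl //= expr0 mulr1 big1 ?addr0 // => k _.
  by rewrite exprS mul0r mulr0.
have tda := tame_dcoef (power_series_tame af).
have := ih _ _ (tame_psum tda); rewrite /dcoef => h.
have /h /eqP : forall z, unit_disc z -> psum (dcoef a) z = 0.
  move=> z z1; have [dz <-] := power_series_derive af z1.
  have z1' : normc z < 1 by exact: z1.
  rewrite /derive; apply: cvg_lim; first exact: norm_hausdorff.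
  apply/cvg_normcP => e e0; apply/nbhs_ballP; exists (1 - normc z)%:C => /=.
    by rewrite ltcR subr_gt0.
  move=> k; rewrite /ball /= sub0r normrN norm_normc ltcR /GRing.scale /= mulr1 => kz _.
  rewrite !f0 //; first by rewrite subrr mulr0 subrr normcC0 ltW.
  by rewrite /unit_disc /mkset (le_lt_trans (normcD _ _)) //; lra.
by rewrite mulf_eq0 pnatr_eq0 /= => /eqP.
Unshelve. all: by end_near. Qed.

(** Identifies the sequence hidden in the existential of [hilbert_image] with any other expansion of
    the same function. *)
Lemma power_series_inj a b f : power_series_on_disc a f -> power_series_on_disc b f ->
  a = b.
Proof.
move=> af bf; apply/funext => n; apply/eqP; rewrite -subr_eq0; apply/eqP.
apply: (power_series0 (power_seriesB af bf)) => z _; exact: subrr.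
Qed.

End PowerSeries.

(** * Means over a period, standing for integrals over the circle *)

Section CircleMean.
Variable R : realType.
Local Notation C := (cplx R).
Local Notation leb := (@lebesgue_measure R).
Implicit Types (g : R -> R) (G : R -> C).

Lemma continuous_integrable_itv g (a b : R) : continuous g ->
  leb.-integrable `[a, b] (EFin \o g).
Proof.
move=> cg; apply: continuous_compact_integrable; first exact: segment_compact.
exact: continuous_subspaceT.
Qed.

Lemma continuous_antiderivative g (a x : R) : continuous g -> a < x ->
  is_derive x 1 (fun y => \int[leb]_(t in `[a, y]) g t) (g x).
Proof.
move=> cg ax; have x1 : x < x + 1 by rewrite ltrDl.
have [dF F'] := continuous_FTC1_closed x1 (continuous_integrable_itv a (x + 1) cg) ax (cg x).
by split; [exact: dF|rewrite -derive1E; exact: F'].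
Qed.

(** With an antiderivative [P], the integral over [[k, k + 1]] is [P (k + 1) - P k], whose
    derivative in [k] is [g (k + 1) - g k], hence zero. *)
Lemma Rintegral_periodic_shift g (h : R) : continuous g ->
  (forall x, g (x + 1) = g x) ->
  \int[leb]_(x in `[0, 1]) g (x + h) = \int[leb]_(x in `[0, 1]) g x.
Proof.
(* The base point of the antiderivative lies strictly to the left of both 0 and [h], so [P] is
   differentiable at all points used. *)
move=> cg g1; pose a := - `|h| - 1.
pose P y := \int[leb]_(t in `[a, y]) g t.
have dP x : a < x -> is_derive x 1 P (g x) by exact: continuous_antiderivative.
have dPs k x : a < x + k -> is_derive x 1 (fun y => P (y + k)) (g (x + k)).
  move=> axk; have dP1 := dP _ axk.
  have ds : is_derive x 1 (fun y : R => y + k) 1.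
    by apply: is_derive_eq; rewrite addr0.
  by have := @is_derive1_comp _ P (fun y : R => y + k) x _ _ dP1 ds; rewrite mulr1.
have shiftE k : a < k -> \int[leb]_(x in `[0, 1]) g (x + k) = P (1 + k) - P k.
  move=> ak; rewrite /Rintegral.
  have -> : P (1 + k) - P k = fine ((P (1 + k))%:E - (P (0 + k))%:E)%E by rewrite add0r.
  congr fine; apply: (continuous_FTC2 (F := fun y => P (y + k))) => //.
  - apply: continuous_subspaceT => x; apply: continuous_comp; last exact: cg.
    by apply: continuousD; [exact: cvg_id|exact: cst_continuous].
  - have cP x : 0 <= x -> {for x, continuous (fun y => P (y + k))}.
      move=> x0; apply/differentiable_continuous/derivable1_diffP.
      have ax : a < x + k by lra.
      by have [] := dPs k x ax.
    split.
    + move=> x; rewrite in_itv /= => /andP[x0 _]; have ax : a < x + k by lra.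
      by have [] := dPs k x ax.
    + by apply: cvg_at_right_filter; exact: cP.
    + by apply: cvg_at_left_filter; apply: cP.
  - move=> x; rewrite in_itv /= => /andP[x0 _]; rewrite derive1E.
    have ax : a < x + k by lra.
    by have [_ ->] := dPs k x ax.
have ah : a < h by rewrite /a; have := ler_norm (- h); rewrite normrN; lra.
have a0 : a < 0 by rewrite /a; have := normr_ge0 h; lra.
rewrite shiftE //; have := shiftE 0 a0.
under eq_Rintegral do rewrite addr0.
move=> ->.
pose Q y := P (y + 1) - P y.
have dQ x : a < x -> is_derive x 1 Q 0.
  move=> ax; have d1 := dPs 1 x _; have d2 := dP _ ax.
  have := @is_deriveB _ _ _ _ _ _ _ _ _ (d1 _) d2; rewrite g1 subrr; apply; lra.
suff QE x y : a < x -> x <= y -> Q x = Q y.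
  rewrite !(addrC 1) -/(Q h) -/(Q 0).
  by have [h0|h0] := leP h 0; [apply: QE|apply/esym/QE => //; exact: ltW].
move=> ax xy.
have dQxy t : t \in `[x, y] -> is_derive t 1 Q 0.
  by rewrite in_itv /= => /andP[xt _]; apply: dQ; exact: lt_le_trans xt.
have cQ : {within `[x, y], continuous Q}.
  apply: continuous_in_subspaceT => t /set_mem/= /dQxy[dt _].
  exact/differentiable_continuous/derivable1_diffP.
have [c _] := @MVT_segment _ Q (cst 0) x y xy (fun t tt => dQxy t (subset_itv_oo_cc tt)) cQ.
by rewrite mul0r => /eqP; rewrite subr_eq0 => /eqP.
Qed.

Definition mean G : C :=
  (\int[leb]_(x in `[0, 1]) complex.Re (G x)) +i*
  (\int[leb]_(x in `[0, 1]) complex.Im (G x)).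

Lemma continuous_ReC G : continuous G -> continuous (fun x => complex.Re (G x)).
Proof. by move=> cG x; apply: cvg_Re; exact: cG. Qed.

Lemma continuous_ImC G : continuous G -> continuous (fun x => complex.Im (G x)).
Proof. by move=> cG x; apply: cvg_Im; exact: cG. Qed.

Lemma meanB G H : continuous G -> continuous H ->
  mean (fun x => G x - H x) = mean G - mean H.
Proof.
move=> cG cH; rewrite /mean.
under eq_Rintegral do rewrite ReB.
under [X in _ +i* X]eq_Rintegral do rewrite ImB.
rewrite !RintegralB //; apply: continuous_integrable_itv;
  by [exact: continuous_ReC|exact: continuous_ImC].
Qed.

Lemma meanZ (c : C) G : continuous G -> mean (fun x => c * G x) = c * mean G.
Proof.
move=> cG; case: c => a b; rewrite /mean.
have ReM w : complex.Re ((a +i* b) * w) = a * complex.Re w - b * complex.Im w by case: w.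
have ImM w : complex.Im ((a +i* b) * w) = a * complex.Im w + b * complex.Re w by case: w.
have iR k : leb.-integrable `[0, 1] (EFin \o (fun x => k * complex.Re (G x))).
  apply: continuous_integrable_itv => x; apply: cvgM; first exact: cvg_cst.
  exact: continuous_ReC.
have iI k : leb.-integrable `[0, 1] (EFin \o (fun x => k * complex.Im (G x))).
  apply: continuous_integrable_itv => x; apply: cvgM; first exact: cvg_cst.
  exact: continuous_ImC.
under eq_Rintegral do rewrite ReM.
under [X in _ +i* X]eq_Rintegral do rewrite ImM.
rewrite RintegralB // RintegralD // !RintegralZl //;
  apply: continuous_integrable_itv; by [exact: continuous_ReC|exact: continuous_ImC].
Qed.

Lemma Rintegral01_cst (r : R) : \int[leb]_(x in `[0, 1]) r = r.
Proof.
rewrite Rintegral_cst; last exact: measurable_itv.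
have := lebesgue_measure_itv (`[0, 1]%R : interval R).
by rewrite /= lte_fin ltr01 oppr0 adde0 => ->; rewrite /= mulr1.
Qed.

Lemma mean_cst (c : C) : mean (fun=> c) = c.
Proof. by rewrite /mean !Rintegral01_cst; case: c. Qed.

(** Rotating by the [u] of [normc_dual] makes the mean real; estimating the two components
    separately would cost a factor. *)
Lemma mean_le G (M : R) : continuous G -> (forall x, normc (G x) <= M) ->
  normc (mean G) <= M.
Proof.
move=> cG GM; have [u u1 ->] := normc_dual (mean G).
have cuG : continuous (fun x => u * G x) by move=> x; apply: cvgM; [exact: cvg_cst|exact: cG].
rewrite -meanZ // /mean /=.
rewrite -[leRHS]Rintegral01_cst.
apply: le_Rintegral => //.
- by apply: continuous_integrable_itv; exact: continuous_ReC.
- by apply: continuous_integrable_itv; exact: cst_continuous.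
- move=> x _; apply: le_trans (ler_norm _) _; apply: le_trans (Re_le_normc _) _.
  by rewrite normcM u1 mul1r.
Qed.

Lemma mean_periodic_shift G (h : R) : continuous G -> (forall x, G (x + 1) = G x) ->
  mean (fun x => G (x + h)) = mean G.
Proof.
move=> cG G1; rewrite /mean; congr (_ +i* _).
  apply: (Rintegral_periodic_shift _ (continuous_ReC cG)) => x; by rewrite G1.
apply: (Rintegral_periodic_shift _ (continuous_ImC cG)) => x; by rewrite G1.
Qed.

Lemma Rintegral_dominated0 (g_ : nat -> R -> R) (M : R) :
  (forall n, continuous (g_ n)) -> (forall n x, `|g_ n x| <= M) ->
  (forall x, g_ ^~ x @ \oo --> (0 : R)) ->
  (fun n => \int[leb]_(x in `[0, 1]) g_ n x) @ \oo --> (0 : R).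
Proof.
move=> cg gM g0.
have [|||||_ _] := @dominated_convergence _ _ _ leb `[0, 1]%classic (measurable_itv _)
   (fun n => EFin \o g_ n) (EFin \o cst 0) (EFin \o cst M).
- by move=> n; apply: (measurable_int leb); exact: continuous_integrable_itv.
- by apply: (measurable_int leb); apply: continuous_integrable_itv; exact: cst_continuous.
- by apply: aeW => x _; apply: cvg_EFin; [exact: nearW|exact: g0].
- by apply: continuous_integrable_itv; exact: cst_continuous.
- by apply: aeW => x n _; rewrite /= lee_fin.
rewrite integral0 => h.
by have := fine_cvg h; apply.
Qed.

Lemma mean_dominated0 (G_ : nat -> R -> C) (M : R) :
  (forall n, continuous (G_ n)) -> (forall n x, normc (G_ n x) <= M) ->
  (forall x, G_ ^~ x @ \oo --> (0 : C)) ->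
  (fun n => mean (G_ n)) @ \oo --> (0 : C).
Proof.
move=> cG GM G0; apply: cvgC_ReIm => /=.
  apply: (@Rintegral_dominated0 (fun n x => complex.Re (G_ n x)) M) => [n|n x|x].
  exact: (continuous_ReC (cG n)).
    exact: le_trans (Re_le_normc _) (GM n x).
  exact: cvg_Re (G0 x).
apply: (@Rintegral_dominated0 (fun n x => complex.Im (G_ n x)) M) => [n|n x|x].
  exact: (continuous_ImC (cG n)).
  exact: le_trans (Im_le_normc _) (GM n x).
exact: cvg_Im (G0 x).
Qed.

End CircleMean.

(** * Differentiation along segments and the mean value inequality *)

Section Paths.
Variable R : realType.
Local Notation C := (cplx R).
Local Notation "x %:C" := (real_complex R x : C).
Implicit Types (f : C -> C) (z w p q u : C).

(** In Caratheodory's form there is no quotient, so it can be composed with increments that vanish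
    or that depend on a parameter. *)
Lemma derivable_caratheodory f z : derivable f z 1 ->
  exists phi : C -> C, [/\ phi k @[k --> (0 : C)] --> (0 : C), phi 0 = 0 &
    forall k, f (k + z) = f z + k * (derive1 f z + phi k)].
Proof.
move=> df; pose phi k := if k == 0 then 0 else k^-1 * (f (k + z) - f z) - derive1 f z.
exists phi; split; last 2 first.
- by rewrite /phi eqxx.
- move=> k; rewrite /phi; have [->|k0] := eqVneq k 0; first by rewrite add0r mul0r addr0.
  by field.
apply/(cvg_normcP (F := nbhs (0 : C))) => e e0.
have : h^-1 *: ((f \o shift z) (h *: 1) - f z) @[h --> (0 : C)^'] --> derive1 f z.
  by rewrite derive1E; exact: df.
move=> /cvg_normcP /(_ _ e0) /nbhs_ballP[d /= d0 hd]; apply/nbhs_ballP; exists d => // k kd.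
rewrite /phi; have [_|k0] := eqVneq k 0; first by rewrite subr0 normcC0 ltW.
by have := hd k kd k0; rewrite /GRing.scale /= mulr1 sub0r normcNn normcB.
Qed.

Lemma derivable_continuous f z : derivable f z 1 -> {for z, continuous f}.
Proof. by move=> df; apply/differentiable_continuous/derivable1_diffP. Qed.

Lemma path_derive f p q u (t : R) : derivable f (p + t%:C * q) 1 ->
  is_derive t 1 (fun t : R => complex.Re (u * f (p + t%:C * q)))
    (complex.Re (u * (q * derive1 f (p + t%:C * q)))).
Proof.
move=> df; have [phi [phi0 _ phiE]] := derivable_caratheodory df.
set F := fun t : R => _; set D := complex.Re _.
suff hg : h^-1 *: ((F \o shift t) (h *: 1) - F t) @[h --> (0:R)^'] --> D.
  by apply: DeriveDef; [apply/cvg_ex; exists D|exact: cvg_lim].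
have hq : (h%:C * q : C) @[h --> (0 : R)^'] --> (0 : C).
  apply/cvg_normcP => e e0; apply/nbhs_ballP; exists (e / (normc q + 1)) => /=.
    by rewrite divr_gt0 // ltr_wpDl ?normc_ge0.
  move=> h; rewrite /ball /= sub0r normrN ltr_pdivlMr ?ltr_wpDl ?normc_ge0 // => hh _.
  rewrite sub0r normcNn normcM normcR; apply: le_trans (ltW hh).
  by rewrite ler_wpM2l // lerDl.
have : complex.Re (u * (q * (derive1 f (p + t%:C * q) + phi (h%:C * q)))) @[h --> (0 : R)^'] --> D.
  apply: cvg_Re; apply: cvgM; first exact: cvg_cst.
  apply: cvgM; first exact: cvg_cst.
  rewrite -[X in _ --> X]addr0; apply: cvgD; first exact: cvg_cst.
  exact: cvg_comp hq phi0.
apply: cvg_trans; apply: near_eq_cvg; apply/nbhs_ballP; exists 1 => //= h _ h0.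
rewrite /F /GRing.scale /= mulr1.
have -> : p + (h + t)%:C * q = h%:C * q + (p + t%:C * q) by rewrite rmorphD /=; ring.
rewrite phiE -ReB -mulrBr [f _ + _]addrC addrK.
have -> : u * (h%:C * q * (derive1 f (p + t%:C * q) + phi (h%:C * q))) =
   h%:C * (u * (q * (derive1 f (p + t%:C * q) + phi (h%:C * q)))) by ring.
set c := u * _; have -> : complex.Re (h%:C * c) = h * complex.Re c.
  by case: c => a b /=; rewrite mul0r subr0.
by rewrite mulKf.
Qed.

(** Mean value inequality with a variable bound: the real function [phi - psi] has nonpositive
    derivative, where [phi] is the component of [f] along its own increment. A primitive [psi] of
    the bound replaces an integral. *)
Lemma path_growth f p q (psi dpsi : R -> R) (a b : R) : a <= b ->
  (forall t, a <= t <= b -> derivable f (p + t%:C * q) 1) ->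
  (forall t, a <= t <= b -> is_derive t 1 psi (dpsi t)) ->
  (forall t, a <= t <= b -> normc q * normc (derive1 f (p + t%:C * q)) <= dpsi t) ->
  normc (f (p + b%:C * q) - f (p + a%:C * q)) <= psi b - psi a.
Proof.
move=> ab df dp hle; have [u u1 ->] := normc_dual (f (p + b%:C * q) - f (p + a%:C * q)).
pose phi (t : R) := complex.Re (u * f (p + t%:C * q)).
have dg t : a <= t <= b -> is_derive t 1 (phi - psi)
    (complex.Re (u * (q * derive1 f (p + t%:C * q))) - dpsi t).
  by move=> tab; have d1 := path_derive u (df _ tab); have d2 := dp _ tab; apply: is_deriveB.
have dg' t : t \in `]a, b[ -> is_derive t 1 (phi - psi)
    (complex.Re (u * (q * derive1 f (p + t%:C * q))) - dpsi t).
  by rewrite in_itv /= => /andP[at_ tb]; apply: dg; rewrite !ltW.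
have cg : {within `[a, b], continuous (phi - psi)}.
  apply: continuous_in_subspaceT => t /set_mem/=; rewrite in_itv /= => /dg[dt _].
  exact/differentiable_continuous/derivable1_diffP.
have [c cab] := MVT_segment ab dg' cg.
rewrite in_itv /= in cab; move=> E.
rewrite mulrBr ReB -/(phi b) -/(phi a) -subr_le0.
have -> : phi b - phi a - (psi b - psi a) = (phi - psi) b - (phi - psi) a.
  by rewrite !fctE; ring.
rewrite E mulr_le0_ge0 ?subr_ge0 // subr_le0; apply: le_trans (hle _ cab).
apply: le_trans (ler_norm _) _; apply: le_trans (Re_le_normc _) _.
by rewrite !normcM u1 mul1r.
Qed.

Lemma disc_convex p q (r t : R) : normc p <= r -> normc (p + q) <= r -> 0 <= t <= 1 ->
  normc (p + t%:C * q) <= r.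
Proof.
move=> pr qr /andP[t0 t1].
have -> : p + t%:C * q = (1 - t)%:C * p + t%:C * (p + q) by rewrite rmorphB rmorph1 /=; ring.
apply: le_trans (normcD _ _) _; rewrite !normcM !normcR !ger0_norm ?subr_ge0 //.
have -> : r = (1 - t) * r + t * r by ring.
by rewrite lerD // ler_wpM2l // subr_ge0.
Qed.

Lemma lipschitz_disc f (r L : R) : r < 1 -> analytic_on_disc f ->
  (forall z, normc z <= r -> normc (derive1 f z) <= L) ->
  forall z w, normc z <= r -> normc w <= r -> normc (f z - f w) <= L * normc (z - w).
Proof.
move=> r1 af fL z w zr wr.
have inr t : 0 <= t <= 1 -> normc (w + t%:C * (z - w)) <= r.
  by apply: disc_convex => //; rewrite addrC subrK.
have := @path_growth f w (z - w) (fun t => t * (L * normc (z - w))) (cst (L * normc (z - w))) 0 1 ler01.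
have -> : w + 1%:C * (z - w) = z by rewrite rmorph1; ring.
have -> : w + 0%:C * (z - w) = w by rewrite rmorph0; ring.
rewrite mul1r mul0r subr0; apply.
- by move=> t /inr h; apply: af; exact: le_lt_trans h r1.
- by move=> t _; apply: is_derive_eq; rewrite scaler0 add0r /GRing.scale /= mulr1.
- by move=> t /inr h; rewrite mulrC ler_wpM2r ?normc_ge0 // fL.
Qed.

End Paths.

(** * Cauchy's formula on the unit circle and Taylor expansions *)

Section Cauchy.
Variable R : realType.
Local Notation C := (cplx R).
Local Notation "x %:C" := (real_complex R x : C).
Implicit Types (F f : C -> C) (z w : C).
Local Notation tau := (pi *+ 2 : R).

Definition unitc (t : R) : C := cos (tau * t) +i* sin (tau * t).

Lemma unitcD s t : unitc (s + t) = unitc s * unitc t.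
Proof.
by rewrite /unitc mulrDr cosD sinD; congr (_ +i* _); rewrite addrC.
Qed.

Lemma unitc0 : unitc 0 = 1.
Proof. by rewrite /unitc mulr0 cos0 sin0. Qed.

Lemma unitc_periodic t : unitc (t + 1) = unitc t.
Proof. by rewrite unitcD /unitc mulr1 cos2pi sin2pi [_ +i* 0]/(1 : C) mulr1. Qed.

Lemma normc_unitc t : normc (unitc t) = 1.
Proof. by rewrite /normc /unitc cos2Dsin2 sqrtr1. Qed.

Lemma unitc_neq0 t : unitc t != 0.
Proof. by rewrite -normc_eq0 normc_unitc oner_eq0. Qed.

Lemma unitcX t n : unitc (n%:R * t) = unitc t ^+ n.
Proof.
elim: n => [|n ih]; first by rewrite mul0r unitc0 expr0.
by rewrite -natr1 mulrDl mul1r unitcD ih exprSr.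
Qed.

Lemma unitc_half : unitc 2^-1 = -1.
Proof.
rewrite /unitc; have -> : tau * 2^-1 = pi by rewrite -[pi *+ 2]mulr_natr mulfK ?pnatr_eq0.
by rewrite cospi sinpi; apply/eqP; rewrite eq_complex /= oppr0 !eqxx.
Qed.

Lemma continuous_unitc : continuous unitc.
Proof.
have ct : continuous (fun t : R => tau * t).
  by move=> t; apply: cvgM; [exact: cvg_cst|exact: cvg_id].
move=> t; apply: cvgC_ReIm => /=.
  by apply: continuous_comp; [exact: ct|exact: continuous_cos].
by apply: continuous_comp; [exact: ct|exact: continuous_sin].
Qed.

Lemma unitc_slope :
  h%:C^-1 * (unitc h - 1) @[h --> (0 : R)^'] --> (0 +i* tau : C).
Proof.
have dt : is_derive (0 : R) 1 (fun h : R => tau * h) tau.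
  apply: is_derive_eq.
  by rewrite /GRing.scale /= mulr1.
have quo (g : R -> R) (l : R) : is_derive (0 : R) 1 g l ->
    h^-1 * (g h - g 0) @[h --> (0 : R)^'] --> l.
  move=> [dg <-]; apply: (cvg_trans _ dg); apply: near_eq_cvg; near=> h.
  by rewrite /GRing.scale /= mulr1 addr0.
have ic : is_derive (tau * 0) 1 (@cos R) (- sin (tau * 0)) by exact: is_derive_cos.
have isn : is_derive (tau * 0) 1 (@sin R) (cos (tau * 0)) by exact: is_derive_sin.
have /quo hc := @is_derive1_comp _ (@cos R) (fun h : R => tau * h) 0 _ _ ic dt.
have /quo hs := @is_derive1_comp _ (@sin R) (fun h : R => tau * h) 0 _ _ isn dt.
rewrite mulr0 /= cos0 mul1r in hs; rewrite mulr0 /= sin0 oppr0 mul0r in hc.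
have E (h : R) : h%:C^-1 * (unitc h - 1) =
   h^-1 * (cos (tau * h) - cos (tau * 0)) +i* (h^-1 * (sin (tau * h) - sin (tau * 0))).
  rewrite -fmorphV /unitc mulr0 cos0 sin0; apply/eqP.
  by rewrite eq_complex /= !mul0r subr0 addr0 oppr0 !eqxx.
under eq_fun do rewrite E.
by apply: cvgC_ReIm.
Unshelve. all: by end_near. Qed.

Lemma continuous_unitcVX k : continuous (fun t => (unitc t)^-1 ^+ k).
Proof.
move=> t; elim: k => [|k ih]; first exact: cvg_cst.
under eq_fun do rewrite exprS; apply: cvgM ih.
by apply: cvgV; [exact: unitc_neq0|exact: continuous_unitc].
Qed.

(** On the circle [w = unitc t] one has [dw = 2 pi i w dt], so the Cauchy kernel
    [dw / (2 pi i (w - z))] becomes [w / (w - z) dt]. *)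
Definition cauchy_kernel z (t : R) : C := unitc t / (unitc t - z).

Lemma unitc_sub_neq0 z t : normc z < 1 -> unitc t - z != 0.
Proof.
by move=> z1; rewrite subr_eq0; apply/eqP => E; rewrite -E normc_unitc ltxx in z1.
Qed.

Lemma continuous_kernel z : normc z < 1 -> continuous (cauchy_kernel z).
Proof.
move=> z1 t; apply: cvgM; first exact: continuous_unitc.
apply: cvgV; first exact: unitc_sub_neq0.
by apply: cvgB; [exact: continuous_unitc|exact: cvg_cst].
Qed.

Lemma normc_kernel z t : normc z < 1 -> normc (cauchy_kernel z t) <= (1 - normc z)^-1.
Proof.
move=> z1; rewrite /cauchy_kernel normcM normcV normc_unitc mul1r.
rewrite lef_pV2 ?posrE ?subr_gt0 // ?normc_gt0 ?unitc_sub_neq0 //.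
by rewrite lerBlDr -(normc_unitc t) -{1}(subrK z (unitc t)) normcD.
Qed.

(** The kernel is the geometric series in [z / unitc t]. The remainder after [n] terms is again the
    kernel times the [n]-th power of that ratio, so partial sums telescope and the error decays like
    [normc z ^+ n]. *)
Lemma mean_kernel_series (G : R -> C) z (M : R) : continuous G ->
  (forall t, normc (G t) <= M) -> normc z < 1 ->
  series (fun k => mean (fun t => G t * (unitc t)^-1 ^+ k) * z ^+ k) @ \oo -->
  mean (fun t => G t * cauchy_kernel z t).
Proof.
move=> cG GM z1.
have cV := continuous_unitcVX.
have cGV k : continuous (fun t => G t * (unitc t)^-1 ^+ k).
  by move=> t; apply: cvgM; [exact: cG|exact: cV].
have cGK : continuous (fun t => G t * cauchy_kernel z t).
  by move=> t; apply: cvgM; [exact: cG|exact: continuous_kernel].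
pose rest n t := G t * cauchy_kernel z t * (z ^+ n * (unitc t)^-1 ^+ n).
have crest n : continuous (rest n).
  move=> t; apply: cvgM; first exact: cGK.
  by apply: cvgM; [exact: cvg_cst|exact: cV].
have E n : series (fun k => mean (fun t => G t * (unitc t)^-1 ^+ k) * z ^+ k) n =
    mean (fun t => G t * cauchy_kernel z t) - mean (rest n).
  rewrite /series /=; elim: n => [|n ih].
    rewrite big_nil /rest; under [X in _ - mean X]eq_fun do rewrite !expr0 !mulr1.
    by rewrite subrr.
  have step : mean (rest n) - mean (rest n.+1) =
      z ^+ n * mean (fun t => G t * (unitc t)^-1 ^+ n).
    rewrite -(meanB (crest n) (crest n.+1)) -(meanZ (z ^+ n) (cGV n)).
    congr (mean _); apply/funext => t.
    rewrite /rest /cauchy_kernel !exprS; field.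
    by rewrite unitc_neq0 unitc_sub_neq0.
  by rewrite big_nat_recr //= ih [_ * z ^+ n]mulrC -step; ring.
have M0 : 0 <= M by apply: le_trans (GM 0); exact: normc_ge0.
suff rest0 : (fun n => mean (rest n)) @ \oo --> (0 : C).
  rewrite (funext E : series _ = _).
  move: (mean (fun t => _)) => A; rewrite -[X in _ --> X]subr0.
  by apply: cvgB rest0; exact: cvg_cst.
apply/cvg_normcP => e e0.
have geo0 : M * (1 - normc z)^-1 * normc z ^+ n @[n --> \oo] --> (0 : R).
  rewrite -[X in _ --> X](mulr0 (M * (1 - normc z)^-1)).
  by apply: cvgM; [exact: cvg_cst|apply: cvg_expr; rewrite ger0_norm ?normc_ge0].
move/cvgrPdist_le : geo0 => /(_ _ e0); apply: filterS => n; apply: le_trans.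
rewrite !sub0r normcNn normrN; apply: le_trans (ler_norm _).
apply: mean_le; first exact: crest.
move=> t; rewrite /rest normcM [normc (z ^+ n * _)]normcM [normc (_^-1 ^+ n)]normcX.
rewrite normcV normc_unitc invr1 expr1n mulr1 normcX [normc (G t * _)]normcM.
rewrite ler_wpM2r ?exprn_ge0 ?normc_ge0 // ler_pM ?normc_ge0 //.
exact: normc_kernel.
Qed.

(** A shift by half a period, [1 / (2 k)], changes the sign of the function but not its mean. *)
Lemma mean_unitc_inv k : (0 < k)%N -> mean (fun t => (unitc t)^-1 ^+ k) = 0.
Proof.
move=> k0; set G := fun t => _.
have cG : continuous G by exact: continuous_unitcVX.
have G1 t : G (t + 1) = G t by rewrite /G unitc_periodic.
pose h : R := (2 * k%:R)^-1.
have Gh t : G (t + h) = -1 * G t.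
  rewrite /G unitcD invfM exprMn mulrC [(unitc h)^-1 ^+ k]exprVn -unitcX.
  have -> : k%:R * h = 2^-1 by rewrite /h invfM mulrCA mulfV ?mulr1 // pnatr_eq0 -lt0n.
  by rewrite unitc_half invrN invr1.
have := mean_periodic_shift h cG G1; under eq_fun do rewrite Gh.
rewrite (meanZ _ cG) mulN1r => /eqP; rewrite eq_sym -subr_eq0 opprK -mulr2n mulrn_eq0 /=.
by move/eqP.
Qed.

(** In the expansion of the kernel only the term of index 0 has a nonzero mean. *)
Lemma mean_kernel z : normc z < 1 -> mean (cauchy_kernel z) = 1.
Proof.
move=> z1.
have n1 (t : R) : normc (1 : C) <= 1 by rewrite normc1n.
have c1 : continuous (fun _ : R => 1 : C) by move=> t; exact: cvg_cst.
have h := mean_kernel_series c1 n1 z1.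
have E : (fun t => 1 * cauchy_kernel z t) = cauchy_kernel z by apply/funext => t; rewrite mul1r.
rewrite E in h.
apply: (cvg_unique _ h); first exact: norm_hausdorff.
apply: (@cvg_trans _ (cst (1 : C) @ \oo)); last exact: cvg_cst.
apply: near_eq_cvg; near=> m; rewrite /series /=.
have m0 : (0 < m)%N by near: m; exact: nbhs_infty_gt.
rewrite -(prednK m0) big_nat_recl //= !expr0 mulr1.
rewrite [X in mean X](_ : _ = fun=> 1); last by apply/funext => t; rewrite expr0 mulr1.
rewrite mean_cst big1 ?addr0 // => k _.
rewrite [X in mean X](_ : _ = fun t => (unitc t)^-1 ^+ k.+1); last by apply/funext => t; rewrite mul1r.
by rewrite mean_unitc_inv // mul0r.
Unshelve. all: by end_near. Qed.

Section Formula.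
Variables (F : C -> C) (L : R) (z : C).
Hypothesis dF : forall w, normc w <= 1 -> derivable F w 1.
(** Takes the place of continuity of the derivative: it dominates the difference quotients below, so
    limits may be taken under the mean. *)
Hypothesis lipF : forall w w', normc w <= 1 -> normc w' <= 1 ->
  normc (F w - F w') <= L * normc (w - w').
Hypothesis z1 : normc z < 1.

Let path (s t : R) : C := z + s%:C * (unitc t - z).

(* [J] interpolates between [F z] and the Cauchy integral.  Formally
   [J' s] is the mean of [F'(path s t) * unitc t], which is a multiple of the
   derivative in [t] of the 1-periodic function [F (path s t)], so it is zero. *)
Let J (s : R) : C := mean (fun t => F (path s t) * cauchy_kernel z t).

Let path_disc (s t : R) : 0 <= s <= 1 -> normc (path s t) <= 1.
Proof.
move=> s01; apply: disc_convex => //; first exact: ltW.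
by rewrite addrC subrK normc_unitc.
Qed.

Let pathB s s' t : path s t - path s' t = (s - s')%:C * (unitc t - z).
Proof. by rewrite /path rmorphB /=; ring. Qed.

Let continuous_Fpath (s : R) : 0 <= s <= 1 -> continuous (fun t => F (path s t)).
Proof.
move=> s01 t; apply: continuous_comp.
  apply: cvgD; first exact: cvg_cst.
  apply: cvgM; first exact: cvg_cst.
  by apply: cvgB; [exact: continuous_unitc|exact: cvg_cst].
by apply: derivable_continuous; apply: dF; exact: path_disc.
Qed.

Let continuous_J (s : R) : 0 <= s <= 1 -> continuous (fun t => F (path s t) * cauchy_kernel z t).
Proof.
by move=> s01 t; apply: cvgM; [exact: continuous_Fpath|exact: continuous_kernel].
Qed.

Let kernelE t : (unitc t - z) * cauchy_kernel z t = unitc t.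
Proof. by rewrite /cauchy_kernel mulrC divfK // unitc_sub_neq0. Qed.

Let L0 : 0 <= L.
Proof.
have := @lipF 0 1; rewrite normcC0 sub0r !normcNn normc1n mulr1 ler01 lexx.
by move=> /(_ isT isT); apply: le_trans; exact: normc_ge0.
Qed.

(** The increment of the path carries the factor [unitc t - z], which cancels the denominator of the
    kernel; the constant is therefore [L], however close [z] is to the circle. *)
Let J_lipschitz (s s' : R) : 0 <= s <= 1 -> 0 <= s' <= 1 -> normc (J s - J s') <= L * `|s - s'|.
Proof.
move=> s01 s01'; rewrite /J -(meanB (continuous_J s01) (continuous_J s01')).
apply: mean_le.
  by move=> t; apply: cvgB; exact: continuous_J.
move=> t; rewrite -mulrBl normcM.
apply: (le_trans (ler_wpM2r (normc_ge0 _) (lipF (path_disc _ s01) (path_disc _ s01')))).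
by rewrite pathB -mulrA -normcM -mulrA kernelE normcM normc_unitc mulr1 normcR.
Qed.

Let J_slope (s : R) (h : nat -> R) : 0 < s < 1 -> (forall n, h n != 0) ->
  (forall n, 0 <= s + h n <= 1) -> h @ \oo --> 0 ->
  (h n)%:C^-1 * (J (s + h n) - J s) @[n --> \oo] --> (0 : C).
Proof.
move=> /andP[s0 s1] hn0 hs h0.
have s01 : 0 <= s <= 1 by rewrite !ltW.
have slope : (h n)%:C^-1 * (unitc (h n) - 1) @[n --> \oo] --> (0 +i* tau : C).
  apply: (cvg_comp _ _ _ (@unitc_slope)) => P /nbhs_ballP[d /= d0 hd].
  move/cvgrPdist_lt : h0 => /(_ _ d0); apply: filterS => n hn.
  by apply: hd => //; rewrite /ball /= in hn *.
have [B hB] : exists B, forall n, normc ((h n)%:C^-1 * (unitc (h n) - 1)) <= B.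
  move: (slope) => /cvg_normc/cvgP/cvg_seq_bounded[M [_ hM]].
  exists (M + 1) => n; have := hM (M + 1) _ n I; rewrite ltrDl ltr01 => /(_ erefl) /=.
  by rewrite ger0_norm ?normc_ge0.
have tau0 : (0 +i* tau : C) != 0.
  by rewrite eq_complex /= eqxx /= mulrn_eq0 /= gt_eqF ?pi_gt0.
move: (0 +i* tau : C) slope tau0 => tauC slope tau0.
have sC0 : s%:C != 0 :> C by rewrite -normc_eq0 normcR normr_eq0 gt_eqF.
have hC0 n : (h n)%:C != 0 :> C by rewrite -normc_eq0 normcR normr_eq0.
pose Fp t := F (path s t).
have cFp : continuous Fp := continuous_Fpath s01.
have cFph n : continuous (fun t => Fp (t + h n)).
  move=> t; apply: continuous_comp; last exact: cFp.
  by apply: cvgD; [exact: cvg_id|exact: cvg_cst].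
(* A rotation by [h n] moves [path s t] by about [s * unitc t * (2 pi i) * h n]. Dividing by [s], by
   the slope [tauC] and by [h n] leaves [unitc t] times the derivative, the limit of [A n t]. *)
pose c n : C := tauC^-1 * s%:C^-1 * (h n)%:C^-1.
pose dJ n t := F (path (s + h n) t) * cauchy_kernel z t - F (path s t) * cauchy_kernel z t.
pose dF' n t := Fp (t + h n) - Fp t.
have cdJ n : continuous (dJ n) by move=> t; apply: cvgB; exact: continuous_J.
have cdF n : continuous (dF' n) by move=> t; apply: cvgB; [exact: cFph|exact: cFp].
pose A n t : C := (h n)%:C^-1 * dJ n t.
pose D n t : C := c n * dF' n t.
have cA n : continuous (A n) by move=> t; apply: cvgM; [exact: cvg_cst|exact: cdJ].
have cD n : continuous (D n) by move=> t; apply: cvgM; [exact: cvg_cst|exact: cdF].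
have meanE n : mean (fun t => A n t - D n t) = (h n)%:C^-1 * (J (s + h n) - J s).
  rewrite (meanB (cA n) (cD n)) (meanZ _ (cdJ n)) (meanZ _ (cdF n)).
  rewrite (meanB (continuous_J (hs n)) (continuous_J s01)) (meanB (cFph n) cFp).
  (* [D n] has mean zero by periodicity, so subtracting it is free; it has the
     same pointwise limit as [A n]. *)
  have Fp1 t : Fp (t + 1) = Fp t by rewrite /Fp /path unitc_periodic.
  by rewrite (mean_periodic_shift (h n) cFp Fp1) subrr mulr0 subr0.
rewrite -(funext meanE).
have pathDs n t : path s (t + h n) - path s t = s%:C * unitc t * (unitc (h n) - 1).
  by rewrite /path unitcD; ring.
apply: (@mean_dominated0 _ _ (L + normc tauC^-1 * (L * B))).
- by move=> n t; apply: cvgB; [exact: cA|exact: cD].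
- move=> n t; apply: le_trans (normcD _ _) _; rewrite normcNn; apply: lerD.
    rewrite /A normcM normcV ler_pdivrMl ?normc_gt0 // normcR /dJ -mulrBl.
    rewrite [normc (_ * _)]normcM [leRHS]mulrC.
    apply: (le_trans (ler_wpM2r (normc_ge0 _) (lipF (path_disc _ (hs n)) (path_disc _ s01)))).
    by rewrite pathB addrAC subrr add0r -mulrA -normcM -mulrA kernelE normcM normc_unitc mulr1 normcR.
  rewrite /D /dF' /c -!mulrA normcM ler_wpM2l ?normc_ge0 //.
  rewrite normcM normcM !normcV ler_pdivrMl ?normc_gt0 // ler_pdivrMl ?normc_gt0 //.
  apply: (le_trans (lipF (path_disc _ s01) (path_disc _ s01))).
  rewrite pathDs -mulrA [normc (s%:C * _)]normcM [normc (unitc t * _)]normcM normc_unitc mul1r.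
  have hBn := hB n; rewrite normcM normcV ler_pdivrMl ?normc_gt0 // in hBn.
  have -> : normc (h n)%:C * (normc s%:C * (L * B)) = L * (normc s%:C * (normc (h n)%:C * B)) by ring.
  by rewrite ler_wpM2l // ler_wpM2l ?normc_ge0.
move=> t; have [phi [phi0 _ phiE]] := derivable_caratheodory (dF (path_disc t s01)).
set f' := derive1 F _ in phiE.
have hC : (h n)%:C @[n --> \oo] --> (0 : C).
  apply/cvg_normcP => e e0; move/cvgrPdist_le : h0 => /(_ _ e0); apply: filterS => n.
  by rewrite !sub0r normcNn normcR normrN.
have d1 : (h n)%:C * (unitc t - z) @[n --> \oo] --> (0 : C).
  by rewrite -[X in _ --> X](mul0r (unitc t - z)); apply: cvgM; [exact: hC|exact: cvg_cst].
have d2 : s%:C * unitc t * (unitc (h n) - 1) @[n --> \oo] --> (0 : C).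
  have E n : s%:C * unitc t * (unitc (h n) - 1) =
     s%:C * unitc t * ((h n)%:C * ((h n)%:C^-1 * (unitc (h n) - 1))) by rewrite mulVKf.
  rewrite (funext E) -[X in _ --> X](mulr0 (s%:C * unitc t)).
  apply: cvgM; first exact: cvg_cst.
  have X := cvgM hC slope; rewrite mul0r in X; exact: X.
have AE n : A n t = unitc t * (f' + phi ((h n)%:C * (unitc t - z))).
  rewrite /A /dJ -mulrBl.
  have -> : path (s + h n) t = (h n)%:C * (unitc t - z) + path s t.
    by rewrite -[LHS](subrK (path s t)) pathB addrAC subrr add0r.
  rewrite phiE; move: (phi _) => P; move: (cauchy_kernel z t) (unitc t - z) (kernelE t) => K q <-; field.
  exact: hC0.
have DE n : D n t = unitc t * (tauC^-1 * ((h n)%:C^-1 * (unitc (h n) - 1)) *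
     (f' + phi (s%:C * unitc t * (unitc (h n) - 1)))).
  rewrite /D /dF' /Fp /c.
  have -> : path s (t + h n) = s%:C * unitc t * (unitc (h n) - 1) + path s t.
    by rewrite -pathDs subrK.
  rewrite phiE; move: (phi _) => P; field.
  by apply/and3P; split; [exact: hC0|exact: tau0|exact: sC0].
have {}AE : A ^~ t @ \oo --> unitc t * (f' + 0).
  rewrite (funext AE); apply: cvgM; first exact: cvg_cst.
  by apply: cvgD; [exact: cvg_cst|exact: cvg_comp d1 phi0].
have {}DE : D ^~ t @ \oo --> unitc t * (tauC^-1 * tauC * (f' + 0)).
  rewrite (funext DE); apply: cvgM; first exact: cvg_cst.
  apply: cvgM; first by apply: cvgM; [exact: cvg_cst|exact: slope].
  by apply: cvgD; [exact: cvg_cst|exact: cvg_comp d2 phi0].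
have -> : (0 : C) = unitc t * (f' + 0) - unitc t * (tauC^-1 * tauC * (f' + 0)).
  by rewrite mulVf // mul1r subrr.
exact: cvgB AE DE.
Qed.

Let J_derive (u : C) (s : R) : 0 < s < 1 -> is_derive s 1 (fun s : R => complex.Re (u * J s)) 0.
Proof.
move=> s01; set g := fun s : R => _.
suff hg : h^-1 *: ((g \o shift s) (h *: 1) - g s) @[h --> (0 : R)^'] --> (0 : R).
  by apply: DeriveDef; [apply/cvg_ex; exists 0|exact: cvg_lim].
have E h : h^-1 *: ((g \o shift s) (h *: 1) - g s) =
    complex.Re (u * (h%:C^-1 * (J (s + h) - J s))).
  rewrite /g /GRing.scale /= mulr1 -ReB -mulrBr (addrC h) mulrCA -fmorphV.
  by case: (u * _) => a b /=; rewrite mul0r subr0.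
rewrite (funext E); apply/cvgr_dnbhsP => v [v0 vl].
(* [J_slope] needs the whole sequence to stay in [[0, 1]]; a tail of [v] does. *)
have [N vN] : exists N, forall n, 0 <= s + v (n + N)%N <= 1.
  have /andP[s0 s1] := s01; have d0 : 0 < Num.min s (1 - s) by rewrite lt_min s0 subr_gt0.
  move/cvgrPdist_lt : vl => /(_ _ d0)[N _ hN]; exists N => n.
  have := hN (n + N)%N (leq_addl _ _); rewrite sub0r normrN lt_min => /andP[h1 h2].
  have h3 := ler_norm (v (n + N)%N); have h4 := ler_norm (- v (n + N)%N).
  by rewrite normrN in h4; apply/andP; split; lra.
rewrite -(cvg_shiftn N).
have vl' : (fun n => v (n + N)%N) @ \oo --> 0 by rewrite (cvg_shiftn N).
have := J_slope s01 (fun n => v0 (n + N)%N) vN vl' => /(cvgM (cvg_cst u)).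
by rewrite mulr0 => /cvg_Re.
Qed.

Let J0E : J 0 = F z.
Proof.
rewrite /J -[RHS]mulr1 -(mean_kernel z1) -(meanZ _ (continuous_kernel z1)).
by congr mean; apply/funext => t; rewrite /path rmorph0 mul0r addr0.
Qed.

(** The zero derivative of [J] is known only inside []0, 1[], so [J] is constant on [[d, 1 - d]] and
    the two ends are reached by the Lipschitz bound. *)
Lemma cauchy_formula : mean (fun t => F (unitc t) * cauchy_kernel z t) = F z.
Proof.
have -> : mean (fun t => F (unitc t) * cauchy_kernel z t) = J 1.
  by congr mean; apply/funext => t; rewrite /path rmorph1 mul1r addrC subrK.
rewrite -J0E; apply/eqP; rewrite -subr_eq0 -normc_eq0 eq_le normc_ge0 andbT.
apply/ler_addgt0Pr => e e0; rewrite add0r.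
(* The bound [4^-1] ensures [d <= 1 - d]; the other makes the two end errors, [L * d] each, sum to
   at most [e]. The [+ 1] covers [L = 0]. *)
pose d := Num.min (4^-1) (e / (2 * (L + 1))).
have d0 : 0 < d by rewrite lt_min invr_gt0 ltr0n divr_gt0 // mulr_gt0 // ltr_wpDl.
have d4 : d <= 4^-1 by rewrite ge_min lexx.
have de : 2 * (L * d) <= e.
  have : d <= e / (2 * (L + 1)) by rewrite ge_min lexx orbT.
  rewrite ler_pdivlMr ?mulr_gt0 ?ltr_wpDl // => h; apply: le_trans h.
  have -> : d * (2 * (L + 1)) = 2 * (L * d) + 2 * d by ring.
  by rewrite lerDl mulr_ge0 // ltW.
have d1 : d <= 1 - d by lra.
have JJ : J (1 - d) = J d.
  apply/eqP; rewrite -subr_eq0 -normc_eq0; have [u _ ->] := normc_dual (J (1 - d) - J d).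
  pose g s := complex.Re (u * J s).
  have dg s : s \in `[d, 1 - d] -> is_derive s 1 g 0.
    by rewrite in_itv /= => /andP[h1 h2]; apply: J_derive; apply/andP; split; lra.
  have cg : {within `[d, 1 - d], continuous g}.
    apply: continuous_in_subspaceT => t /set_mem/= /dg[dt _].
    exact/differentiable_continuous/derivable1_diffP.
  have [c _] := @MVT_segment _ g (cst 0) _ _ d1 (fun s ss => dg s (subset_itv_oo_cc ss)) cg.
  by rewrite mul0r mulrBr ReB => ->.
have -> : J 1 - J 0 = (J 1 - J (1 - d)) + (J d - J 0) by rewrite JJ addrA subrK.
apply: le_trans (normcD _ _) _; apply: le_trans de.
have h1 : normc (J 1 - J (1 - d)) <= L * d.
  have := @J_lipschitz 1 (1 - d); have -> : 1 - (1 - d) = d by ring.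
  by rewrite (ger0_norm (ltW d0)); apply; apply/andP; split; lra.
have h2 : normc (J d - J 0) <= L * d.
  have := @J_lipschitz d 0; rewrite subr0.
  by rewrite (ger0_norm (ltW d0)); apply; apply/andP; split; lra.
by rewrite mulr_natl mulr2n; exact: lerD h1 h2.
Qed.

End Formula.

Lemma taylor_closed (F : C -> C) (L : R) :
  (forall w, normc w <= 1 -> derivable F w 1) ->
  (forall w w', normc w <= 1 -> normc w' <= 1 -> normc (F w - F w') <= L * normc (w - w')) ->
  power_series_on_disc (fun k => mean (fun t => F (unitc t) * (unitc t)^-1 ^+ k)) F.
Proof.
move=> dF lF z z1; rewrite -[X in _ --> X](cauchy_formula dF lF z1).
apply: (mean_kernel_series _ (M := normc (F 0) + L)) => //.
  move=> t; apply: continuous_comp; first exact: continuous_unitc.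
  by apply: derivable_continuous; apply: dF; rewrite normc_unitc.
move=> t; have := lF (unitc t) 0; rewrite subr0 normc_unitc normcC0 lexx ler01 mulr1.
move=> /(_ isT isT) h; have := normcD (F 0) (F (unitc t) - F 0).
by rewrite addrC subrK; lra.
Qed.

(** The formula needs the closed disc, so it is applied to the dilations [f (r z)]. By uniqueness
    their coefficients divided by [r ^+ k] are independent of [r]. The last clause is Cauchy's
    estimate [normc (a k) * r ^+ k <= B] as [r] tends to 1. *)
Lemma analytic_power_series f :
  analytic_on_disc f ->
  (forall r : R, r < 1 -> exists L, forall z, normc z <= r -> normc (derive1 f z) <= L) ->
  exists2 a, power_series_on_disc a f &
    forall B : R, (forall z, unit_disc z -> normc (f z) <= B) -> forall k, normc (a k) <= B.
Proof.
move=> af bf.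
pose fs (r : R) (z : C) : C := f (r%:C * z).
pose c (r : R) (k : nat) : C := mean (fun t => fs r (unitc t) * (unitc t)^-1 ^+ k).
have fsP r : 0 < r < 1 -> power_series_on_disc (c r) (fs r).
  move=> /andP[r0 r1]; have [L hL] := bf r r1.
  have inr w : normc w <= 1 -> normc (r%:C * w) <= r.
    by move=> w1; rewrite normcM normcR gtr0_norm // ler_piMr // ltW.
  apply: (@taylor_closed _ (L * r)).
    move=> w /inr w1; apply/derivable1_diffP; apply: differentiable_comp.
      by apply/derivable1_diffP; apply: derivableM.
    by apply/derivable1_diffP; apply: af; exact: le_lt_trans w1 r1.
  move=> w w' w1 w1'; apply: le_trans (lipschitz_disc r1 af hL (inr _ w1) (inr _ w1')) _.
  by rewrite -mulrBr normcM normcR gtr0_norm // mulrA.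
have cE r s k : 0 < r < 1 -> 0 < s < 1 -> c r k / r%:C ^+ k = c s k / s%:C ^+ k.
  wlog rs : r s / r <= s.
    by move=> h r01 s01; have [rs|/ltW rs] := leP r s; [|apply/esym]; apply: h.
  move=> r01 s01; have /andP[r0 r1] := r01; have /andP[s0 s1] := s01.
  have r0C : r%:C != 0 by rewrite -normc_eq0 normcR normr_eq0 gt_eqF.
  have s0C : s%:C != 0 by rewrite -normc_eq0 normcR normr_eq0 gt_eqF.
  have : power_series_on_disc (fun k => c s k * (r%:C / s%:C) ^+ k) (fs r).
    move=> z z1; have z1' : unit_disc (r%:C / s%:C * z).
      rewrite /unit_disc /mkset normcM normcM normcV !normcR !gtr0_norm //.
      apply: le_lt_trans (_ : normc z < 1) => //.
      by rewrite ler_piMl ?normc_ge0 // ler_pdivrMr // mul1r.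
    have := fsP _ s01 _ z1'; rewrite {1}/fs.
    have -> : s%:C * (r%:C / s%:C * z) = r%:C * z by rewrite mulrA [s%:C * _]mulrC divfK.
    by under eq_fun do rewrite exprMn mulrA.
  move=> /(power_series_inj (fsP _ r01)) /(congr1 (@^~ k)) ->.
  by rewrite expr_div_n -mulrA; congr (_ * _); rewrite mulrAC divff ?mul1r ?expf_neq0.
have h01 : 0 < (2^-1 : R) < 1 by lra.
exists (fun k => c 2^-1 k / (2^-1)%:C ^+ k) => [z z1|B fB k]; last first.
  set a := normc _; suff ar (r : R) : 0 < r < 1 -> a * r ^+ k <= B.
    have ca : a * r ^+ k @[r --> (1 : R)^'-] --> a.
      rewrite -[X in _ --> X]mulr1 -[X in _ * X](expr1n R k).
      apply: cvg_at_left_filter; apply: cvgM; first exact: cvg_cst.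
      exact: exprn_continuous.
    rewrite -(cvg_lim (@Rhausdorff R) ca); apply: limr_le; first by apply/cvg_ex; exists a.
    near=> r; apply: ar; apply/andP; split; near: r; last exact: nbhs_left_lt.
    by apply: nbhs_left_gt.
  move=> r01; have /andP[r0 r1] := r01.
  rewrite /a (cE _ r) // normcM normcV normcX normcR gtr0_norm // divfK; last first.
    by rewrite expf_neq0 // gt_eqF.
  have dfs w : normc w <= 1 -> unit_disc (r%:C * w).
    move=> w1; rewrite /unit_disc /mkset normcM normcR gtr0_norm //.
    by apply: le_lt_trans r1; rewrite ler_piMr // ltW.
  apply: mean_le.
    move=> t; apply: cvgM; last exact: continuous_unitcVX.
    rewrite /fs; apply: (@continuous_comp _ _ _ (fun t => r%:C * unitc t) f).
      by apply: cvgM; [exact: cvg_cst|exact: continuous_unitc].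
    by apply: derivable_continuous; apply: af; apply: dfs; rewrite normc_unitc.
  move=> t; rewrite normcM normcX normcV normc_unitc invr1 expr1n mulr1.
  by apply: fB; apply: dfs; rewrite normc_unitc.

have nz1 : normc z < 1 by exact: z1.
have nz0 := normc_ge0 z.
pose r := (1 + normc z) / 2.
have r01 : 0 < r < 1 by rewrite /r; apply/andP; split; lra.
have r0C : r%:C != 0 by rewrite -normc_eq0 normcR normr_eq0 gt_eqF //; case/andP: r01.
have z1' : unit_disc (z / r%:C).
  rewrite /unit_disc /mkset normcM normcV normcR gtr0_norm; last by case/andP: r01.
  by rewrite ltr_pdivrMr /r; lra.
have := fsP _ r01 _ z1'; rewrite {1}/fs [r%:C * _]mulrC divfK //.
under eq_fun do rewrite expr_div_n.
suff E k : c 2^-1 k / (2^-1)%:C ^+ k * z ^+ k = c r k * (z ^+ k / r%:C ^+ k).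
  by rewrite (funext E).
by rewrite (cE _ r) // mulrA mulrAC.
Unshelve. all: by end_near. Qed.


End Cauchy.

(** * Growth of Bloch functions along radii when the exponent is below 1 *)

Section BlochGrowth.
Variables (R : realType) (beta : R).
Hypothesis beta01 : 0 < beta < 1.
Local Notation C := (cplx R).
Local Notation "x %:C" := (real_complex R x : C).
Implicit Types (f : C -> C) (z q : C).

Lemma powR_onem_derive (g t : R) : t < 1 ->
  is_derive t 1 (fun t => (1 - t) `^ g) (- (g * (1 - t) `^ (g - 1))).
Proof.
move=> t1.
have d1 : is_derive t 1 (fun t : R => 1 - t) (-1).
  by apply: is_derive_eq; rewrite add0r mul1r.
have t10 : 0 < 1 - t by rewrite subr_gt0.
have d2 := is_derive1_powR g t10.
by have := @is_derive1_comp _ (fun x : R => x `^ g) (fun t : R => 1 - t) t _ _ d2 d1; rewrite mulrN1.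
Qed.

Variables (f : C -> C) (M : R).
Hypothesis af : analytic_on_disc f.
Hypothesis fM : forall z, unit_disc z ->
  (1 - normc z ^+ 2) `^ beta * normc (derive1 f z) <= M.

Lemma bloch_growth q (s t : R) : 0 <= s <= t -> t < 1 -> normc q <= 1 ->
  normc (f (t%:C * q) - f (s%:C * q)) <= M / (1 - beta) * (1 - s) `^ (1 - beta).
Proof.
move=> /andP[s0 st] t1 q1; have /andP[b0 b1] := beta01.
have c0 : 1 - beta != 0 by rewrite gt_eqF // subr_gt0.
pose psi x := - (M / (1 - beta) * (1 - x) `^ (1 - beta)).
pose dpsi x := M * (1 - x) `^ (- beta).
have inq x : s <= x <= t -> unit_disc (0 + x%:C * q).
  move=> /andP[sx xt]; rewrite /unit_disc /mkset add0r normcM normcR ger0_norm ?(le_trans s0) //.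
  by apply: le_lt_trans (le_lt_trans xt t1); rewrite ler_piMr // (le_trans s0).
have M0 : 0 <= M.
  apply: le_trans (fM (disc0 R)); by rewrite mulr_ge0 ?powR_ge0 ?normc_ge0.
have := @path_growth R f 0 q psi dpsi s t st (fun x xst => af (inq x xst)).
rewrite !add0r => h; apply: le_trans (h _ _) _.
- move=> x /andP[_ xt]; have x1 : x < 1 by exact: le_lt_trans t1.
  have dx := powR_onem_derive (1 - beta) x1.
  rewrite /psi /dpsi.
  have := is_deriveN (is_deriveZ (M / (1 - beta)) dx).
  have -> : 1 - beta - 1 = - beta by ring.
  rewrite scalerN opprK /GRing.scale /= mulrA divfK //.
- move=> x xst; have x1 := inq _ xst; rewrite /dpsi powRN ler_pdivlMr; last first.
    by rewrite powR_gt0 // subr_gt0; case/andP: xst => _ /le_lt_trans; apply.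
  have dn0 := normc_ge0 (derive1 f (0 + x%:C * q)).
  apply: le_trans (fM x1); rewrite mulrC.
  apply: ler_pM; rewrite ?powR_ge0 ?mulr_ge0 ?normc_ge0 //; last by rewrite ler_piMl.
  apply: ge0_ler_powR; rewrite ?nnegrE ?(ltW b0) //.
  + by rewrite subr_ge0 ltW //; case/andP: xst => _ /le_lt_trans; apply.
  + by rewrite subr_ge0 expr_le1 ?normc_ge0 // ltW.
  rewrite lerD2l lerN2 add0r normcM normcR exprMn.
  case/andP: xst => sx xt; have x0 := le_trans s0 sx; rewrite ger0_norm //.
  apply: (@le_trans _ _ (x ^+ 2)); first by rewrite ler_piMr ?sqr_ge0 // expr_le1 ?normc_ge0.
  by rewrite expr2 ler_piMl // ltW // (le_lt_trans xt).
rewrite /psi opprK addrC gerBl mulr_ge0 ?powR_ge0 // divr_ge0 // subr_ge0 ltW //.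
Qed.

Lemma bloch_bounded z : unit_disc z -> normc (f z) <= normc (f 0) + M / (1 - beta).
Proof.
move=> z1; have [->|z0] := eqVneq z 0.
  rewrite lerDl divr_ge0 //; last by rewrite subr_ge0 ltW //; case/andP: beta01.
  by apply: le_trans (fM (disc0 R)); rewrite mulr_ge0 ?powR_ge0 ?normc_ge0.
have nz0 : normc z != 0 by rewrite normc_eq0.
pose q := z / (normc z)%:C.
have q1 : normc q <= 1 by rewrite normcM normcV normcR ger0_norm ?normc_ge0 // divff.
have zq : z = (normc z)%:C * q.
  by rewrite /q mulrC divfK // -normc_eq0 normcR normr_eq0.
have := @bloch_growth q 0 (normc z); rewrite lexx normc_ge0 subr0 powR1 mulr1 -zq mul0r.
move=> /(_ isT z1 q1) h; have := normcD (f z - f 0) (f 0); rewrite subrK; lra.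
Qed.

Lemma bloch_derive_bounded (r : R) : r < 1 ->
  exists L, forall z, normc z <= r -> normc (derive1 f z) <= L.
Proof.
move=> r1; exists (M / (1 - r ^+ 2) `^ beta) => z zr.
have r0 : 0 <= r by exact: le_trans (normc_ge0 _) zr.
have z1 : unit_disc z by exact: le_lt_trans r1.
have w0 : 0 < (1 - r ^+ 2) `^ beta by rewrite powR_gt0 // subr_gt0 expr_lt1.
rewrite ler_pdivlMr // mulrC; apply: le_trans (fM z1).
rewrite ler_wpM2r ?normc_ge0 //; apply: ge0_ler_powR.
- by case/andP: beta01 => /ltW.
- by rewrite nnegrE subr_ge0 expr_le1 // ltW.
- by rewrite nnegrE subr_ge0 expr_le1 ?normc_ge0 // ltW.
by rewrite lerD2l lerN2 lerXn2r // nnegrE normc_ge0.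
Qed.

Lemma bloch_power_series : exists2 a, power_series_on_disc a f &
  forall k, normc (a k) <= normc (f 0) + M / (1 - beta).
Proof.
have [a afs ab] := analytic_power_series af bloch_derive_bounded.
by exists a => //; apply: ab; exact: bloch_bounded.
Qed.

End BlochGrowth.

(** * The coefficients of the binomial series *)

Section GeneralizedBinomial.
Variable R : realType.
Implicit Types (g r s x : R).

(** The coefficient of [x ^ n] in [(1 - x) ^ (- g)]. The product form makes the recurrences
    immediate; [Gamma_ratio] connects it with the Gamma quotient. *)
Definition gbin (g : R) (n : nat) : R := \prod_(j < n) ((g + j%:R) / j.+1%:R).

Lemma gbinS g n : gbin g n.+1 = gbin g n * ((g + n%:R) / n.+1%:R).
Proof. by rewrite /gbin big_ord_recr. Qed.

Lemma gbin0 g : gbin g 0 = 1.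
Proof. by rewrite /gbin big_ord0. Qed.

Lemma gbin_gt0 g n : 0 < g -> 0 < gbin g n.
Proof.
move=> g0; elim: n => [|n ih]; first by rewrite gbin0.
by rewrite gbinS mulr_gt0 // divr_gt0 // ltr_wpDr.
Qed.

Lemma gbinS_mul g n : n.+1%:R * gbin g n.+1 = (g + n%:R) * gbin g n.
Proof. by rewrite gbinS mulrCA (mulrC (gbin _ _)) [RHS]mulrC mulrC; congr (_ * _); rewrite mulrC divfK // pnatr_eq0. Qed.

(** Both sides are the [n]-th coefficient of the derivative of [(1 - x) ^ (- g)], which is
    [g * (1 - x) ^ (- g - 1)]. *)
Lemma gbin_shift g n : g != 0 -> g * gbin (g + 1) n = (g + n%:R) * gbin g n.
Proof.
move=> g0; elim: n => [|n ih]; first by rewrite !gbin0 addr0.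
by rewrite gbinS mulrA ih gbinS -natr1; field; rewrite natr1 pnatr_eq0.
Qed.

Definition gbin_psum g n r := \sum_(0 <= k < n) gbin g k * r ^+ k.

Lemma is_derive_monomial (c r : R) n :
  is_derive r 1 (fun r => c * r ^+ n) (n%:R * c * r ^+ n.-1).
Proof.
have d : is_derive r 1 (@GRing.exp R ^~ n) (n%:R *: r ^+ n.-1 *: 1).
  by split; [exact: exprn_derivable|exact: exp_derive].
by apply: (is_derive_eq (is_deriveZ c d)); rewrite /GRing.scale /=; ring.
Qed.

Lemma gbin_psum_derive g n r :
  is_derive r 1 (gbin_psum g n) (\sum_(0 <= k < n) k%:R * gbin g k * r ^+ k.-1).
Proof.
elim: n => [|n ih].
  rewrite (_ : gbin_psum g 0 = cst 0); last by apply/funext => x; rewrite /gbin_psum big_nil.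
  by rewrite big_nil; exact: is_derive_cst.
rewrite (_ : gbin_psum g n.+1 = gbin_psum g n + (fun r => gbin g n * r ^+ n)); last first.
  by apply/funext => x; rewrite /gbin_psum big_nat_recr.
rewrite big_nat_recr //=; apply: is_deriveD.
exact: is_derive_monomial.
Qed.

(** The full series [S] satisfies [(1 - r) S' = g S]; truncating it leaves a single boundary
    term. *)
Lemma gbin_psum_ode g n r :
  (1 - r) * (\sum_(0 <= k < n) k%:R * gbin g k * r ^+ k.-1) =
  g * gbin_psum g n r - n%:R * gbin g n * r ^+ n.-1.
Proof.
elim: n => [|n ih]; first by rewrite /gbin_psum !big_nil !mulr0 !mul0r subrr.
rewrite big_nat_recr //= mulrDr ih /gbin_psum big_nat_recr //= gbinS_mul.
case: n {ih} => [|n]; first by rewrite /= !expr0; ring.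
by rewrite /= exprS; ring.
Qed.

(** For the full series this product would be identically 1. For a truncation the differential
    equation reduces its derivative to one term of constant sign, so bounds follow from
    monotonicity. *)
Let h g n r := gbin_psum g n r * (1 - r) `^ g.

Let h_derive g n r : r < 1 ->
  is_derive r 1 (h g n) (- (n%:R * gbin g n * r ^+ n.-1 * (1 - r) `^ (g - 1))).
Proof.
move=> r1; have r10 : 0 < 1 - r by rewrite subr_gt0.
apply: (is_derive_eq (is_deriveM (gbin_psum_derive g n r) (powR_onem_derive g r1))).
have E : (1 - r) `^ g = (1 - r) * (1 - r) `^ (g - 1).
  by rewrite powRB ?(gt_eqF r10) ?implybT // powRr1 ?(ltW r10) // mulrC divfK // gt_eqF.
have := gbin_psum_ode g n r; rewrite /GRing.scale /= E.
set S := \sum_(0 <= k < n) _; set P := gbin_psum g n r; set W := (1 - r) `^ _ => ode.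
have -> : P * - (g * W) + (1 - r) * W * S = ((1 - r) * S - g * P) * W by ring.
by rewrite ode; ring.
Qed.

Let h0 g n : (0 < n)%N -> h g n 0 = 1.
Proof.
case: n => // n _; rewrite /h subr0 powR1 mulr1 /gbin_psum big_nat_recl //= gbin0 expr0 mulr1.
by rewrite big1 ?addr0 // => k _; rewrite exprS mul0r mulr0.
Qed.

Let h_le1 g n r : 0 < g -> 0 <= r < 1 -> h g n r <= 1.
Proof.
move=> g0 /andP[r0 r1]; case: n => [|n]; first by rewrite /h /gbin_psum big_nil mul0r.
rewrite -(@h0 g n.+1) // -subr_le0.
have dh x : x \in `[0, r] -> is_derive x 1 (h g n.+1) (- (n.+1%:R * gbin g n.+1 * x ^+ n * (1 - x) `^ (g - 1))).
  by rewrite in_itv /= => /andP[_ xr]; apply: h_derive; exact: le_lt_trans r1.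
have ch : {within `[0, r], continuous (h g n.+1)}.
  apply: continuous_in_subspaceT => x /set_mem/= /dh[dx _].
  exact/differentiable_continuous/derivable1_diffP.
have [c] := MVT_segment r0 (fun x xx => dh x (subset_itv_oo_cc xx)) ch.
rewrite in_itv /= => /andP[c0 cr] ->.
rewrite mulr_le0_ge0 ?subr_ge0 // oppr_le0 !mulr_ge0 ?powR_ge0 ?exprn_ge0 //.
by rewrite ltW // gbin_gt0.
Qed.

Let h_ge g n r : 1 <= g -> 0 <= r < 1 -> (0 < n)%N -> 1 - gbin g n * r ^+ n <= h g n r.
Proof.
move=> g1 /andP[r0 r1]; case: n => // n _; have g0 : 0 < g by exact: lt_le_trans g1.
pose k x := h g n.+1 x + gbin g n.+1 * x ^+ n.+1.
have dk x : x \in `[0, r] -> is_derive x 1 k (n.+1%:R * gbin g n.+1 * x ^+ n * (1 - (1 - x) `^ (g - 1))).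
  rewrite in_itv /= => /andP[_ xr].
  have d1 := h_derive g n.+1 (le_lt_trans xr r1).
  have d2 : is_derive x 1 (fun x : R => gbin g n.+1 * x ^+ n.+1) (n.+1%:R * gbin g n.+1 * x ^+ n).
    exact: is_derive_monomial.
  by apply: (is_derive_eq (is_deriveD d1 d2)); rewrite /=; ring.
have ck : {within `[0, r], continuous k}.
  apply: continuous_in_subspaceT => x /set_mem/= /dk[dx _].
  exact/differentiable_continuous/derivable1_diffP.
have [c] := MVT_segment r0 (fun x xx => dk x (subset_itv_oo_cc xx)) ck.
rewrite in_itv /= => /andP[c0 cr] E.
have : 0 <= k r - k 0.
  rewrite E !mulr_ge0 ?exprn_ge0 ?subr_ge0 //; first by rewrite ltW // gbin_gt0.
  have E1 : 1 `^ (g - 1) = 1 :> R by rewrite powR1.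
  rewrite -[leRHS]E1; apply: ge0_ler_powR; rewrite ?nnegrE ?subr_ge0 ?lerBlDr ?lerDl //.
  exact: le_trans cr (ltW r1).
have -> : k 0 = 1 by rewrite /k h0 // (exprS 0) mul0r mulr0 addr0.
rewrite /k; lra.
Qed.

Lemma gbin_psum_le g n r : 0 < g -> 0 <= r < 1 -> gbin_psum g n r <= ((1 - r) `^ g)^-1.
Proof.
move=> g0 r01; have := h_le1 n g0 r01; rewrite /h.
have w0 : 0 < (1 - r) `^ g by rewrite powR_gt0 // subr_gt0; case/andP: r01.
by rewrite -ler_pdivlMr // mul1r.
Qed.

Lemma gbin_psum_ge g n r : 1 <= g -> 0 <= r < 1 -> (0 < n)%N ->
  (1 - gbin g n * r ^+ n) / (1 - r) `^ g <= gbin_psum g n r.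
Proof.
move=> g1 r01 n0; have := h_ge g1 r01 n0; rewrite /h.
have w0 : 0 < (1 - r) `^ g by rewrite powR_gt0 // subr_gt0; case/andP: r01.
by rewrite ler_pdivrMr.
Qed.

Lemma gbin_geo_bounded g r : 0 < g -> 0 <= r < 1 ->
  forall n, gbin g n * r ^+ n <= ((1 - r) `^ g)^-1.
Proof.
move=> g0 r01 n; apply: le_trans (gbin_psum_le n.+1 g0 r01).
rewrite /gbin_psum big_nat_recr //= lerDr sumr_ge0 // => k _.
by rewrite mulr_ge0 ?exprn_ge0 ?(ltW (gbin_gt0 _ _)) //; case/andP: r01.
Qed.

Lemma gbin_geo_cvg0 g r : 0 < g -> 0 <= r < 1 -> gbin g n * r ^+ n @[n --> \oo] --> 0.
Proof.
move=> g0 /andP[r0 r1]; pose q := (1 + r) / 2.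
have q01 : 0 <= q < 1 by rewrite /q; apply/andP; split; lra.
have q0 : 0 < q by rewrite /q; lra.
have rq0 : 0 <= r / q := divr_ge0 r0 (ltW q0).
have up : ((1 - q) `^ g)^-1 * (r / q) ^+ n @[n --> \oo] --> 0.
  rewrite -[X in _ --> X](mulr0 ((1 - q) `^ g)^-1); apply: cvgM; first exact: cvg_cst.
  apply: cvg_expr; rewrite (ger0_norm rq0).
  by rewrite ltr_pdivrMr // mul1r /q; lra.
apply: (squeeze_cvgr _ (cvg_cst 0) up); near=> n.
rewrite mulr_ge0 ?exprn_ge0 ?(ltW (gbin_gt0 _ _)) //=.
have -> : gbin g n * r ^+ n = gbin g n * q ^+ n * (r / q) ^+ n.
  by rewrite -mulrA -exprMn mulrCA divff ?mulr1 ?gt_eqF.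
by rewrite ler_wpM2r ?exprn_ge0 // gbin_geo_bounded.
Unshelve. all: by end_near. Qed.

(** The factor 1/2 is what remains once [gbin g n * r ^+ n] has dropped to 1/2. A finite [n] is
    wanted because the coefficients are later compared on partial sums. *)
Lemma gbin_psum_large g r : 1 <= g -> 0 <= r < 1 ->
  exists n, ((1 - r) `^ g)^-1 / 2 <= gbin_psum g n r.
Proof.
move=> g1 r01; have g0 : 0 < g by exact: lt_le_trans g1.
have := gbin_geo_cvg0 g0 r01 => /cvgrPdist_le /(_ _ (ltac:(lra) : 0 < (2^-1 : R))).
move=> [N _ hN]; exists N.+1; apply: le_trans (gbin_psum_ge g1 r01 (ltn0Sn N)).
have := hN N.+1 (leqnSn N); rewrite /= sub0r normrN => h1.
have w0 : 0 < (1 - r) `^ g by rewrite powR_gt0 // subr_gt0; case/andP: r01.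
rewrite mulrC ler_wpM2r ?invr_ge0 ?(ltW w0) //.
have := ler_norm (gbin g N.+1 * r ^+ N.+1); lra.
Qed.

End GeneralizedBinomial.

(** * The functional equation and positivity of Gamma to the right of 1 *)

Section GammaFunction.
Variable R : realType.
Local Notation leb := (@lebesgue_measure R).
Implicit Types (x y t : R).

Let p y t : R := t `^ y * expR (- t).

(** Half of the exponential decay absorbs the power; the other half, [expR (- (t / 2))], still gives
    integrability and a vanishing boundary term. *)
Lemma powR_le_expR y : 0 <= y -> exists2 c : R, 0 <= c & forall t, 0 <= t -> t `^ y <= c * expR (t / 2).
Proof.
move=> y0; pose m := (Num.trunc `|y|).+1.
have ym : y <= m%:R by apply: le_trans (ler_norm _) _; rewrite ltW // truncnS_gt.
exists (1 + 2 ^+ m * m`!%:R); first by rewrite addr_ge0 // mulr_ge0 // exprn_ge0.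
move=> t t0.
have e1 : 1 <= expR (t / 2) by rewrite -(expR0 R) ler_expR divr_ge0.
have [t1|/ltW t1] := leP t 1.
  apply: (@le_trans _ _ 1); last first.
    by rewrite -[leLHS]mulr1 ler_pM // lerDl mulr_ge0 // exprn_ge0.
  have -> : (1 : R) = 1 `^ y by rewrite powR1.
  by apply: ge0_ler_powR; rewrite ?nnegrE.
apply: le_trans (ler_powR t1 ym) _; rewrite powR_mulrn //.
have := expR_ge1Dxn m.-1 (divr_ge0 t0 (ler0n _ 2)); rewrite prednK // => h.
rewrite mulrDl; apply: (@le_trans _ _ (2 ^+ m * m`!%:R * expR (t / 2))).
  have -> : t ^+ m = 2 ^+ m * m`!%:R * ((t / 2) ^+ m / m`!%:R).
    by rewrite expr_div_n; field; rewrite expf_neq0 // pnatr_eq0 -lt0n fact_gt0.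
  by rewrite ler_wpM2l ?mulr_ge0 ?exprn_ge0 //; apply: le_trans h; rewrite lerDr.
by rewrite lerDr.
Qed.

(** At the left end 0 the function is continuous because [y > 0]; this restricts the section to
    Gamma at arguments above 1. *)
Let p_continuous y a b : 0 < y -> 0 <= a < b -> {within `[a, b], continuous (p y)}.
Proof.
move=> y0 /andP[a0 ab].
have cp t : 0 < t -> {for t, continuous (p y)}.
  move=> t0; apply: cvgM; first by have [/derivable1_diffP/differentiable_continuous] := is_derive1_powR y t0.
  by apply: continuous_comp; [exact: cvgN|exact: continuous_expR].
apply/continuous_within_itvP => //; split.
- by move=> t; rewrite in_itv /= => /andP[at_ _]; apply: cp; exact: le_lt_trans at_.
- have [->|an0] := eqVneq a 0; last by apply: cvg_at_right_filter; apply: cp; rewrite lt_def an0.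
  rewrite /p powR0 ?gt_eqF //; apply: cvgM; first exact: powR_cvg0.
  by apply: cvg_at_right_filter; apply: continuous_comp; [exact: cvgN|exact: continuous_expR].
by apply: cvg_at_left_filter; apply: cp; exact: le_lt_trans ab.
Qed.

Let p_integrable y (n : R) : 0 < y -> 0 < n -> leb.-integrable `[0, n] (EFin \o p y).
Proof.
move=> y0 n0; apply: continuous_compact_integrable; first exact: segment_compact.
by apply: p_continuous => //; rewrite lexx.
Qed.

Let p_measurable y (A : set R) : measurable_fun A (p y).
Proof.
apply: (measurable_funS measurableT) => //; apply: measurable_funM; first exact: measurable_powR.
apply: measurableT_comp; first exact: measurable_expR.
exact: oppr_measurable.
Qed.

Let p_ge0 y t : 0 <= p y t.
Proof. by rewrite mulr_ge0 ?powR_ge0 ?expR_ge0. Qed.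

(** The integral of [Gamma (y + 1)] cut at [n]. Integration by parts is carried out on these
    segments, and only then [n] tends to infinity. *)
Let I y (n : R) := \int[leb]_(t in `[0, n]) p y t.

Let p_derive y t : 0 < t ->
  is_derive t 1 (p (y + 1)) ((y + 1) * p y t - p (y + 1) t).
Proof.
move=> t0.
have d1 := is_derive1_powR (y + 1) t0.
have dN : is_derive t 1 (fun t : R => - t) (-1) by exact: is_deriveN.
have d2 : is_derive t 1 (fun t : R => expR (- t)) (expR (- t) * -1).
  exact: (@is_derive1_comp _ (@expR R) (fun t : R => - t) t _ _ (is_derive_expR _) dN).
have h := is_deriveM d1 d2; rewrite addrK in h; apply: (is_derive_eq h).
by rewrite /GRing.scale /= /p; ring.
Qed.

Let I_parts y (n : R) : 0 < y -> 0 < n -> I (y + 1) n = (y + 1) * I y n - p (y + 1) n.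
Proof.
move=> y0 n0; have y10 : 0 < y + 1 by rewrite addr_gt0.
have cyp : {within `[0, n], continuous (fun t => (y + 1) * p y t)}.
  move=> t; apply: cvgM; first exact: cvg_cst.
  by apply: p_continuous; rewrite ?lexx.
have cp1 : {within `[0, n], continuous (p (y + 1))} by apply: p_continuous; rewrite ?lexx.
have E : I (y + 1) n - (y + 1) * I y n = - p (y + 1) n.
  rewrite /I -RintegralZl //; last exact: p_integrable.
  rewrite -RintegralB //; last 2 first.
  - exact: p_integrable.
  - by apply: continuous_compact_integrable; first exact: segment_compact.
  rewrite /Rintegral.
  have -> : - p (y + 1) n = fine ((- p (y + 1) n)%:E - (- p (y + 1) 0)%:E)%E.
    by rewrite /= opprK /p powR0 ?gt_eqF // mul0r addr0.
  have dN t : t \in `]0, n[ -> is_derive t 1 (fun t => - p (y + 1) t) (p (y + 1) t - (y + 1) * p y t).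
    rewrite in_itv /= => /andP[t0 _]; have := is_deriveN (p_derive y t0).
    by rewrite opprB.
  congr fine; apply: (continuous_FTC2 (F := fun t => - p (y + 1) t)) => //.
  - by move=> t; apply: cvgB; [exact: cp1|exact: cyp].
  - have /continuous_within_itvP := cp1 => /(_ n0)[_ h0 hn].
    split; [by move=> t /dN[]|exact: cvgN h0|exact: cvgN hn].
  by move=> t /dN[_ <-]; rewrite derive1E.
by rewrite -E [RHS]addrC subrK.
Qed.

Let I_bound y : 0 < y -> exists c, forall n : R, 0 < n -> I y n <= c.
Proof.
move=> y0; have [c c0 hc] := powR_le_expR (ltW y0).
exists (c * 2) => n n0.
pose q (t : R) := c * expR (- (t / 2)).
have cq : continuous q.
  move=> t; apply: cvgM; first exact: cvg_cst.
  apply: continuous_comp; last exact: continuous_expR.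
  by apply: cvgN; apply: cvgM; [exact: cvg_id|exact: cvg_cst].
apply: (@le_trans _ _ (\int[leb]_(t in `[0, n]) q t)).
  apply: le_Rintegral => //; first exact: p_integrable.
    exact: continuous_integrable_itv.
  move=> t /=; rewrite in_itv /= => /andP[t0 _].
  have -> : q t = c * expR (t / 2) * expR (- t).
    by rewrite /q -mulrA -expRD; congr (_ * expR _); field.
  by rewrite ler_wpM2r ?expR_ge0 // hc.
have dF (t : R) : is_derive t 1 (fun t => - (c * 2) * expR (- (t / 2))) (q t).
  have d1 : is_derive t 1 (fun t : R => - (t / 2)) (- 2^-1).
    by apply: is_derive_eq; rewrite /GRing.scale /= ?mulr0 ?mulr1 ?add0r ?addr0.
  have d2 := @is_derive1_comp _ (@expR R) (fun t : R => - (t / 2)) t _ _ (is_derive_expR _) d1.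
  apply: (is_derive_eq (is_deriveZ (- (c * 2)) d2)).
  by rewrite /GRing.scale /= /q; field.
rewrite /Rintegral (continuous_FTC2 (F := fun t => - (c * 2) * expR (- (t / 2)))) //; last 3 first.
- exact: continuous_subspaceT.
- have cF (t : R) : {for t, continuous (fun t => - (c * 2) * expR (- (t / 2)))}.
    by apply/differentiable_continuous/derivable1_diffP; case: (dF t).
  split=> [t _||]; first by case: (dF t).
    by apply: cvg_at_right_filter; exact: cF.
  by apply: cvg_at_left_filter; exact: cF.
- by move=> t _; rewrite derive1E; case: (dF t).
rewrite /= mul0r oppr0 expR0 mulr1 opprK addrC mulNr gerBl.
by rewrite !mulr_ge0 ?expR_ge0.
Qed.

Let I_cvg y : 0 < y -> I y n%:R @[n --> \oo] --> Gamma (y + 1).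
Proof.
move=> y0; have [c hc] := I_bound y0.
pose F (n : nat) : set R := `]0, n%:R]%classic.
have FU : \bigcup_n F n = `]0, +oo[%classic.
  apply/seteqP; split=> t /=.
    by move=> [n _]; rewrite /F /= !in_itv /= andbT => /andP[].
  rewrite in_itv /= andbT => t0; exists (Num.trunc t).+1 => //.
  by rewrite /F /= in_itv /= t0 /= ltW // truncnS_gt.
have h : (\int[leb]_(t in F n) (p y t)%:E)%E @[n --> \oo] -->
    (\int[leb]_(t in `]0%R, +oo[) (p y t)%:E)%E.
  rewrite -FU; apply: ge0_nondecreasing_set_cvg_integral.
  - apply/nondecreasing_seqP => n; rewrite subsetEset => t; rewrite /F /= !in_itv /=.
    by move=> /andP[-> /= tn]; apply: le_trans tn _; rewrite ler_nat.
  - by move=> n; exact: measurable_itv.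
  - by move=> n; apply/measurable_EFinP; exact: p_measurable.
  - by move=> n t _; rewrite lee_fin.
have IE n : (\int[leb]_(t in F n) (p y t)%:E)%E = (I y n%:R)%:E.
  rewrite /F integral_itv_obnd_cbnd; last by apply/measurable_EFinP; exact: p_measurable.
  case: n => [|n]; last by rewrite /I /Rintegral fineK // integrable_fin_num // p_integrable.
  by rewrite /I /Rintegral set_itv1 integral_set1.
rewrite (funext IE) in h.
(* Without finiteness, [fine] would turn an infinite integral into 0 and the limit would be wrong;
   the uniform bound of [I_bound] excludes this. *)
have fin : (\int[leb]_(t in `]0%R, +oo[) (p y t)%:E)%E \is a fin_num.
  rewrite ge0_fin_numE; last by apply: integral_ge0 => t _; rewrite lee_fin.
  apply: (@le_lt_trans _ _ (Num.max c 0)%:E); last exact: ltry.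
  rewrite -(cvg_lim _ h) //; apply: lime_le; first by apply/cvg_ex; eexists; exact: h.
  apply: nearW => n; rewrite lee_fin le_max; case: n => [|n]; last by rewrite hc ?ltr0n.
  by apply/orP; right; rewrite /I /Rintegral set_itv1 integral_set1.
have -> : Gamma (y + 1) = fine (\int[leb]_(t in `]0%R, +oo[) (p y t)%:E)%E.
  by rewrite /Gamma /Rintegral addrK.
rewrite -(fineK fin) in h; exact: (fine_cvg h).
Qed.

Lemma GammaD1 x : 1 < x -> Gamma (x + 1) = x * Gamma x.
Proof.
move=> x1; have y0 : 0 < x - 1 by rewrite subr_gt0.
have x0 : 0 < x by exact: lt_trans x1.
have [c c0 hc] := powR_le_expR (ltW x0).
have h1 := I_cvg y0; have h2 := I_cvg x0; rewrite subrK in h1.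
have p0 : p x n%:R @[n --> \oo] --> (0 : R).
  have up : (fun n => 2 * c * harmonic n) @ \oo --> (0 : R).
    rewrite -[X in _ --> X](mulr0 (2 * c)).
    by apply: cvgM; [exact: cvg_cst|exact: cvg_harmonic].
  apply: (squeeze_cvgr _ (cvg_cst 0) up); near=> n; rewrite p_ge0 /=.
  have n0 : 0 <= n%:R :> R by [].
  rewrite /p /harmonic; apply: le_trans (ler_wpM2r (expR_ge0 _) (hc _ n0)) _.
  have -> : c * expR (n%:R / 2) * expR (- n%:R) = c * expR (- (n%:R / 2)).
    by rewrite -[LHS]mulrA -expRD; congr (_ * expR _); field.
  rewrite expRN (mulrC 2) -[leRHS]mulrA ler_wpM2l //.
  rewrite ler_pdivlMr // mulrC ler_pdivrMr ?expR_gt0 // mulrC -ler_pdivrMr //.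
  apply: le_trans (expR_ge1Dx _); rewrite -natr1; lra.
apply: (cvg_unique _ h2); first exact: Rhausdorff.
have h3 : x * I (x - 1) n%:R - p x n%:R @[n --> \oo] --> x * Gamma x.
  rewrite -[X in _ --> X]subr0; apply: cvgB; last exact: p0.
  by apply: cvgM; [exact: cvg_cst|exact: h1].
apply: cvg_trans h3; apply: near_eq_cvg; near=> n.
have n0 : (0 < n)%N by near: n; exact: nbhs_infty_gt.
have n0R : 0 < n%:R :> R by rewrite ltr0n.
by have := I_parts y0 n0R; rewrite subrK => ->.
Unshelve. all: by end_near. Qed.

(** On [[1, 2]] the integrand is at least [expR (-2)], and the interval has length 1. *)
Lemma Gamma_gt0 x : 1 < x -> 0 < Gamma x.
Proof.
move=> x1; have y0 : 0 < x - 1 by rewrite subr_gt0.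
have h1 := I_cvg y0; rewrite subrK in h1.
apply: (@lt_le_trans _ _ (expR (-2))); first exact: expR_gt0.
rewrite -(cvg_lim (@Rhausdorff R) h1); apply: limr_ge; first by apply/cvg_ex; eexists; exact: h1.
near=> n; have n2 : 2 <= n%:R :> R by rewrite ler_nat; near: n; exact: nbhs_infty_ge.
have n0 : 0 < n%:R :> R by lra.
rewrite -lee_fin /I /Rintegral fineK; last by rewrite integrable_fin_num // p_integrable.
apply: (@le_trans _ _ (\int[leb]_(t in `[1%R, 2%R]) (expR (-2))%:E)%E).
  rewrite integral_cst //.
  have m12 : leb `[1, 2]%classic = 1%:E.
    have := lebesgue_measure_itv (`[1, 2]%R : interval R).
    by rewrite /= lte_fin ltr1n -EFinB => ->; congr _%:E; ring.
  rewrite [X in (_ <= _ * X)%E](m12 : _ = 1%:E).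
  by rewrite mule1.
apply: (@le_trans _ _ (\int[leb]_(t in `[1%R, 2%R]) (p (x - 1) t)%:E)%E).
  apply: ge0_le_integral => //.
  - by apply/measurable_EFinP; exact: p_measurable.
  move=> t /=; rewrite in_itv /= => /andP[t1 t2]; rewrite lee_fin /p.
  rewrite -[leLHS]mul1r ler_pM ?expR_ge0 //; last by rewrite ler_expR lerN2.
  have E1 : 1 `^ (x - 1) = 1 :> R by rewrite powR1.
  have t0 : 0 <= t by exact: le_trans ler01 t1.
  by rewrite -[leLHS]E1; apply: ge0_ler_powR; rewrite ?nnegrE ?(ltW y0).
apply: ge0_subset_integral => //.
- by apply/measurable_EFinP; exact: p_measurable.
- by move=> t _; rewrite lee_fin.
move=> t /=; rewrite !in_itv /= => /andP[t1 t2]; rewrite (le_trans ler01 t1) /=.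
exact: le_trans t2 n2.
Unshelve. all: by end_near. Qed.

Lemma Gamma_ratio (g : R) n : 1 < g -> Gamma (n%:R + g) / (n`!%:R * Gamma g) = gbin g n.
Proof.
move=> g1; have G0 : Gamma g != 0 by rewrite gt_eqF // Gamma_gt0.
elim: n => [|n ih]; first by rewrite add0r fact0 mul1r gbin0 divff.
rewrite gbinS -ih -natr1 addrAC GammaD1; last by rewrite ltr_wpDl.
rewrite factS natrM -natr1; move: (Gamma g) G0 => G G0; field.
by rewrite natr1 G0 !pnatr_eq0 /= -lt0n fact_gt0.
Qed.

End GammaFunction.

(** * Moments *)

Section Moments.
Variables (R : realType) (mu : {measure set (measurableTypeR R) -> \bar R}).
Local Notation C := (cplx R).
Local Notation "x %:C" := (real_complex R x : C).
Local Notation D := (`[0%R, 1%R[%classic : set (measurableTypeR R)).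

Let mD : measurable D.
Proof. exact: measurable_itv. Qed.

Definition moment (n : nat) : R := fine (\int[mu]_(t in D) (t ^+ n)%:E)%E.

Lemma measurable_expn n (A : set (measurableTypeR R)) :
  measurable_fun A (fun t : measurableTypeR R => t ^+ n : R).
Proof. by apply: (measurable_funS measurableT) => //; exact: exprn_measurable. Qed.

Section FiniteMeasure.
Hypothesis finD : (mu D < +oo)%E.

Lemma moment_bound n : (0 <= \int[mu]_(t in D) (t ^+ n)%:E <= mu D)%E.
Proof.
apply/andP; split.
  by apply: integral_ge0 => t /=; rewrite in_itv /= => /andP[t0 _]; rewrite lee_fin exprn_ge0.
rewrite -[leRHS]mul1e -integral_cst //; apply: ge0_le_integral => //.
- by move=> t /=; rewrite in_itv /= => /andP[t0 _]; rewrite lee_fin exprn_ge0.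
- by apply/measurable_EFinP; exact: measurable_expn.
- by move=> t /=; rewrite in_itv /= => /andP[t0 t1]; rewrite lee_fin exprn_ile1 // ltW.
Qed.

Lemma moment_fin n : (\int[mu]_(t in D) (t ^+ n)%:E)%E \is a fin_num.
Proof.
have /andP[h0 h1] := moment_bound n.
by rewrite ge0_fin_numE // (le_lt_trans h1).
Qed.

Lemma momentE n : (\int[mu]_(t in D) (t ^+ n)%:E)%E = (moment n)%:E.
Proof. by rewrite /moment fineK // moment_fin. Qed.

Lemma moment_ge0 n : 0 <= moment n.
Proof. by rewrite -lee_fin -momentE; case/andP: (moment_bound n). Qed.

Lemma moment_decr n k : moment (n + k) <= moment k.
Proof.
rewrite -lee_fin -!momentE; apply: ge0_le_integral => //.
- by move=> t /=; rewrite in_itv /= => /andP[t0 _]; rewrite lee_fin exprn_ge0.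
- by apply/measurable_EFinP; exact: measurable_expn.
- by apply/measurable_EFinP; exact: measurable_expn.
move=> t /=; rewrite in_itv /= => /andP[t0 t1]; rewrite lee_fin exprD.
by rewrite ler_piMl ?exprn_ge0 // exprn_ile1 // ltW.
Qed.

Lemma integrable_expn n : mu.-integrable D (EFin \o (fun t : measurableTypeR R => t ^+ n : R)).
Proof.
apply/integrableP; split; first by apply/measurable_EFinP; exact: measurable_expn.
rewrite (eq_integral (fun t : measurableTypeR R => (t ^+ n : R)%:E)); first by rewrite momentE ltry.
move=> t /[!inE] /=; rewrite in_itv /= => /andP[t0 _].
by rewrite ger0_norm // exprn_ge0.
Qed.

(* [P] runs through the polynomials with real coefficients; the integral of
   [t ^ n P(t)] is the corresponding combination of moments. *)
Lemma moment_poly_le n N (p : nat -> R) (B : R) :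
  (forall t, 0 <= t < 1 -> \sum_(0 <= k < N) p k * t ^+ k <= B) ->
  \sum_(0 <= k < N) p k * moment (n + k) <= B * moment n.
Proof.
move=> hB; have Z (c : R) m : mu.-integrable D (EFin \o (fun t : measurableTypeR R => c * t ^+ m)).
  exact: (integrableZl mD c (integrable_expn m)).
pose F M (t : measurableTypeR R) : R := \sum_(0 <= k < M) p k * t ^+ (n + k).
have F0 : F 0 = cst 0 by apply/funext => t; rewrite /F big_nil.
have FS M : F M.+1 = fun t => F M t + p M * t ^+ (n + M).
  by apply/funext => t; rewrite /F big_nat_recr.
have S M : mu.-integrable D (EFin \o F M) /\
   \int[mu]_(t in D) F M t = \sum_(0 <= k < M) p k * moment (n + k).
  elim: M => [|M [ih1 ih2]].
    rewrite F0 big_nil; split; last by rewrite /Rintegral integral0.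
    exact: integrable0.
  rewrite FS big_nat_recr //= -ih2.
  split; first exact: (integrableD mD ih1 (Z _ _)).
  rewrite (RintegralD mD ih1 (Z _ _)); congr (_ + _).
  by rewrite (RintegralZl _ mD (integrable_expn _)).
have [S1 <-] := S N; rewrite -[moment n]/(\int[mu]_(t in D) (t ^+ n)).
rewrite -(RintegralZl _ mD (integrable_expn _)); apply: le_Rintegral => //.
move=> t /=; rewrite in_itv /= => t01.
rewrite /F; under eq_bigr do rewrite exprD mulrCA.
rewrite -mulr_sumr mulrC ler_wpM2r ?hB //.
by rewrite exprn_ge0 //; case/andP: t01.
Qed.

End FiniteMeasure.

Lemma carleson_finite : carleson mu 2 -> (mu D < +oo)%E.
Proof.
move=> [c c0 /(_ 0)]; rewrite lexx ltr01 => /(_ isT) h.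
by apply: le_lt_trans h _; rewrite ltry.
Qed.

(** A closed form that induction can check; its limit 12 is the constant in [m_n] below. *)
Let sum_sqr_half n : \sum_(0 <= j < n) j.+1%:R ^+ 2 * (2^-1) ^+ j =
  12 - (2 * n%:R ^+ 2 + 8 * n%:R + 12) * (2^-1) ^+ n :> R.
Proof.
elim: n => [|n ih]; first by rewrite big_nil expr0; ring.
by rewrite big_nat_recr //= ih (exprS _ n) -natr1; field.
Qed.

Let onem_expn_le (j n : nat) : (j <= n)%N -> (0 < n)%N -> (1 - j%:R / n%:R) ^+ n <= (2^-1 : R) ^+ j.
Proof.
move=> jn n0; have n0R : 0 < n%:R :> R by rewrite ltr0n.
have h1 : 1 - j%:R / n%:R <= expR (- (j%:R / n%:R)) :> R by exact: expR_ge1Dx.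
have h0 : 0 <= 1 - j%:R / n%:R :> R by rewrite subr_ge0 ler_pdivrMr // mul1r ler_nat.
apply: (@le_trans _ _ (expR (- (j%:R / n%:R)) ^+ n)).
  by rewrite lerXn2r // ?nnegrE ?expR_ge0.
rewrite -expRM_natl; have -> : n%:R * - (j%:R / n%:R) = j%:R * -1 :> R.
  by field; rewrite gt_eqF.
rewrite expRM_natl lerXn2r // ?nnegrE ?expR_ge0 ?invr_ge0 //.
rewrite expRN lef_pV2 ?posrE ?expR_gt0 //.
by apply: le_trans (expR_ge1Dx _); rewrite -[2]/(1 + 1 : R).
Qed.

(** Cuts [[0, 1)] by the distance to 1 at scale [1 / n]: where [n * (1 - t)] has integer part [j],
    [t ^+ n] is at most [2 ^ (- j)], and [t] lies in the tail starting at [1 - (j + 1) / n], whose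
    mass the Carleson condition controls. *)
Let shell n (t : R) : (0 < n)%N -> 0 <= t < 1 ->
  t ^+ n <= \sum_(0 <= j < n) (2^-1 : R) ^+ j * \1_(`[1 - j.+1%:R / n%:R, 1[%classic) t.
Proof.
move=> n0 /andP[t0 t1]; have n0R : 0 < n%:R :> R by rewrite ltr0n.
have s0 (P : pred nat) : 0 <= \sum_(0 <= j < n | P j) (2^-1 : R) ^+ j * \1_(`[1 - j.+1%:R / n%:R, 1[%classic) t.
  by apply: sumr_ge0 => j _; rewrite mulr_ge0 ?exprn_ge0 ?invr_ge0.
(* At [t = 0] the integer part would be [n], outside the range of the sum. *)
have [te|tn0] := eqVneq t 0.
  by apply: le_trans (s0 xpredT); rewrite te expr0n gtn_eqF.
have t_gt0 : 0 < t by rewrite lt_def tn0.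
have nt0 : 0 <= n%:R * (1 - t) by rewrite mulr_ge0 // subr_ge0 ltW.
have := Num.Theory.truncn_itv nt0.
set j := Num.trunc _ => /andP[j1 j2].
have jn : (j < n)%N.
  rewrite -(ltr_nat R); apply: le_lt_trans j1 _.
  by rewrite -[ltRHS]mulr1 ltr_pM2l // gtrBl.
rewrite (bigD1_seq j) ?iota_uniq ?mem_index_iota //=.
apply: (@le_trans _ _ ((2^-1) ^+ j)); last first.
  rewrite indicE mem_set ?mulr1; first by rewrite lerDl; exact: s0.
  rewrite /= in_itv /= t1 andbT lerBlDr -lerBlDl ler_pdivlMr // mulrC.
  exact: ltW.
apply: le_trans (onem_expn_le (ltnW jn) n0).
have tj : t <= 1 - j%:R / n%:R by rewrite lerBrDl -lerBrDr ler_pdivrMr // mulrC.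
by rewrite lerXn2r // nnegrE // (le_trans t0).
Qed.

(** Summing over the shells gives [12 * c / n ^ 2]. The denominator [n.+1%:R * n.+2%:R] makes sense
    at [n = 0] and telescopes when summed. *)
Lemma moment_decay : carleson mu 2 ->
  exists2 K, 0 < K & forall n, moment n <= K / (n.+1%:R * n.+2%:R).
Proof.
move=> cm; have finD := carleson_finite cm; have [c c0 hc] := cm.
have m_n n : (0 < n)%N -> moment n <= 12 * c / n%:R ^+ 2.
  move=> n0; have n0R : 0 < n%:R :> R by rewrite ltr0n.
  pose A j : set (measurableTypeR R) := `[1 - j.+1%:R / n%:R, 1[%classic.
  have mA j : measurable (A j) by exact: measurable_itv.
  rewrite -lee_fin -momentE //.
  apply: (@le_trans _ _ (\int[mu]_(t in D) (\sum_(0 <= j < n) ((2^-1) ^+ j)%:E * (\1_(A j) t)%:E))%E).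
    apply: ge0_le_integral => //.
    - by move=> t /=; rewrite in_itv /= => /andP[t0 _]; rewrite lee_fin exprn_ge0.
    - by apply/measurable_EFinP; exact: measurable_expn.
    - apply: emeasurable_sum => j; apply: measurable_funeM.
      by apply/measurable_EFinP; exact: measurable_indic.
    move=> t /=; rewrite in_itv /= => t01.
    under eq_bigr do rewrite -EFinM; rewrite sumEFin lee_fin.
    exact: shell.
  rewrite ge0_integral_sum //; last first.
    by move=> j; apply: measurable_funeM; apply/measurable_EFinP; exact: measurable_indic.
  apply: (@le_trans _ _ (\sum_(0 <= j < n) (c / n%:R ^+ 2 * (j.+1%:R ^+ 2 * (2^-1) ^+ j))%:E)%E).
    rewrite !big_mkord; apply: lee_sum => j _.
    rewrite ge0_integralZl_EFin //; last first.
      by apply/measurable_EFinP; exact: measurable_indic.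
    rewrite integral_indic //.
    apply: (@le_trans _ _ (((2^-1) ^+ j)%:E * (c * (j.+1%:R / n%:R : R) `^ 2)%:E)%E).
      apply: lee_wpmul2l; first by rewrite lee_fin exprn_ge0 ?invr_ge0.
      have h1 : 0 <= (1 - j.+1%:R / n%:R : R) < 1.
        by rewrite subr_ge0 ler_pdivrMr // mul1r ler_nat ltn_ord /= gtrBl divr_gt0.
      have := hc _ h1; rewrite opprB addrCA subrr addr0; apply: le_trans.
      by apply: le_measure; rewrite ?inE //; exact: measurableI.
    rewrite -EFinM lee_fin powR_mulrn ?divr_ge0 ?(ltW n0R) // le_eqVlt; apply/orP; left; apply/eqP.
    by rewrite expr_div_n; field; rewrite gt_eqF.
  rewrite sumEFin lee_fin -mulr_sumr sum_sqr_half.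
  rewrite [leRHS](_ : _ = c / n%:R ^+ 2 * 12); last by ring.
  rewrite ler_wpM2l ?divr_ge0 ?exprn_ge0 ?(ltW c0) // gerBl mulr_ge0 ?exprn_ge0 ?invr_ge0 //.
have m_0 : moment 0 <= c.
  rewrite -lee_fin -momentE //; have /andP[_ h] := moment_bound 0.
  apply: le_trans h _; have := hc 0; rewrite lexx ltr01 => /(_ isT).
  by rewrite subr0 powR1 mulr1.
(* [72 = 12 * 6], since [(n + 1) * (n + 2) <= 6 * n ^ 2] for [n >= 1], with equality at 1. *)
exists (72 * c) => [|[|n]]; first by rewrite mulr_gt0.
  by apply: le_trans m_0 _; rewrite ler_pdivlMr //; lra.
apply: le_trans (m_n n.+1 isT) _.
have n0 : 0 <= n%:R :> R by [].
rewrite ler_pdivrMr ?exprn_gt0 // mulrAC ler_pdivlMr ?mulr_gt0 //.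
rewrite -subr_ge0 -(natr1 n.+2) -(natr1 n.+1) -(natr1 n).
set x : R := n%:R in n0 *.
have -> : 72 * c * (x + 1) ^+ 2 - 12 * c * ((x + 1 + 1) * (x + 1 + 1 + 1)) =
   12 * (c * (5 * x ^+ 2 + 7 * x)) by ring.
by rewrite !mulr_ge0 ?addr_ge0 ?mulr_ge0 ?exprn_ge0 ?(ltW c0).
Qed.

Lemma moment_ge (s : R) n : (mu D < +oo)%E -> 0 <= s < 1 ->
  ((s ^+ n)%:E * mu `[s, 1%R[%classic <= (moment n)%:E)%E.
Proof.
move=> finD /andP[s0 s1]; rewrite -momentE // -integral_cst; last exact: measurable_itv.
have sD : `[s, 1%R[%classic `<=` D.
  by move=> t /=; rewrite !in_itv /= => /andP[st ->]; rewrite (le_trans s0).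
apply: (@le_trans _ _ (\int[mu]_(t in `[s, 1%R[) (t ^+ n)%:E)%E).
  apply: ge0_le_integral => //.
  - by move=> t _; rewrite lee_fin exprn_ge0.
  - by apply/measurable_EFinP; exact: measurable_expn.
  move=> t /=; rewrite in_itv /= => /andP[st t1]; rewrite lee_fin lerXn2r // nnegrE //.
  exact: le_trans st.
apply: ge0_subset_integral => //.
- by apply/measurable_EFinP; exact: measurable_expn.
- by move=> t /=; rewrite in_itv /= => /andP[t0 _]; rewrite lee_fin exprn_ge0.
Qed.

End Moments.

Lemma cvg_poly_left1 (R : realType) (b : nat -> cplx R) N :
  \sum_(0 <= k < N) b k * (real_complex R r : cplx R) ^+ k @[r --> (1 : R)^'-] -->
  \sum_(0 <= k < N) b k.
Proof.
have rC : (real_complex R r : cplx R) @[r --> (1 : R)^'-] --> (1 : cplx R).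
  apply/cvg_normcP => e e0.
  have : r @[r --> (1 : R)^'-] --> (1 : R) by apply: cvg_at_left_filter; exact: cvg_id.
  move/cvgrPdist_le => /(_ _ e0); apply: filterS => r.
  have -> : 1 - (real_complex R r : cplx R) = real_complex R (1 - r) by rewrite rmorphB rmorph1.
  by rewrite normcR.
have rX k : (real_complex R r : cplx R) ^+ k @[r --> (1 : R)^'-] --> (1 : cplx R).
  elim: k => [|k ih]; first exact: cvg_cst.
  have X : (real_complex R r : cplx R) * (real_complex R r : cplx R) ^+ k @[r --> (1 : R)^'-] --> (1 * 1 : cplx R).
    exact: cvgM rC ih.
  rewrite mulr1 in X.
  rewrite (_ : (fun r : R => _ ^+ k.+1) = fun r => (real_complex R r : cplx R) * (real_complex R r : cplx R) ^+ k) //.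
  by apply/funext => r; rewrite exprS.
pose P n (r : R) : cplx R := \sum_(0 <= k < n) b k * (real_complex R r : cplx R) ^+ k.
rewrite -[X in X @ _]/(P N); elim: N => [|N ih].
  rewrite big_nil (_ : P 0 = cst 0); first exact: cvg_cst.
  by apply/funext => r; rewrite /P big_nil.
have PS : P N.+1 = fun r => P N r + b N * (real_complex R r : cplx R) ^+ N.
  by apply/funext => r; rewrite /P big_nat_recr.
have X : b N * (real_complex R r : cplx R) ^+ N @[r --> (1 : R)^'-] --> (b N * 1 : cplx R).
  by apply: cvgM (rX N); exact: cvg_cst.
rewrite mulr1 in X.
have SE : \sum_(0 <= k < N.+1) b k = \sum_(0 <= k < N) b k + b N by rewrite big_nat_recr.
rewrite PS SE; exact: cvgD ih X.
Qed.

(** * The operator on bounded coefficient sequences *)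

Section Operator.
Variables (R : realType) (mu : {measure set (measurableTypeR R) -> \bar R}).
Variables (alpha : R).
Hypothesis alpha2 : 2 <= alpha.
Hypothesis finD : (mu `[0%R, 1%R[%classic < +oo)%E.
Variable K : R.
Hypothesis K0 : 0 < K.
Hypothesis momentK : forall n, moment mu n <= K / (n.+1%:R * n.+2%:R).
Local Notation C := (cplx R).
Local Notation "x %:C" := (real_complex R x : C).
Implicit Types (a b : nat -> C) (z : C).
Local Notation m := (moment mu).

Let m_ge0 n : 0 <= m n. Proof. exact: moment_ge0. Qed.

Lemma hilbert_momentE n k : hilbert_moment mu alpha n k = (gbin alpha n * m (n + k))%:E.
Proof.
rewrite /hilbert_moment Gamma_ratio; last by apply: lt_le_trans alpha2; rewrite ltr1n.
under eq_integral do rewrite EFinM.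
rewrite integralZl //; last exact: integrable_expn.
by rewrite momentE // EFinM.
Qed.

Lemma telescope_inv (N M : nat) : (N <= M)%N ->
  \sum_(N <= k < M) (k.+1%:R * k.+2%:R)^-1 = N.+1%:R^-1 - M.+1%:R^-1 :> R.
Proof.
elim: M => [|M ih]; first by rewrite leqn0 => /eqP->; rewrite big_geq // subrr.
rewrite leq_eqVlt => /predU1P[->|]; first by rewrite big_geq // subrr.
rewrite ltnS => NM; rewrite big_nat_recr //= ih // -!(natr1 M.+1) -!(natr1 M).
have x0 : 0 < M%:R + 1 :> R by rewrite ltr_wpDl.
move: (M%:R + 1) x0 (N.+1%:R^-1) => x x0 y.
by field; rewrite !gt_eqF //= addr_gt0.
Qed.

Lemma moment_tail n (N M : nat) : (N <= M)%N -> \sum_(N <= k < M) m (n + k) <= K / N.+1%:R.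
Proof.
move=> NM; apply: (@le_trans _ _ (\sum_(N <= k < M) K * (k.+1%:R * k.+2%:R)^-1)).
  by apply: ler_sum => k _; apply: le_trans (moment_decr finD n k) (momentK k).
rewrite -mulr_sumr telescope_inv // ler_wpM2l ?(ltW K0) // gerBl invr_ge0 //.
Qed.

Definition moment_series a n : nat -> C := series (fun k => (m (n + k))%:C * a k).

Definition moment_pairing a n : C := limn (moment_series a n).

Section BoundedCoefficients.
Variables (a : nat -> C) (A : R).
Hypothesis aA : forall k, normc (a k) <= A.

Lemma coef_bound_ge0 : 0 <= A.
Proof. exact: le_trans (normc_ge0 _) (aA 0%N). Qed.

Lemma bounded_tame : tame a.
Proof.
move=> r /andP[r0 r1]; exists A => k; apply: le_trans (aA k).
by rewrite ler_piMr ?normc_ge0 // exprn_ile1 // ltW.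
Qed.

Lemma moment_series_abs n N : \sum_(0 <= k < N) normc ((m (n + k))%:C * a k) <= A * K.
Proof.
apply: (@le_trans _ _ (A * \sum_(0 <= k < N) m (n + k))).
  rewrite mulr_sumr; apply: ler_sum => k _; rewrite normcM normcR ger0_norm // mulrC.
  by rewrite ler_wpM2r.
rewrite ler_wpM2l ?coef_bound_ge0 //.
by have := moment_tail n (leq0n N); rewrite divr1.
Qed.

Lemma moment_series_cvg n : moment_series a n @ \oo --> moment_pairing a n.
Proof. exact: abs_cvgC (moment_series_abs n). Qed.

Lemma moment_pairing_crude n : normc (moment_pairing a n) <= A * K.
Proof.
apply: (@normc_lim_le _ (moment_series a n)); first exact: moment_series_cvg.
move=> N.
exact: le_trans (normc_le_sum _ _) (moment_series_abs n N).
Qed.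

Lemma psum_tail (x : R) N : 0 <= x < 1 ->
  normc (psum a x%:C - \sum_(0 <= k < N) a k * x%:C ^+ k) <= A * x ^+ N / (1 - x).
Proof.
move=> /andP[x0 x1]; have A0 := coef_bound_ge0.
have xd : unit_disc (x%:C) by rewrite /unit_disc /mkset normcR ger0_norm.
have cv := tame_psum bounded_tame xd.
set S := \sum_(0 <= k < N) _.
have cvs : (fun M => series (fun k => a k * x%:C ^+ k) (M + N)%N - S) @ \oo --> psum a x%:C - S.
  by apply: cvgB; [rewrite (cvg_shiftn N)|exact: cvg_cst].
apply: (@normc_lim_le _ _ _ _ cvs) => M; rewrite /S /series /=.
rewrite (big_cat_nat (n := N)) //= ?leq_addl // addrAC subrr add0r.
rewrite -{1}[N]add0n big_addn addnK; apply: le_trans (normc_le_sum _ _) _.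
apply: (@le_trans _ _ (A * x ^+ N * \sum_(0 <= k < M) x ^+ k)).
  rewrite mulr_sumr; apply: ler_sum => k _; rewrite normcM normcX normcR ger0_norm //.
  by rewrite exprD -mulrA [x ^+ N * _]mulrC ler_wpM2r // mulr_ge0 ?exprn_ge0.
by rewrite ler_wpM2l ?mulr_ge0 ?exprn_ge0 // geo_sum_le // x0.
Qed.

Lemma psum_partial_le (x : R) N : 0 <= x < 1 ->
  normc (\sum_(0 <= k < N) a k * x%:C ^+ k) <= normc (psum a x%:C) + A * x ^+ N / (1 - x).
Proof.
move=> x01; apply: le_trans (normc_le_dist _ (psum a x%:C)) _.
by rewrite lerD2l psum_tail.
Qed.

(* Abel means: for [r < 1] the partial sums of [f(r t)] are within a geometric
   error of [f], so only finite sums have to be integrated. *)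
Lemma moment_pairing_le n (B : R) : (forall t, 0 <= t < 1 -> normc (psum a t%:C) <= B) ->
  normc (moment_pairing a n) <= B * m n.
Proof.
move=> aB; have A0 := coef_bound_ge0.
have E (x v w y : C) : x * (v * (w * y)) = v * (w * (y * x)) by ring.
pose p (r : R) N : C := \sum_(0 <= k < N) (m (n + k))%:C * (a k * r%:C ^+ k).
(* After rotation the sum is real, hence an integral of a real polynomial against [t ^ n]. The
   geometric error is uniform in [t] but blows up as [r] tends to 1. *)
have p_abel r N : 0 <= r < 1 -> normc (p r N) <= (B + A * r ^+ N / (1 - r)) * m n.
  move=> /andP[r0 r1]; have [u u1 ->] := normc_dual (p r N).
  have -> : complex.Re (u * p r N) =
      \sum_(0 <= k < N) complex.Re (u * (a k * r%:C ^+ k)) * m (n + k).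
    rewrite /p mulr_sumr Re_sum; apply: eq_bigr => k _; by rewrite mulrCA ReZ mulrC.
  apply: (moment_poly_le finD) => t /andP[t0 t1].
  have rt : 0 <= r * t < 1.
    by rewrite mulr_ge0 //= (le_lt_trans _ r1) // ler_piMr // ltW.
  have -> : \sum_(0 <= k < N) complex.Re (u * (a k * r%:C ^+ k)) * t ^+ k =
      complex.Re (u * \sum_(0 <= k < N) a k * (r * t)%:C ^+ k).
    rewrite mulr_sumr Re_sum; apply: eq_bigr => k _.
    rewrite mulrC -ReZ; congr complex.Re.
    rewrite rmorphM exprMn rmorphXn /=.
    exact: E.
  apply: le_trans (ler_norm _) _; apply: le_trans (Re_le_normc _) _.
  rewrite normcM u1 mul1r; apply: le_trans (psum_partial_le N rt) _.
  rewrite lerD ?aB //; case/andP: rt => rt0 rt1.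
  have rtr : r * t <= r by rewrite ler_piMr // ltW.
  apply: ler_pM; rewrite ?mulr_ge0 ?exprn_ge0 ?invr_ge0 ?subr_ge0 ?(ltW rt1) //.
    by rewrite ler_wpM2l // lerXn2r.
  by rewrite lef_pV2 ?posrE ?subr_gt0 // lerD2l lerN2.
(* The cost of cutting at [N] is a moment tail, uniform in [r]. This permits the order of limits
   below: [M] to infinity with [r] fixed removes the geometric error, then [r] to 1 with [N] fixed,
   then [N] to infinity. *)
have p_cut r N M : 0 <= r < 1 -> (N <= M)%N -> normc (p r N) <= normc (p r M) + A * (K / N.+1%:R).
  move=> /andP[r0 r1] NM.
  suff h : normc (p r M - p r N) <= A * (K / N.+1%:R).
    by apply: le_trans (normc_le_dist _ (p r M)) _; rewrite lerD2l.
  rewrite /p (big_cat_nat (n := N)) //= addrAC subrr add0r.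
  apply: le_trans (ler_wpM2l A0 (moment_tail n NM)).
  rewrite -{1}[N]add0n -(add0n N) !big_addn; apply: le_trans (normc_le_sum _ _) _.
  rewrite mulr_sumr; apply: ler_sum => k _; rewrite !normcM normcX !normcR !ger0_norm // mulrC.
  by rewrite ler_wpM2r // -[leRHS]mulr1 ler_pM ?normc_ge0 ?exprn_ge0 ?exprn_ile1 // ltW.
have p_r r N : 0 <= r < 1 -> normc (p r N) <= B * m n + A * (K / N.+1%:R).
  move=> r01; have /andP[r0 r1] := r01.
  have lim : (B + A * r ^+ M / (1 - r)) * m n + A * (K / N.+1%:R) @[M --> \oo] -->
      (B + A * 0 / (1 - r)) * m n + A * (K / N.+1%:R).
    apply: cvgD; last exact: cvg_cst.
    apply: cvgM; last exact: cvg_cst.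
    apply: cvgD; first exact: cvg_cst.
    apply: cvgM; last exact: cvg_cst.
    by apply: cvgM; [exact: cvg_cst|apply: cvg_expr; rewrite ger0_norm].
  rewrite mulr0 mul0r addr0 in lim.
  rewrite -(cvg_lim (@Rhausdorff R) lim); apply: limr_ge; first by apply/cvg_ex; eexists; exact: lim.
  near=> M; have NM : (N <= M)%N by near: M; exact: nbhs_infty_ge.
  by apply: le_trans (p_cut r N M r01 NM) _; rewrite lerD2r p_abel.
have p_1 N : normc (p 1 N) <= B * m n + A * (K / N.+1%:R).
  have cp : p r N @[r --> (1 : R)^'-] --> p 1 N.
    have -> : p 1 N = \sum_(0 <= k < N) (m (n + k))%:C * a k.
      by apply: eq_bigr => k _; rewrite rmorph1 expr1n mulr1.
    have pE r : p r N = \sum_(0 <= k < N) (m (n + k))%:C * a k * r%:C ^+ k.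
      by apply: eq_bigr => k _; rewrite mulrA.
    by rewrite (funext pE); exact: cvg_poly_left1.
  have {}cp : normc (p r N) @[r --> (1 : R)^'-] --> normc (p 1 N) by exact: cvg_normc cp.
  rewrite -(cvg_lim (@Rhausdorff R) cp); apply: limr_le; first by apply/cvg_ex; eexists; exact: cp.
  near=> r; apply: p_r; apply/andP; split; near: r; last exact: nbhs_left_lt.
  by apply: nbhs_left_ge.
have lim : B * m n + A * (K * harmonic N) @[N --> \oo] --> B * m n + A * (K * 0).
  apply: cvgD; first exact: cvg_cst.
  apply: cvgM; first exact: cvg_cst.
  by apply: cvgM; [exact: cvg_cst|exact: cvg_harmonic].
rewrite !mulr0 addr0 in lim.
have nl : normc (moment_series a n N) @[N --> \oo] --> normc (moment_pairing a n).
  by apply: cvg_normc; exact: moment_series_cvg.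
apply: (ler_cvg_to nl lim); near=> N.
apply: le_trans (p_1 N); rewrite /p /moment_series /series /= le_eqVlt; apply/orP; left; apply/eqP.
by congr normc; apply: eq_bigr => k _; rewrite rmorph1 expr1n mulr1.
Unshelve. all: by end_near. Qed.

Definition hilbert_coef n : C := (gbin alpha n)%:C * moment_pairing a n.

Let a0 : 0 < alpha. Proof. exact: lt_le_trans alpha2. Qed.

Lemma hilbert_coef_tame : tame hilbert_coef.
Proof.
move=> r /andP[r0 r1]; exists (((1 - r) `^ alpha)^-1 * (A * K)) => k.
rewrite normcM normcR ger0_norm ?(ltW (gbin_gt0 _ a0)) // mulrAC.
rewrite ler_pM ?mulr_ge0 ?exprn_ge0 ?normc_ge0 ?(ltW (gbin_gt0 _ a0)) ?moment_pairing_crude //.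
by rewrite gbin_geo_bounded // r0.
Qed.

(** Relative to [gbin (alpha - 1) k], differentiation and the passage from [alpha - 1] to [alpha]
    each cost a factor of size [k], and the moment decay pays for both. Each quotient is at most
    [alpha], whence [alpha ^+ 2]; the divisor [alpha - 1] comes from [gbin_shift]. *)
Lemma dcoef_hilbert_coef_le (B : R) k : (forall t, 0 <= t < 1 -> normc (psum a t%:C) <= B) ->
  normc (dcoef hilbert_coef k) <= alpha ^+ 2 / (alpha - 1) * K * B * gbin (alpha - 1) k.
Proof.
move=> aB; have B0 : 0 <= B.
  by apply: le_trans (aB 0 _); rewrite ?lexx ?ltr01 ?normc_ge0.
have a1 : 0 < alpha - 1 by have := alpha2; lra.
rewrite /dcoef /hilbert_coef !normcM normc_nat normcR ger0_norm ?(ltW (gbin_gt0 _ a0)) //.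
rewrite mulrA gbinS_mul.
have gE : gbin alpha k = (alpha - 1 + k%:R) / (alpha - 1) * gbin (alpha - 1) k.
  have := gbin_shift k (lt0r_neq0 a1); rewrite subrK => E.
  by rewrite mulrAC -E mulrC mulKf // gt_eqF.
have g0 := ltW (gbin_gt0 k a1).
have ml : normc (moment_pairing a k.+1) <= B * (K / (k.+2%:R * k.+3%:R)).
  by apply: le_trans (moment_pairing_le _ aB) _; rewrite ler_wpM2l.
have k0 : 0 <= k%:R :> R by [].
have s0 : 0 <= alpha + k%:R by rewrite addr_ge0 // ltW.
apply: le_trans (ler_wpM2l _ ml) _.
  by rewrite mulr_ge0 // ltW // gbin_gt0.
rewrite gE.
have -> : (alpha + k%:R) * ((alpha - 1 + k%:R) / (alpha - 1) * gbin (alpha - 1) k) *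
   (B * (K / (k.+2%:R * k.+3%:R))) =
   ((alpha + k%:R) / k.+2%:R) * ((alpha - 1 + k%:R) / k.+3%:R) * (K * B * gbin (alpha - 1) k / (alpha - 1)).
  by field; rewrite (gt_eqF a1) !gt_eqF // ltr_wpDr.
have -> : alpha ^+ 2 / (alpha - 1) * K * B * gbin (alpha - 1) k =
   alpha * alpha * (K * B * gbin (alpha - 1) k / (alpha - 1)) by field; rewrite gt_eqF.
apply: ler_wpM2r; first by rewrite divr_ge0 ?mulr_ge0 ?(ltW K0) ?(ltW a1).
have al2 := alpha2; have ak : 0 <= (alpha - 1) * k%:R by rewrite mulr_ge0 ?(ltW a1).
apply: ler_pM.
- by rewrite divr_ge0.
- by rewrite divr_ge0 // addr_ge0 // ltW.
- rewrite ler_pdivrMr // -(natr1 k.+1) -(natr1 k).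
  have -> : alpha * (k%:R + 1 + 1) = alpha + k%:R + ((alpha - 1) * k%:R + alpha) by ring.
  by rewrite lerDl addr_ge0 // ltW.
rewrite ler_pdivrMr // -(natr1 k.+2) -(natr1 k.+1) -(natr1 k).
have -> : alpha * (k%:R + 1 + 1 + 1) = alpha - 1 + k%:R + ((alpha - 1) * k%:R + (2 * alpha + 1)) by ring.
by rewrite lerDl addr_ge0 //; lra.
Qed.

(** The value 0 off the disc is the normalisation required by [is_bloch]. *)
Definition hilbert_sum z : C := if `[< unit_disc z >] then psum hilbert_coef z else 0.

Lemma hilbert_sum_disc z : unit_disc z -> hilbert_sum z = psum hilbert_coef z.
Proof. by move=> z1; rewrite /hilbert_sum; case: asboolP. Qed.

Lemma hilbert_sum_power_series : power_series_on_disc hilbert_coef hilbert_sum.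
Proof. by move=> z z1; rewrite hilbert_sum_disc //; exact: tame_psum hilbert_coef_tame _ z1. Qed.

Lemma hilbert_sum_weight (B : R) z : (forall t, 0 <= t < 1 -> normc (psum a t%:C) <= B) ->
  unit_disc z ->
  (1 - normc z ^+ 2) `^ (alpha - 1) * normc (derive1 hilbert_sum z) <=
    alpha ^+ 2 / (alpha - 1) * K * 2 `^ (alpha - 1) * B.
Proof.
move=> aB z1; have z1' : normc z < 1 by exact: z1.
have B0 : 0 <= B.
  by apply: le_trans (aB 0 _); rewrite ?lexx ?ltr01 ?normc_ge0.
have a1 : 0 < alpha - 1 by have := alpha2; lra.
have nz0 := normc_ge0 z.
set r := normc z in z1' nz0 *.
have w0 : 0 < (1 - r) `^ (alpha - 1) by rewrite powR_gt0 // subr_gt0.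
set c := alpha ^+ 2 / (alpha - 1) * K.
have c0 : 0 <= c by rewrite mulr_ge0 ?(ltW K0) // divr_ge0 ?exprn_ge0 ?(ltW a0) ?(ltW a1).
rewrite (power_series_derive1 hilbert_sum_power_series z1).
have dle : normc (psum (dcoef hilbert_coef) z) <= c * B * ((1 - r) `^ (alpha - 1))^-1.
  apply: (@normc_lim_le _ (series (fun k => dcoef hilbert_coef k * z ^+ k))).
    exact: tame_psum (tame_dcoef hilbert_coef_tame) _ z1.
  move=> N; apply: le_trans (normc_le_sum _ _) _.
  apply: (@le_trans _ _ (c * B * gbin_psum (alpha - 1) N r)); last first.
    apply: ler_wpM2l; first exact: mulr_ge0.
    by apply: gbin_psum_le => //; rewrite nz0.
  rewrite /gbin_psum mulr_sumr; apply: ler_sum => k _; rewrite normcM normcX mulrA.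
  by rewrite ler_wpM2r ?exprn_ge0 // dcoef_hilbert_coef_le.
have wle : (1 - r ^+ 2) `^ (alpha - 1) <= 2 `^ (alpha - 1) * (1 - r) `^ (alpha - 1).
  rewrite -powRM ?subr_ge0 ?(ltW z1') //; apply: ge0_ler_powR; first exact: ltW.
  - by rewrite nnegrE subr_ge0 expr_le1 // ltW.
  - by rewrite nnegrE mulr_ge0 // subr_ge0 ltW.
  have -> : 1 - r ^+ 2 = (1 + r) * (1 - r) by ring.
  by rewrite ler_wpM2r ?subr_ge0 ?(ltW z1') //; lra.
apply: (@le_trans _ _ (2 `^ (alpha - 1) * (1 - r) `^ (alpha - 1) * (c * B * ((1 - r) `^ (alpha - 1))^-1))).
  by apply: ler_pM; rewrite ?powR_ge0 ?normc_ge0.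
rewrite le_eqVlt; apply/orP; left; apply/eqP.
by field; rewrite gt_eqF.
Qed.

Lemma psum_at0 (b : nat -> C) : psum b 0 = b 0%N.
Proof.
apply: cvg_lim; first exact: norm_hausdorff.
apply: (@cvg_trans _ (cst (b 0%N) @ \oo)); last exact: cvg_cst.
apply: near_eq_cvg; near=> M; rewrite /series /=.
have M0 : (0 < M)%N by near: M; exact: nbhs_infty_gt.
rewrite -(prednK M0) big_nat_recl //= expr0 mulr1 big1 ?addr0 // => k _.
by rewrite exprS mul0r mulr0.
Unshelve. all: by end_near. Qed.

Lemma hilbert_sum0_le (B : R) : (forall t, 0 <= t < 1 -> normc (psum a t%:C) <= B) ->
  normc (hilbert_sum 0) <= K * B.
Proof.
move=> aB; have B0 : 0 <= B.
  by apply: le_trans (aB 0 _); rewrite ?lexx ?ltr01 ?normc_ge0.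
rewrite hilbert_sum_disc; last exact: disc0.
rewrite psum_at0 /hilbert_coef gbin0 rmorph1 mul1r; apply: le_trans (moment_pairing_le _ aB) _.
rewrite mulrC ler_wpM2r //; apply: le_trans (momentK 0) _.
by rewrite ler_pdivrMr // mul1r ler_peMr ?(ltW K0) // ler1n.
Qed.

Lemma hilbert_sum_bloch : (exists B : R, forall t, 0 <= t < 1 -> normc (psum a t%:C) <= B) ->
  is_bloch (alpha - 1) hilbert_sum.
Proof.
move=> [B aB]; split.
- exact: power_series_analytic hilbert_sum_power_series.
- exists (alpha ^+ 2 / (alpha - 1) * K * 2 `^ (alpha - 1) * B) => _ [z z1 <-].
  exact: hilbert_sum_weight.
- by move=> z z1; rewrite /hilbert_sum; case: asboolP.
Qed.

Lemma hilbert_sum_hilbert f : power_series_on_disc a f -> hilbert_image mu alpha f hilbert_sum.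
Proof.
move=> af.
have hs n : hilbert_series mu alpha a n = fun N => (gbin alpha n)%:C * moment_series a n N.
  apply/funext => N; rewrite /hilbert_series /moment_series /series /= mulr_sumr.
  by apply: eq_bigr => k _; rewrite hilbert_momentE /= rmorphM mulrA.
have hc n : hilbert_series mu alpha a n @ \oo --> hilbert_coef n.
  rewrite hs; apply: cvgM; first exact: cvg_cst.
  exact: moment_series_cvg.
exists a; split.
- exact: af.
- by move=> n k; rewrite hilbert_momentE.
- by move=> n; apply/cvg_ex; exists (hilbert_coef n); exact: hc.
- rewrite (_ : (fun n => _) = hilbert_coef); first exact: hilbert_sum_power_series.
  by apply/funext => n; apply: cvg_lim; [exact: norm_hausdorff|exact: hc].
- exact: power_series_analytic hilbert_sum_power_series.
Qed.

End BoundedCoefficients.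

Definition bounded_coef a := exists A : R, forall k, normc (a k) <= A.

Lemma bounded_coef_tame a : bounded_coef a -> tame a.
Proof. by move=> [A /bounded_tame]. Qed.

Lemma bounded_coefZD (c : C) a b : bounded_coef a -> bounded_coef b ->
  bounded_coef (fun k => c * a k + b k).
Proof.
move=> [A aA] [B bB]; exists (normc c * A + B) => k.
by apply: le_trans (normcD _ _) _; rewrite normcM lerD // ler_wpM2l ?normc_ge0.
Qed.

Lemma psumZD (c : C) a b z : bounded_coef a -> bounded_coef b -> unit_disc z ->
  psum (fun k => c * a k + b k) z = c * psum a z + psum b z.
Proof.
move=> ca cb z1.
have h := power_seriesZD (c := c) (tame_psum (bounded_coef_tame ca)) (tame_psum (bounded_coef_tame cb)).
by rewrite -(power_seriesE h z1).
Qed.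

Lemma moment_pairingZD (c : C) a b n : bounded_coef a -> bounded_coef b ->
  moment_pairing (fun k => c * a k + b k) n = c * moment_pairing a n + moment_pairing b n.
Proof.
move=> ca cb; have [A aA] := ca; have [B bB] := cb.
apply: cvg_lim; first exact: norm_hausdorff.
have X : (fun N => c * moment_series a n N + moment_series b n N) @ \oo --> c * moment_pairing a n + moment_pairing b n.
  apply: cvgD; last exact: moment_series_cvg bB n.
  by apply: cvgM; [exact: cvg_cst|exact: moment_series_cvg aA n].
have E : moment_series (fun k => c * a k + b k) n = fun N => c * moment_series a n N + moment_series b n N.
  apply/funext => N; rewrite /moment_series /series /= mulr_sumr -big_split /=.
  by apply: eq_bigr => k _; rewrite mulrDr mulrCA.
by rewrite E.
Qed.

Lemma hilbert_sumZD (c : C) a b z : bounded_coef a -> bounded_coef b ->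
  hilbert_sum (fun k => c * a k + b k) z = c * hilbert_sum a z + hilbert_sum b z.
Proof.
move=> ca cb; rewrite /hilbert_sum; case: asboolP => z1; last by rewrite mulr0 addr0.
have [A aA] := ca; have [B bB] := cb.
have h := power_seriesZD (c := c) (tame_psum (hilbert_coef_tame aA)) (tame_psum (hilbert_coef_tame bB)).
have -> : hilbert_coef (fun k => c * a k + b k) = fun k => c * hilbert_coef a k + hilbert_coef b k.
  by apply/funext => k; rewrite /hilbert_coef moment_pairingZD // mulrDr mulrCA.
by rewrite -(power_seriesE h z1).
Qed.

(* The zero function is a junk value, for coefficients outside the domain. *)
Definition hilbert_bloch a : bloch (alpha - 1) :=
  if pselect (is_bloch (alpha - 1) (hilbert_sum a)) is left h then Bloch (mem_set h) else 0.

Definition radially_bounded a (B : R) :=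
  forall t, 0 <= t < 1 -> normc (psum a t%:C) <= B.

Lemma hilbert_blochE a B : bounded_coef a -> radially_bounded a B -> hilbert_bloch a = hilbert_sum a :> (C -> C).
Proof.
move=> [A aA] aB; rewrite /hilbert_bloch; case: pselect => // h; exfalso; apply: h.
by apply: hilbert_sum_bloch aA _; exists B.
Qed.

Lemma radially_boundedZD (c : C) a b A B : bounded_coef a -> bounded_coef b ->
  radially_bounded a A -> radially_bounded b B ->
  radially_bounded (fun k => c * a k + b k) (normc c * A + B).
Proof.
move=> ca cb aA bB t t01.
have td : unit_disc t%:C.
  by case/andP: t01 => t0 t1; rewrite /unit_disc /mkset normcR ger0_norm.
rewrite psumZD //; apply: le_trans (normcD _ _) _.
by rewrite normcM lerD ?bB // ler_wpM2l ?normc_ge0 ?aA.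
Qed.

Lemma hilbert_blochZD (c : C) a b A B : bounded_coef a -> bounded_coef b ->
  radially_bounded a A -> radially_bounded b B ->
  hilbert_bloch (fun k => c * a k + b k) = c *: hilbert_bloch a + hilbert_bloch b.
Proof.
move=> ca cb aA bB; apply/val_inj/funext => z /=.
rewrite (hilbert_blochE (bounded_coefZD c ca cb) (radially_boundedZD c ca cb aA bB)).
by rewrite /GRing.add /= /GRing.scale /= (hilbert_blochE ca aA) (hilbert_blochE cb bB) hilbert_sumZD.
Qed.

(** The norm on [bloch gamma] takes values in the complex field; this is its underlying real
    number. *)
Definition bnorm (gamma : R) (f : bloch gamma) : R := normc (f 0) + bloch_seminorm gamma f.

Definition hilbert_const : R := K + alpha ^+ 2 / (alpha - 1) * K * 2 `^ (alpha - 1).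

(** The right-hand side involves only the bound on the radius, not the bound on the coefficients.
    Continuity on [coef_class] rests on this. *)
Lemma hilbert_bloch_norm a B : bounded_coef a -> radially_bounded a B ->
  bnorm (hilbert_bloch a) <= hilbert_const * B.
Proof.
move=> ca aB; have [A aA] := ca; rewrite /bnorm (hilbert_blochE ca aB) /hilbert_const mulrDl lerD //.
  exact: hilbert_sum0_le aA _ aB.
by apply: bloch_seminorm_le => z z1; exact: hilbert_sum_weight aA _ _ aB z1.
Qed.

Section Domain.
Variable beta : R.
Hypothesis beta01 : 0 < beta < 1.

Lemma bloch_coef (f : bloch beta) :
  exists2 a, power_series_on_disc a f & forall k, normc (a k) <= bnorm f / (1 - beta).
Proof.
have /andP[b0 b1] := beta01.
have [af ubf zf] := blochP f.
have [a afs ha] := bloch_power_series beta01 af (fun z => bloch_seminorm_ub ubf (z := z)).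
exists a => // k; apply: le_trans (ha k) _; rewrite /bnorm mulrDl lerD2r.
by rewrite ler_pdivlMr ?subr_gt0 // ler_piMr ?normc_ge0 // gerBl ltW.
Qed.

(** A choice of sequence, which by [power_series_inj] is the only one; linearity of [hilbert_op]
    follows from that. *)
Definition coef (f : bloch beta) : nat -> C := s2val (cid2 (bloch_coef f)).

Lemma coefP f : power_series_on_disc (coef f) f.
Proof. by rewrite /coef; case: cid2. Qed.
Arguments coefP : clear implicits.

Lemma coef_le f k : normc (coef f k) <= bnorm f / (1 - beta).
Proof. by rewrite /coef; case: cid2. Qed.

Lemma coef_bounded f : bounded_coef (coef f).
Proof. by exists (bnorm f / (1 - beta)); exact: coef_le. Qed.

Lemma coef_radial f : radially_bounded (coef f) (bnorm f / (1 - beta)).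
Proof.
move=> t /andP[t0 t1]; have /andP[b0 b1] := beta01.
have td : unit_disc t%:C by rewrite /unit_disc /mkset normcR ger0_norm.
rewrite -(power_seriesE (coefP f) td).
have [af ubf zf] := blochP f.
apply: le_trans (bloch_bounded beta01 af (fun z => bloch_seminorm_ub ubf (z := z)) td) _.
rewrite /bnorm mulrDl lerD2r.
by rewrite ler_pdivlMr ?subr_gt0 // ler_piMr ?normc_ge0 // gerBl ltW.
Qed.

Definition hilbert_op (f : bloch beta) : bloch (alpha - 1) := hilbert_bloch (coef f).

Lemma hilbert_op_linear : linear hilbert_op.
Proof.
move=> c f g; rewrite /hilbert_op.
have -> : coef (c *: f + g) = fun k => c * coef f k + coef g k.
  apply: power_series_inj (coefP _) _.
  exact: (power_seriesZD (c := c) (coefP f) (coefP g)).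
exact: hilbert_blochZD (coef_bounded f) (coef_bounded g) (@coef_radial f) (@coef_radial g).
Qed.

Lemma hilbert_op_hilbert : is_hilbert_operator mu alpha hilbert_op.
Proof.
move=> f; rewrite /hilbert_op (hilbert_blochE (coef_bounded f) (@coef_radial f)).
exact: hilbert_sum_hilbert (coef_le f) _ (coefP f).
Qed.

Lemma hilbert_op_bounded : bounded_operator hilbert_op.
Proof.
exists (hilbert_const / (1 - beta))%:C => f.
rewrite -[`|f|]/((bnorm f)%:C) -[`|_|]/((bnorm (hilbert_op f))%:C) -rmorphM lecR.
rewrite mulrAC -mulrA; exact: hilbert_bloch_norm (coef_bounded f) (@coef_radial f).
Qed.

End Domain.

End Operator.

(** * A compact class of coefficient sequences *)

Section CoefficientCompact.
Variable R : realType.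
Local Notation C := (cplx R).
Local Notation "x %:C" := (real_complex R x : C).
Implicit Types (a b : nat -> C) (z : C).

Lemma disc_compact (M : R) : compact [set z : C | normc z <= M].
Proof.
pose f (p : R * R) : C := Complex p.1 p.2.
have sq : compact ((`[- M, M]%classic : set R) `*` (`[- M, M]%classic : set R)).
  by apply: compact_setX; exact: segment_compact.
have cf : continuous f.
  by move=> p; apply: cvgC_ReIm; [exact: cvg_fst|exact: cvg_snd].
have cim := continuous_compact (continuous_subspaceT cf) sq.
apply: subclosed_compact cim _; last first.
  move=> z zM; exists (complex.Re z, complex.Im z); last by case: z zM.
  split; rewrite /= in_itv /= -ler_norml.
    exact: le_trans (Re_le_normc z) zM.
  exact: le_trans (Im_le_normc z) zM.
move=> z zcl; apply/ler_addgt0Pr => e e0 /=.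
have [w [wM zw]] : exists w : C, normc w <= M /\ normc (z - w) <= e.
  have nb : nbhs z [set w : C | normc (z - w) <= e].
    have X : (w : C) @[w --> z] --> z by exact: cvg_id.
    by move/cvg_normcP : X; apply.
  by have [w []] := zcl _ nb; exists w.
rewrite normcB in zw; apply: le_trans (normc_le_dist z w) _.
by rewrite normcB lerD // normcB.
Qed.

Definition coef_box (M : R) : set (prod_topology (fun _ : nat => C)) :=
  [set a | forall k, normc (a k) <= M].

Lemma coef_box_compact (M : R) : compact (coef_box M).
Proof.
exact (@tychonoff nat (fun _ => C) (fun _ => [set z : C | normc z <= M]) (fun _ => disc_compact (M := M))).
Qed.

Lemma coef_nbhs (a : prod_topology (fun _ : nat => C)) N (d : R) : 0 < d ->
  \forall b \near a, forall k, (k < N)%N -> normc (a k - b k) <= d.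
Proof.
move=> d0; have FF : Filter (nbhs a) := nbhs_filter a.
elim: N => [|N ih].
  by apply: (@filterS _ (nbhs a) FF setT); [move=> b _ k|exact: filterT].
have X : b N @[b --> a] --> a N by exact: (@proj_continuous nat (fun _ => C) N a).
have Y : nbhs a (fun b => normc (a N - b N) <= d).
  by move/cvg_normcP : X; apply.
apply: (@filterS2 _ (nbhs a) FF _ _ _ _ ih Y) => b h1 h2 k.
by rewrite ltnS leq_eqVlt => /predU1P[->|/h1].
Qed.

(** The tail beyond [N] is small by the common bound on coefficients; the first [N] differences,
    each at most [e / 2 * (1 - r)], are summed against a geometric series. The form [-1 * b k + a k]
    fits the linearity lemmas. *)
Lemma psum_near (M r e : R) : 0 <= r < 1 -> 0 < e ->
  exists N, exists2 d, 0 < d & forall a b,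
    (forall k, normc (a k) <= M) -> (forall k, normc (b k) <= M) ->
    (forall k, (k < N)%N -> normc (a k - b k) <= d) ->
    forall t, 0 <= t <= r -> normc (psum (fun k => -1 * b k + a k) t%:C) <= e.
Proof.
move=> /andP[r0 r1] e0; have r1' : 0 < 1 - r by rewrite subr_gt0.
have [N hN] : exists N, (M + M) * r ^+ N / (1 - r) <= e / 2.
  have lim : (M + M) * r ^+ N / (1 - r) @[N --> \oo] --> (M + M) * 0 / (1 - r).
    apply: cvgM; last exact: cvg_cst.
    by apply: cvgM; [exact: cvg_cst|apply: cvg_expr; rewrite ger0_norm].
  rewrite mulr0 mul0r in lim.
  have e2 : 0 < e / 2 by rewrite divr_gt0.
  move/cvgrPdist_le : lim => /(_ _ e2)[N _ hN]; exists N.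
  by have := hN N (leqnn N); rewrite sub0r normrN; apply: le_trans; rewrite ler_norm.
exists N, (e / 2 * (1 - r)); first by rewrite mulr_gt0 // divr_gt0.
move=> a b aM bM ab t /andP[t0 tr].
have M0 : 0 <= M by apply: le_trans (aM 0%N); exact: normc_ge0.
have t1 : t < 1 by exact: le_lt_trans r1.
have cM k : normc (-1 * b k + a k) <= M + M.
  by apply: le_trans (normcD _ _) _; rewrite mulN1r normcN lerD.
have t01 : 0 <= t < 1 by rewrite t0.
apply: le_trans (normc_le_dist _ (\sum_(0 <= k < N) (-1 * b k + a k) * t%:C ^+ k)) _.
rewrite [leRHS]splitr lerD //.
  apply: le_trans (normc_le_sum _ _) _.
  apply: (@le_trans _ _ (\sum_(0 <= k < N) e / 2 * (1 - r) * t ^+ k)).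
    rewrite !big_nat; apply: ler_sum => k /= kN.
    rewrite normcM normcX normcR (ger0_norm t0) ler_wpM2r ?exprn_ge0 //.
    by rewrite mulN1r addrC ab.
  rewrite -mulr_sumr -mulrA ger_pMr ?divr_gt0 // mulrC.
  rewrite -ler_pdivlMr //; apply: le_trans (geo_sum_le _ t01) _.
  by rewrite div1r lef_pV2 ?posrE ?subr_gt0 // lerD2l lerN2.
rewrite normcB; apply: le_trans (psum_tail cM N t01) _; apply: le_trans hN.
apply: ler_pM; rewrite ?mulr_ge0 ?addr_ge0 ?exprn_ge0 ?invr_ge0 ?subr_ge0 ?(ltW t1) //.
  by rewrite ler_wpM2l ?addr_ge0 // lerXn2r // nnegrE.
by rewrite lef_pV2 ?posrE ?subr_gt0 // lerD2l lerN2.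
Qed.

Variable beta : R.
Hypothesis beta01 : 0 < beta < 1.

(** Contains the coefficients of a Bloch ball and keeps just two of its features, both stable under
    pointwise limits. The second controls the radius near 1, where pointwise convergence of
    coefficients says nothing. *)
Definition coef_class (M : R) : set (prod_topology (fun _ : nat => C)) :=
  [set a | (forall k, normc (a k) <= M) /\
    forall s t, 0 <= s <= t -> t < 1 ->
      normc (psum a t%:C - psum a s%:C) <= M * (1 - s) `^ (1 - beta)].

Lemma psum_diff a b (t : R) : bounded_coef a -> bounded_coef b -> 0 <= t < 1 ->
  psum (fun k => -1 * b k + a k) t%:C = psum a t%:C - psum b t%:C.
Proof.
move=> ca cb /andP[t0 t1]; rewrite psumZD ?mulN1r 1?addrC //.
by rewrite /unit_disc /mkset normcR ger0_norm.
Qed.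

Lemma closure_coef_nbhs (A : set (prod_topology (fun _ : nat => C))) a N (d : R) :
  closure A a -> 0 < d ->
  exists2 b, A b & forall k, (k < N)%N -> normc (a k - b k) <= d.
Proof. by move=> acl d0; have [b [Ab ab]] := acl _ (coef_nbhs a N d0); exists b. Qed.

Lemma coef_class_compact M : compact (coef_class M).
Proof.
apply: subclosed_compact (coef_box_compact (M := M)) _; last by move=> a [].
move=> a acl.
have abox k : normc (a k) <= M.
  apply/ler_addgt0Pr => e e0; have [b [bM _] ab] := closure_coef_nbhs k.+1 acl e0.
  by apply: le_trans (normc_le_dist _ (b k)) _; rewrite normcB lerD // ab.
split=> // s t /andP[s0 st] t1; apply/ler_addgt0Pr => e e0.
have e20 : 0 < e / 2 by rewrite divr_gt0.
have t01 : 0 <= t < 1 by rewrite (le_trans s0).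
have s01 : 0 <= s < 1 by rewrite s0 (le_lt_trans st).
have [N [d d0 near_ab]] := psum_near M t01 e20.
have [b [bM bs] ab] := closure_coef_nbhs N acl d0.
have dist u : 0 <= u <= t -> normc (psum a u%:C - psum b u%:C) <= e / 2.
  move=> /andP[u0 ut]; have u01 : 0 <= u < 1 by rewrite u0 (le_lt_trans ut).
  rewrite -psum_diff //; [|by exists M..].
  by apply: near_ab => //; rewrite u0.
have := bs s t; rewrite s0 st => /(_ erefl t1) bst.
apply: le_trans (normc_quad _ _ (psum b t%:C) (psum b s%:C)) _; rewrite lerD //.
rewrite (splitr e) lerD //; apply: dist.
  by rewrite lexx (le_trans s0).
by rewrite s0.
Qed.

Lemma coef_class_radial M a : coef_class M a -> radially_bounded a (M + M).
Proof.
move=> [aM as_] t /andP[t0 t1].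
have M0 : 0 <= M by apply: le_trans (aM 0%N); exact: normc_ge0.
have := as_ 0 t; rewrite lexx t0 => /(_ erefl t1).
rewrite subr0 powR1 mulr1 rmorph0 psum_at0 => h.
apply: le_trans (normc_le_dist _ (a 0%N)) _; rewrite normcB.
by rewrite lerD.
Qed.

End CoefficientCompact.

(** * Compactness of the operator *)

Section Compactness.
Variables (R : realType) (mu : {measure set (measurableTypeR R) -> \bar R}).
Variables (alpha beta : R).
Hypothesis alpha2 : 2 <= alpha.
Hypothesis finD : (mu `[0%R, 1%R[%classic < +oo)%E.
Variable K : R.
Hypothesis K0 : 0 < K.
Hypothesis momentK : forall n, moment mu n <= K / (n.+1%:R * n.+2%:R).
Hypothesis beta01 : 0 < beta < 1.
Local Notation C := (cplx R).
Local Notation "x %:C" := (real_complex R x : C).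

Lemma hilbert_const_gt0 : 0 < hilbert_const alpha K.
Proof.
rewrite /hilbert_const ltr_wpDr // mulr_ge0 ?powR_ge0 // mulr_ge0 ?(ltW K0) //.
by rewrite divr_ge0 ?exprn_ge0 // ?subr_ge0; have := alpha2; lra.
Qed.

Lemma small_weight (M e : R) : 0 <= M -> 0 < e ->
  exists2 r, 0 <= r < 1 & M * (1 - r) `^ (1 - beta) <= e.
Proof.
have /andP[b0 b1] := beta01; have b1' : 0 < 1 - beta by rewrite subr_gt0.
move=> M0 e0; have M1 : 0 < M + 1 by rewrite ltr_wpDl.
set x := (e / (M + 1)) `^ (1 - beta)^-1.
have x0 : 0 < x by rewrite powR_gt0 // divr_gt0.
exists (1 - Num.min 1 x).
  by rewrite subr_ge0 ge_min lexx /= gtrBl lt_min ltr01.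
rewrite subKr; apply: (@le_trans _ _ (M * x `^ (1 - beta))).
  rewrite ler_wpM2l // ge0_ler_powR ?(ltW b1') // ?nnegrE ?(ltW x0) ?ge_min ?lexx ?orbT //.
  by rewrite le_min ler01 ltW.
rewrite -powRrM mulVf ?gt_eqF // powRr1; last by rewrite divr_ge0 // ltW.
by rewrite mulrA ler_pdivrMr // mulrC ler_wpM2l ?(ltW e0) // lerDl.
Qed.

Lemma hilbert_bloch_continuous (M : R) : {within coef_class beta M, continuous (hilbert_bloch mu alpha)}.
Proof.
apply/subspace_continuousP => a aM.
apply/cvgrPdist_le => e /lecC_gt0[-> e0]; move: (complex.Re e) e0 => {}e e0.
have [abox as_] := aM.
have M0 : 0 <= M by apply: le_trans (abox 0%N); exact: normc_ge0.
have B0 : 0 < e / hilbert_const alpha K / 2 by rewrite !divr_gt0 // hilbert_const_gt0.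
set B := e / hilbert_const alpha K / 2 in B0.
have [r r01 hr] := small_weight (addr_ge0 M0 M0) B0.
have [N [d d0 near_ab]] := psum_near M r01 B0.
have FF : Filter (nbhs a) := nbhs_filter a.
apply: (@filterS _ (nbhs a) FF _ _ _ (coef_nbhs a N d0)) => b ab bM.
have [bbox bs] := bM.
have ca : bounded_coef a by exists M.
have cb : bounded_coef b by exists M.
(* Up to [r] the two functions are close because finitely many coefficients are. Beyond [r] each
   stays close to its value at [r], by the class condition. This gives [B + B], hence the division
   by 2 in [B]. *)
have rad : radially_bounded (fun k => -1 * b k + a k) (B + B).
  move=> t t01; have /andP[t0 t1] := t01; have [tr|rt] := leP t r.
    apply: (@le_trans _ _ B); last by rewrite lerDl ltW.
    by apply: near_ab => //; rewrite t0.
  have /andP[r0 r1] := r01.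
  rewrite psum_diff //.
  apply: le_trans (normc_quad _ _ (psum a r%:C) (psum b r%:C)) _; rewrite lerD //.
    rewrite -psum_diff //; apply: near_ab => //; by rewrite r0 lexx.
  apply: le_trans hr; rewrite mulrDl lerD //.
    by apply: as_; rewrite ?r0 ?(ltW rt).
  by apply: bs; rewrite ?r0 ?(ltW rt).
have := hilbert_bloch_norm alpha2 finD K0 momentK (bounded_coefZD (-1) cb ca) rad.
rewrite (hilbert_blochZD alpha2 finD K0 momentK (-1) cb ca (coef_class_radial bM) (coef_class_radial aM)).
have E (x y : bloch (alpha - 1)) : (-1 : C) *: x + y = y - x by rewrite scaleN1r [LHS]addrC.
rewrite {}E => h.
rewrite -[`|_|]/((bnorm (hilbert_bloch mu alpha a - hilbert_bloch mu alpha b))%:C) lecR.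
apply: le_trans h _; rewrite /B -splitr mulrC divfK // gt_eqF //; exact: hilbert_const_gt0.
Qed.

Lemma coef_in_class M (f : bloch beta) : bnorm f <= M ->
  coef_class beta (M / (1 - beta)) (coef beta01 f).
Proof.
have /andP[b0 b1] := beta01; have b1' : 0 < 1 - beta by rewrite subr_gt0.
move=> fM; have fM' : bnorm f / (1 - beta) <= M / (1 - beta).
  by rewrite ler_pM2r // invr_gt0.
split=> [k|s t st t1]; first exact: le_trans (coef_le beta01 f k) fM'.
have [af ubf zf] := blochP f; have /andP[s0 st'] := st.
have h := bloch_growth beta01 af (fun z => bloch_seminorm_ub ubf (z := z)) (q := 1) st t1.
rewrite !mulr1 normc1n in h.
have td : unit_disc (t%:C) by rewrite /unit_disc /mkset normcR ger0_norm // (le_trans s0).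
have sd : unit_disc (s%:C) by rewrite /unit_disc /mkset normcR ger0_norm // (le_lt_trans st').
rewrite -(power_seriesE (@coefP _ _ beta01 f) td) -(power_seriesE (@coefP _ _ beta01 f) sd).
apply: le_trans (h (lexx _)) _; rewrite ler_wpM2r ?powR_ge0 // (le_trans _ fM') //.
by rewrite ler_pM2r ?invr_gt0 // lerDr normc_ge0.
Qed.

(** The image of a ball lies in the continuous image of a compact class. That image is compact,
    hence closed in a Hausdorff space, so it also contains the closure. *)
Lemma hilbert_op_compact : compact_operator (hilbert_op mu alpha beta01).
Proof.
move=> A bA; have [M M0 AM] := pinfty_ex_gt0 bA.
have [ME _] := lecC_gt0 M0; rewrite {}ME in AM.
set N := complex.Re M in AM.
have sub : hilbert_op mu alpha beta01 @` A `<=`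
    hilbert_bloch mu alpha @` coef_class beta (N / (1 - beta)).
  move=> _ [f Af <-]; exists (coef beta01 f) => //; apply: coef_in_class.
  by rewrite -lecR; exact: (AM f Af).
have cK := continuous_compact (hilbert_bloch_continuous (M := N / (1 - beta))) (coef_class_compact (beta := beta) (M := N / (1 - beta))).
apply: (subclosed_compact (B := hilbert_bloch mu alpha @` coef_class beta (N / (1 - beta)))).
- exact: closed_closure.
- exact: cK.
apply: subset_trans (closureS sub) _.
have hB : hausdorff_space (bloch (alpha - 1)) by exact: norm_hausdorff.
exact: compact_closed hB cK.
Qed.
End Compactness.

(** * Necessity of the Carleson condition *)

Section Necessity.
Variables (R : realType) (mu : {measure set (measurableTypeR R) -> \bar R}).
Variables (alpha beta : R).
Hypothesis alpha2 : 2 <= alpha.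
Local Notation C := (cplx R).
Local Notation "x %:C" := (real_complex R x : C).

(** The constant function 1 in the representation by functions vanishing off the disc. *)
Definition disc_indicator (z : C) : C := if `[< unit_disc z >] then 1 else 0.

Definition coef1 (k : nat) : C := (k == 0%N)%:R.

Lemma series_coef1 (u : nat -> C) : (fun n => series (fun k => u k * coef1 k) n) @ \oo --> u 0%N.
Proof.
apply: (@cvg_trans _ (cst (u 0%N) @ \oo)); last exact: cvg_cst.
apply: near_eq_cvg; near=> n; rewrite /series /=.
have n0 : (0 < n)%N by near: n; exact: nbhs_infty_gt.
rewrite -(prednK n0) big_nat_recl //= mulr1 big1 ?addr0 // => k _.
by rewrite mulr0.
Unshelve. all: by end_near. Qed.

Lemma disc_indicator_series : power_series_on_disc coef1 disc_indicator.
Proof.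
move=> z z1; rewrite /disc_indicator; case: asboolP => // _.
have := @series_coef1 (fun k => z ^+ k); rewrite expr0.
have -> : (fun k => coef1 k * z ^+ k) = (fun k => z ^+ k * coef1 k).
  by apply/funext => k; rewrite mulrC.
exact.
Qed.

Lemma disc_indicator_bloch : is_bloch beta disc_indicator.
Proof.
have da := power_series_analytic disc_indicator_series; split => //.
  exists 0 => _ [z z1 <-]; rewrite (power_series_derive1 disc_indicator_series z1).
  suff -> : psum (dcoef coef1) z = 0 by rewrite normcC0 mulr0.
  apply: cvg_lim; first exact: norm_hausdorff.
  rewrite (_ : series _ = cst 0); first exact: cvg_cst.
  apply/funext => n; rewrite /series /= big1 // => k _.
  by rewrite /dcoef /coef1 mulr0 mul0r.
by move=> z z1; rewrite /disc_indicator; case: asboolP.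
Qed.

Definition bloch1 : bloch beta := Bloch (mem_set disc_indicator_bloch).

(** Since [gbin alpha 0 = 1], the moment with [n = k = 0] is the total mass, and its finiteness is
    part of being well defined. Uniqueness of the expansion then forces the sequence to be
    [coef1]. *)
Lemma hilbert_image1 g : hilbert_image mu alpha bloch1 g ->
  [/\ (mu `[0%R, 1%R[%classic < +oo)%E,
      power_series_on_disc (fun n => (gbin alpha n * moment mu n)%:C) g
    & analytic_on_disc g].
Proof.
move=> [a [ha hfin _ hg ag]].
have a1 : 1 < alpha by apply: lt_le_trans alpha2; rewrite ltr1n.
have finD : (mu `[0%R, 1%R[%classic < +oo)%E.
  have := hfin 0%N 0%N; rewrite /hilbert_moment Gamma_ratio // gbin0.
  under eq_integral do rewrite addn0 expr0 mulr1.
  by rewrite integral_cst // mul1e ge0_fin_numE.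
split; [exact: finD| |exact: ag].
rewrite (power_series_inj ha disc_indicator_series) in hg.
rewrite (_ : (fun n => _) = (fun n => limn (hilbert_series mu alpha coef1 n))) //.
apply/funext => n; apply/esym/cvg_lim; first exact: norm_hausdorff.
have := @series_coef1 (fun k => (fine (hilbert_moment mu alpha n k))%:C).
rewrite (hilbert_momentE alpha2 finD n 0) addn0 => h.
exact: h.
Qed.

Lemma partial_sum_le_psum (u : nat -> R) (t : R) N : 0 <= t < 1 -> (forall k, 0 <= u k) ->
  tame (fun k => (u k)%:C) ->
  \sum_(0 <= k < N) u k * t ^+ k <= normc (psum (fun k => (u k)%:C) t%:C).
Proof.
move=> /andP[t0 t1] u0 tu.
have td : unit_disc t%:C by rewrite /unit_disc /mkset normcR ger0_norm.
have /cvg_Re h := tame_psum tu td.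
apply: le_trans (le_trans (ler_norm _) (Re_le_normc _)).
have E M : complex.Re (series (fun k => (u k)%:C * t%:C ^+ k) M) = \sum_(0 <= k < M) u k * t ^+ k.
  by rewrite /series /= Re_sum; apply: eq_bigr => k _; rewrite ReZ -rmorphXn.
rewrite (_ : (fun x => _) = series (fun k => u k * t ^+ k)) in h; last exact/funext.
have nd : nondecreasing_seq (series (fun k => u k * t ^+ k)).
  by apply: nondecreasing_series => k _ _; rewrite mulr_ge0 ?exprn_ge0.
rewrite -(cvg_lim (@Rhausdorff R) h).
by have := nondecreasing_cvgn_le nd (cvgP _ h) N.
Qed.

Lemma hilbert_operator_carleson (T : bloch beta -> bloch (alpha - 1)) :
  is_hilbert_operator mu alpha T -> carleson mu 2.
Proof.
move=> hT; have [finD gs ag] := hilbert_image1 (hT bloch1).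
have a0 : 0 < alpha by exact: lt_le_trans alpha2.
set S := bloch_seminorm (alpha - 1) (T bloch1).
have S0 : 0 <= S by apply: bloch_seminorm_ge0; exact: bloch_ub.
pose mass (t : R) := fine (mu `[t, 1%R[%classic).
have mass_fin t : 0 <= t -> mu `[t, 1%R[%classic = (mass t)%:E.
  move=> t0; rewrite /mass fineK // ge0_fin_numE //; apply: le_lt_trans finD.
  by apply: le_measure; rewrite ?inE //; apply: subset_itvr; rewrite bnd_simp.
have mass_ge0 t : 0 <= mass t by exact: fine_ge0.
have mass_le t : 0 <= t -> mass t <= mass 0.
  move=> t0; rewrite -lee_fin -!mass_fin //.
  by apply: le_measure; rewrite ?inE //; apply: subset_itvr; rewrite bnd_simp.
pose u k := alpha * (gbin (alpha + 1) k * moment mu k.+1).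
have dE : dcoef (fun n => (gbin alpha n * moment mu n)%:C) = fun k => (u k)%:C.
  apply/funext => k; rewrite /dcoef /u mulrA gbin_shift ?gt_eqF // -gbinS_mul.
  by rewrite -mulrA [RHS]rmorphM rmorph_nat.
have u0 k : 0 <= u k.
  by rewrite /u !mulr_ge0 ?moment_ge0 ?(ltW a0) ?(ltW (gbin_gt0 _ _)) ?addr_gt0.
have key t : 0 <= t < 1 -> alpha * t * mass t <= 2 * S * (1 - t ^+ 2) ^+ 2.
  move=> t01; have /andP[t0 t1] := t01.
  have td : unit_disc t%:C by rewrite /unit_disc /mkset normcR ger0_norm.
  have w0 : 0 < 1 - t ^+ 2 by rewrite subr_gt0 expr_lt1.
  have := bloch_seminorm_ub (bloch_ub (T bloch1)) td.
  rewrite (power_series_derive1 gs td) dE normcR (ger0_norm t0) => hS.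
  (* The argument is [t ^ 2] because two powers meet: [t ^ k] from evaluating at [t], and
     [t ^ (k + 1)] from the lower bound on the moment; the extra [t] goes to the left-hand side of
     [key]. *)
  have r01 : 0 <= t ^+ 2 < 1 by rewrite exprn_ge0 // expr_lt1.
  have [|N hN] := @gbin_psum_large R (alpha + 1) (t ^+ 2) _ r01; first by rewrite lerDr ltW.
  have tu : tame (fun k => (u k)%:C) by rewrite -dE; apply: tame_dcoef; exact: power_series_tame gs.
  have hu := partial_sum_le_psum N t01 u0 tu.
  have hl : alpha * t * mass t * gbin_psum (alpha + 1) N (t ^+ 2) <= \sum_(0 <= k < N) u k * t ^+ k.
    rewrite /gbin_psum mulr_sumr; apply: ler_sum => k _.
    have mk : t ^+ k.+1 * mass t <= moment mu k.+1.
      by have := moment_ge k.+1 finD t01; rewrite mass_fin // lee_fin.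
    have := ler_wpM2l (mulr_ge0 (mulr_ge0 (ltW a0) (ltW (gbin_gt0 k (addr_gt0 a0 ltr01)))) (exprn_ge0 k t0)) mk.
    rewrite /u exprS -exprM mulnC exprM expr2.
    move: (gbin _ _) (t ^+ k) (mass t) (moment _ _) => p q w v.
    by congr (_ <= _); ring.
  have X0 : 0 <= alpha * t * mass t by rewrite !mulr_ge0 ?(ltW a0).
  have {}hl := le_trans (le_trans (ler_wpM2l X0 hN) hl) hu.
  have := le_trans (ler_wpM2l (powR_ge0 _ (alpha - 1)) hl) hS.
  have -> : (1 - t ^+ 2) `^ (alpha + 1) = (1 - t ^+ 2) `^ (alpha - 1) * (1 - t ^+ 2) ^+ 2.
    move: (1 - t ^+ 2) w0 => w w0.
    rewrite -(powR_mulrn 2 (ltW w0)) -powRD; last by rewrite (gt_eqF w0) implybT.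
    by congr (_ `^ _); ring.
  have : 0 < (1 - t ^+ 2) `^ (alpha - 1) by exact: powR_gt0.
  move: (1 - t ^+ 2) w0 (alpha * t * mass t) => w w0 X; move: (w `^ (alpha - 1)) => p p0.
  have -> : p * (X * ((p * w ^+ 2)^-1 / 2)) = X / (2 * w ^+ 2) by field; rewrite !gt_eqF.
  by rewrite ler_pdivrMr ?mulr_gt0 ?exprn_gt0 // -/S mulrA [S * 2]mulrC.
have S1 : 0 < 16 * S / alpha + 4 * mass 0 + 1.
  by rewrite ltr_wpDl // addr_ge0 ?mulr_ge0 ?invr_ge0 ?(ltW a0).
(* For [t >= 1/2], the 16 combines the 2 of [key], a 2 for removing the factor [t], and
   [(1 + t) ^ 2 <= 4]. For [t < 1/2] the total mass suffices, as [1 <= 4 * (1 - t) ^ 2]. The final 1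
   makes the constant positive. *)
exists (16 * S / alpha + 4 * mass 0 + 1) => // t /andP[t0 t1].
rewrite mass_fin // lee_fin powR_mulrn ?subr_ge0 ?(ltW t1) //.
have q0 : 0 <= (1 - t) ^+ 2 by rewrite exprn_ge0 // subr_ge0 ltW.
have ia0 : 0 <= S / alpha by rewrite divr_ge0 // ltW.
have mc : 0 <= mass 0 by [].
have [th|th] := leP 2^-1 t.
  have t01 : 0 <= t < 1 by rewrite t0.
  have h1 : alpha * mass t <= 2 * (alpha * t * mass t).
    have : 0 <= alpha * mass t * (2 * t - 1).
      by rewrite !mulr_ge0 ?(ltW a0) // subr_ge0 -ler_pdivrMl // mulr1.
    lra.
  have h2 : (1 - t ^+ 2) ^+ 2 <= 4 * (1 - t) ^+ 2.
    have -> : (1 - t ^+ 2) ^+ 2 = (1 + t) ^+ 2 * (1 - t) ^+ 2 by ring.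
    rewrite ler_wpM2r // (_ : 4 = 2 ^+ 2) ?lerXn2r ?nnegrE //; last by ring.
      by rewrite addr_ge0.
    lra.
  have h3 : mass t <= 16 * (S / alpha) * (1 - t) ^+ 2.
    rewrite -(ler_pM2l a0); apply: le_trans h1 _.
    apply: le_trans (ler_wpM2l _ (key t t01)) _ => //.
    have -> : alpha * (16 * (S / alpha) * (1 - t) ^+ 2) = 4 * S * (4 * (1 - t) ^+ 2).
      by field; rewrite gt_eqF.
    have -> : 2 * (2 * S * (1 - t ^+ 2) ^+ 2) = 4 * S * (1 - t ^+ 2) ^+ 2 by ring.
    by rewrite ler_wpM2l // mulr_ge0.
  by apply: le_trans h3 _; rewrite ler_wpM2r // mulrA -addrA lerDl addr_ge0 // mulr_ge0.
apply: le_trans (mass_le _ t0) _.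
have h4 : 1 <= 4 * (1 - t) ^+ 2.
  have : 0 <= (2^-1 - t) * (3 / 2 - t) by rewrite mulr_ge0 //; lra.
  lra.
apply: (@le_trans _ _ (mass 0 * (4 * (1 - t) ^+ 2))).
  by rewrite ler_peMr.
rewrite mulrA ler_wpM2r // [mass 0 * 4]mulrC -addrA addrCA lerDl.
by rewrite addr_ge0 // -mulrA mulr_ge0.
Qed.
End Necessity.

Theorem theorem3p2 (R : realType) (alpha beta : R)
    (mu : {measure set (measurableTypeR R) -> \bar R})
    (halpha : 2 <= alpha) (hbeta : 0 < beta < 1) :
  (hilbert_bounded mu alpha beta (alpha - 1) <->
   hilbert_compact mu alpha beta (alpha - 1)) /\
  (hilbert_compact mu alpha beta (alpha - 1) <-> carleson mu 2).
Proof.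
have suff_c : carleson mu 2 ->
    hilbert_bounded mu alpha beta (alpha - 1) /\ hilbert_compact mu alpha beta (alpha - 1).
  move=> hc; have finD := carleson_finite hc; have [K K0 momentK] := moment_decay hc.
  have hT := hilbert_op_hilbert halpha finD K0 momentK hbeta.
  have bT := hilbert_op_bounded halpha finD K0 momentK hbeta.
  have cT : compact_operator (hilbert_op mu alpha hbeta) := hilbert_op_compact halpha finD K0 momentK (beta01 := hbeta).
  have lT := hilbert_op_linear halpha finD K0 momentK hbeta.
  move: (hilbert_op mu alpha hbeta) hT bT cT lT => T0 hT bT cT lT.
  pose lT' := GRing.isLinear.Build _ _ _ _ _ lT.
  pose T : {linear bloch beta -> bloch (alpha - 1)} := HB.pack T0 lT'.
  split; exists T; split.
  - exact: hT.
  - exact bT.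
  - exact: hT.
  - exact cT.
have nec_b : hilbert_bounded mu alpha beta (alpha - 1) -> carleson mu 2.
  by move=> [T [hT _]]; exact: hilbert_operator_carleson hT.
have nec_c : hilbert_compact mu alpha beta (alpha - 1) -> carleson mu 2.
  by move=> [T [hT _]]; exact: hilbert_operator_carleson hT.
split; split.
- by move=> /nec_b/suff_c[].
- by move=> /nec_c/suff_c[].
- exact: nec_c.
- by move=> /suff_c[].
Qed.
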